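(* Let $\mathcal{C}$ be a cyclic attractor in a general Glass network in $\mathbb{R}^n$. If $\mathcal{C}$ is ideal, then $\mathcal{C}$ has a unique and asymptotically stable periodic orbit. If $\mathcal{C}$ is non-ideal, then one of the following two possibilities holds: (1) $\mathcal{C}$ has a unique and asymptotically stable periodic orbit; (2) all trajectories in $\mathcal{C}$ converge to the spine $\mathcal{S}(\mathcal{C})$ (only degenerate periodic orbits).
   Context: Networks. There are $n$ real variables; the $i$-th one has $J_i\ge 1$ thresholds $\theta_i^1<\dots<\theta_i^{J_i}$; put $\theta_i^0=-\infty$, $\theta_i^{J_i+1}=+\infty$. For $y_i$ not a threshold, $\tilde y_i\in\{0,\dots,J_i\}$ is the index $j$ with $\theta_i^j<y_i<\theta_i^{j+1}$. A region is an open box $\mathcal{O}=\prod_{i=1}^n(\theta_i^{j_i},\theta_i^{j_i+1})$ with $0\le j_i\le J_i$; $\tilde{\mathcal O}=(j_1,\dots,j_n)$. A wall is a set $\prod_{i<m}(\theta_i^{j_i},\theta_i^{j_i+1})\times\{\theta_m^{j_m}\}\times\prod_{i>m}(\theta_i^{j_i},\theta_i^{j_i+1})$ with $1\le j_m\le J_m$, i.e. the common facet of two adjacent regions. A Glass network is a system $\dot y_i=-y_i+F_i(\tilde y_1,\dots,\tilde y_n)$, $1\le i\le n$. The constant vector $f=F(\tilde{\mathcal O})$ is the focal point of $\mathcal O$; inside $\mathcal O$ trajectories are $y(t)=f+(y(0)-f)e^{-t}$. Standing assumption: no coordinate $f_i$ of any focal point equals a threshold $\theta_i^j$. The network is binary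 if $J_i=1$ for all $i$, and is a general Glass network if some $J_i\ge2$. Cycles. A cycle of regions is a sequence of pairwise distinct regions $\mathcal O_1\to\dots\to\mathcal O_k\to\mathcal O_{k+1}=\mathcal O_1$ with consecutive ones adjacent across a wall $\mathcal W_i$ between $\mathcal O_i$ and $\mathcal O_{i+1}$ ($\mathcal W_0=\mathcal W_k$), such that, if $\mathcal W_i$ lies in $\{x_m=\theta_m^j\}$ and $f^i,f^{i+1}$ are the focal points of $\mathcal O_i,\mathcal O_{i+1}$, then $f^i_m,f^{i+1}_m$ are both $>\theta_m^j$ when crossing from $\mathcal O_i$ to $\mathcal O_{i+1}$ increases the $m$-th coordinate, and both $<\theta_m^j$ when it decreases it. On $\mathcal W_i$ the dynamics is the continuous extension of that of $\mathcal O_{i+1}$, so a trajectory reaching $\mathcal W_i$ from $\mathcal O_i$ continues into $\mathcal O_{i+1}$. A cyclic attractor is a cycle of regions, written $\mathcal C=\bigcup_i\mathcal O_i$ (together with the walls $\mathcal W_i$), such that for every $i$ all trajectories starting in $\mathcal O_i$ unambiguously enter $\mathcal O_{i+1}$ next. Its spine is $\mathcal S(\mathcal C)=\bigcap_{i=0}^{k-1}\overline{\mathcal W_i}$; $\mathcal C$ is ideal if $\mathcal S(\mathcal C)=\emptyset$ and non-ideal otherwise. Periodic orbits. A (non-degenerate) periodic orbit of $\mathcal C$ is a closed trajectory of positive period in $\mathcal C$; equivalently it corresponds to a fixed point, in the wall $\mathcal W_0$, of the Poincaré return map $M:\mathcal W_0\to\mathcal W_0$ obtained by following trajectories once around the cycle,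 and (asymptotic) stability of the periodic orbit corresponds to that of the fixed point of $M$ on $\mathcal W_0$. A degenerate periodic orbit is one consisting of a single point of the spine. Trajectories are considered on their maximal forward time interval along the cycle, and convergence to the spine (which may occur in finite time) is meant as time tends to the right end of that interval. *)

(* Defs.v *)
From HB Require Import structures.
From mathcomp Require Import all_boot all_order all_algebra.
From mathcomp Require Import all_classical all_reals all_analysis.

Set Implicit Arguments.
Unset Strict Implicit.
Unset Printing Implicit Defensive.

Import Order.TTheory GRing.Theory Num.Theory.
Import numFieldNormedType.Exports.

Local Open Scope classical_set_scope.
Local Open Scope ring_scope.

(* Variable i has J_i = nthr i thresholds; its j-th threshold is thr i j for
   1 <= j <= nthr i, and the values of thr i at other indices are irrelevant. *)
Record glass_network (R : realType) (n : nat) := GlassNetwork {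
  nthr : 'I_n -> nat;
  thr : 'I_n -> nat -> R;
  focal : {dffun forall i : 'I_n, 'I_(nthr i).+1} -> 'rV[R]_n;
  nthr_gt0 : forall i, (0 < nthr i)%N;
  thr_lt : forall i j, (0 < j < nthr i)%N -> thr i j < thr i j.+1;
  focal_neq_thr : forall a i j, (0 < j <= nthr i)%N -> focal a 0 i != thr i j
}.

Section Network.
Context {R : realType} {n : nat}.
Variable N : glass_network R n.

Definition region_index := {dffun forall i : 'I_n, 'I_(nthr N i).+1}.

Definition general_network := exists i : 'I_n, (2 <= nthr N i)%N.

(* The thresholds completed by theta_i^0 = -oo and theta_i^(J_i + 1) = +oo. *)
Definition ethr (i : 'I_n) (j : nat) : \bar R :=
  (if j == 0%N then -oo else if (j <= nthr N i)%N then (thr N i j)%:E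
   else +oo)%E.

Definition between_thr (i : 'I_n) (j : nat) (x : R) : Prop :=
  (ethr i j < x%:E < ethr i j.+1)%E.

Definition region (a : region_index) : set 'rV[R]_n :=
  [set x | forall i, between_thr i (a i) (x 0 i)].

Definition adjacent_along (m : 'I_n) (a b : region_index) : Prop :=
  (b m = (a m).+1 :> nat \/ a m = (b m).+1 :> nat) /\
  (forall i, i != m -> a i = b i).

(* The common facet of two adjacent regions.  The m-th intervals of indices j
   and j + 1 meet at theta_m^(j + 1), whence the maximum. *)
Definition wall (a b : region_index) : set 'rV[R]_n :=
  [set x | exists m, [/\ adjacent_along m a b,
     x 0 m = thr N m (maxn (a m) (b m)) &
     forall i, i != m -> between_thr i (a i) (x 0 i)]].

Definition crosses (a b : region_index) : Prop :=
  exists m, adjacent_along m a b /\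
    let theta := thr N m (maxn (a m) (b m)) in
    ((a m < b m)%N -> theta < focal a 0 m /\ theta < focal b 0 m) /\
    ((b m < a m)%N -> focal a 0 m < theta /\ focal b 0 m < theta).

Definition is_cycle (k : nat) (O : 'I_k -> region_index) : Prop :=
  [/\ (0 < k)%N, injective O & forall i, crosses (O i) (O (ordS i))].

(* The solution, starting at x, of y' = - y + f. *)
Definition region_flow (f x : 'rV[R]_n) (t : R) : 'rV[R]_n :=
  f + expR (- t) *: (x - f).

(* The trajectory of the first region reaches the wall; by the condition on
   focal points in crosses, it then continues into the second region. *)
Definition enters_next (a b : region_index) : Prop :=
  forall x, region a x -> exists t, [/\ 0 < t,
    forall s, 0 <= s < t -> region a (region_flow (focal a) x s) &
    wall a b (region_flow (focal a) x t)].

Definition cyclic_attractor (k : nat) (O : 'I_k -> region_index) : Prop :=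
  is_cycle O /\ forall i, enters_next (O i) (O (ordS i)).

Section Cycle.
Variables (k : nat) (O : 'I_k -> region_index).

Definition cycle_wall (i : 'I_k) : set 'rV[R]_n := wall (O i) (O (ordS i)).

Definition cycle_set : set 'rV[R]_n :=
  \bigcup_(i in [set: 'I_k]) (region (O i) `|` cycle_wall i).

Definition spine : set 'rV[R]_n :=
  \bigcap_(i in [set: 'I_k]) closure (cycle_wall i).

Definition ideal : Prop := spine = set0.

(* A trajectory along the cycle on the time interval [0, T).  On a wall the
   vector field is that of the region being entered, which gives the right
   derivative there. *)
Definition trajectory (T : \bar R) (y : R -> 'rV[R]_n) : Prop :=
  [/\ (0 < T)%E,
      {within [set t : R | 0 <= t /\ (t%:E < T)%E], continuous y},
      forall t, 0 <= t -> (t%:E < T)%E -> cycle_set (y t),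
      forall t i m, 0 < t -> (t%:E < T)%E -> region (O i) (y t) ->
        is_derive t 1 (fun s => y s 0 m) (- y t 0 m + focal (O i) 0 m) &
      forall t i m, 0 <= t -> (t%:E < T)%E -> cycle_wall i (y t) ->
        h^-1 * (y (t + h) 0 m - y t 0 m) @[h --> 0^'+] -->
          - y t 0 m + focal (O (ordS i)) 0 m].

Definition maximal_trajectory (T : \bar R) (y : R -> 'rV[R]_n) : Prop :=
  trajectory T y /\
  forall T' z, trajectory T' z ->
    (forall t, 0 <= t -> (t%:E < T)%E -> z t = y t) ->
    (T' <= T)%E.

(* Points within distance less than e of the set A. *)
Definition neighborhood (A : set 'rV[R]_n) (e : R) : set 'rV[R]_n :=
  [set x | exists2 p, A p & ball p e x].

Definition converges_to (T : \bar R) (y : R -> 'rV[R]_n) (A : set 'rV[R]_n) :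
    Prop :=
  forall e, 0 < e -> exists t0, [/\ 0 <= t0, (t0%:E < T)%E &
    forall t, t0 <= t -> (t%:E < T)%E -> neighborhood A e (y t)].

(* A periodic orbit is the point set of a closed trajectory of positive period
   in the cycle, hence never a single point of the spine, which is disjoint
   from cycle_set. *)
Definition periodic_orbit (G : set 'rV[R]_n) : Prop :=
  exists y P, [/\ 0 < P, trajectory +oo%E y,
    forall t, 0 <= t -> y (t + P) = y t &
    G = [set y t | t in [set t : R | 0 <= t]]].

(* Orbital asymptotic stability: Lyapunov stability together with local
   attractivity. *)
Definition asymptotically_stable (G : set 'rV[R]_n) : Prop :=
  (forall e, 0 < e -> exists2 d, 0 < d &
     forall T y, maximal_trajectory T y -> neighborhood G d (y 0) ->
       forall t, 0 <= t -> (t%:E < T)%E -> neighborhood G e (y t)) /\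
  (exists2 d, 0 < d &
     forall T y, maximal_trajectory T y -> neighborhood G d (y 0) ->
       converges_to T y G).

Definition unique_stable_periodic_orbit : Prop :=
  exists2 G, unique periodic_orbit G & asymptotically_stable G.

Definition all_converge_to_spine : Prop :=
  forall T y, maximal_trajectory T y -> converges_to T y spine.

End Cycle.
End Network.

(* Main.v *)
Require Import Defs.
From mathcomp Require Import all_boot all_order all_algebra.
From mathcomp Require Import all_classical all_reals all_analysis.
From mathcomp Require Import ring lra zify.

(** Inside a region the flow moves each point along the segment towards the focal
    point, so the map from one wall to the next is fractional linear. Writing a
    point as X / D, a crossing of the threshold theta of the variable m is (X,
    D) |-> (X, D) + w (f, 1), where the weight w = (theta D - X_m) / (f_m -
    theta) is a linear functional of (X, D). Going round the cycle thus becomes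
    a linear map on pairs ([run], [vertex_lift]), and the theorem becomes a
    statement of Perron-Frobenius type about it.

    The positivity comes from the hypothesis that the cycle is an attractor: in
    every coordinate but the one that is crossed next, the focal point of a
    region lies strictly inside the interval of that region ([focal_between]).
    Between two successive crossings of the same variable this expresses the
    second weight as a positive combination of the weights in between and, if
    the two thresholds differ, of the denominator ([weight_recursion]). Hence
    the cone of nonnegative weights, and of nonnegative D if some variable is
    crossed at two thresholds, is invariant, and after three rounds all the
    functionals that define it are comparable ([gauge_harnack]). From such a
    Harnack inequality, Doeblin's contraction argument ([squeezed_contraction])
    gives for each orbit a growth rate Lam and a limit direction ([perron]).

    If Lam > 1 for some orbit, the limit direction yields an eigenvector (xs,
    1), that is a fixed point xs of the return map ([eigenvector]). Along any
    other orbit D grows at least like a multiple of Lam^p, and X - xs D by a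
    geometric factor more slowly ([defect_bound]), which gives global
    attraction to xs and its stability. This case always occurs if some
    variable is crossed at two distinct thresholds, for then the denominator is
    comparable with the weights that it accumulates. If Lam <= 1 for all
    orbits, the weights become negligible with respect to D
    ([subcritical_ratio_small]), so that every crossed coordinate X_m / D tends
    to its unique threshold. In the latter case the cycle is not ideal, because
    pushing the crossed coordinates of any point of a region to their
    thresholds leads to a point of the spine ([spine_point]); moreover the
    distance to the spine then tends to 0.

    It remains to pass from crossing points to trajectories. A trajectory has
    to follow the flows of the successive regions ([follow_region]); in a
    finite time it can make infinitely many crossings only by reaching the
    spine, which is disjoint from the cycle ([reach]); so a maximal trajectory
    makes all its crossings ([maximal_reaches]). As it runs along the polygonal
    line through its crossing points ([on_segment]), its distance to the
    periodic orbit or to the spine is controlled by these points. Compactness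
    of the periodic orbit makes the estimates for stability uniform along it
    ([orbit_stays_close]). *)

Set Implicit Arguments.
Unset Strict Implicit.
Unset Printing Implicit Defensive.

Import Order.TTheory GRing.Theory Num.Theory.
Import numFieldNormedType.Exports.

Local Open Scope classical_set_scope.
Local Open Scope ring_scope.

(** * Geometric estimates for sequences *)

Section Sequences.
Context {R : realType}.
Implicit Types (s : nat -> R) (C q : R).

Lemma geometric_cauchy_cvg s C q : 0 <= q < 1 ->
  (forall p, `|s p.+1 - s p| <= C * q ^+ p) -> exists l : R, s @ \oo --> l.
Proof.
move=> /andP[q0 q1] hs.
have cs : cvgn (series (telescope s)).
  apply: (@normed_cvg _ R^o).
  apply: (@series_le_cvg _ _ (geometric C q)).
  - by move=> n; apply: normr_ge0.
  - by move=> n; apply: le_trans (hs n); apply: normr_ge0.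
  - by move=> n; apply: hs.
  - by apply: is_cvg_geometric_series; rewrite ger0_norm.
have /cvg_ex[l hl] := cs.
exists (s 0%N + l).
have h : (fun p => s 0%N + series (telescope s) p) @ \oo --> s 0%N + l.
  by apply: cvgD; [apply: cvg_cst|apply: hl].
have e : (fun p => s 0%N + series (telescope s) p) = s.
  by apply/funext => p; rewrite -eq_sum_telescope.
by rewrite e in h.
Qed.

Lemma geometric_small C q (e : R) : 0 <= q < 1 -> 0 < e ->
  exists P, forall p, (P <= p)%N -> C * q ^+ p < e.
Proof.
move=> /andP[q0 q1] e0.
have h : (geometric C q) @ \oo --> (0 : R).
  by apply: cvg_geometric; rewrite ger0_norm.
have [P _ hP] := (cvgrPdist_lt _ _).1 h e e0.
exists P => p Pp; have := hP p Pp; rewrite /= sub0r normrN.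
by apply: le_lt_trans; apply: ler_norm.
Qed.

(** Here [z] grows at a rate tending to L <= 1 while [d] accumulates [z]. If
    z / d stayed above [e], then [d] would gain a factor 1 + e at every
    step, more than [z] does, and the ratio would decrease geometrically;
    and once below [e] the ratio cannot climb back, because x / (1 + x)
    increases with x. *)
Lemma subcritical_ratio_small (z d : nat -> R) L C q (e : R) :
  0 <= q < 1 -> L <= 1 -> 0 <= C -> 0 < e ->
  (forall p, 0 < z p) -> (forall p, 0 < d p) ->
  (forall p, d p + z p <= d p.+1) ->
  (forall p, z p.+1 <= (L + C * q ^+ p) * z p) ->
  exists P, forall p, (P <= p)%N -> z p <= e * d p.
Proof.
move=> q01 L1 C0 e0 z0 d0 hd hz.
have e20 : 0 < e / 2 by rewrite divr_gt0.
have [P hP] := geometric_small C q01 e20.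
have hz' p : (P <= p)%N -> z p.+1 <= (1 + e / 2) * z p.
  move=> Pp; apply: le_trans (hz p) _; rewrite ler_pM2r //.
  by have := hP p Pp; lra.
have stay p : (P <= p)%N -> z p <= e * d p -> z p.+1 <= e * d p.+1.
  move=> Pp h; apply: le_trans (hz' p Pp) _.
  have h1 := hd p; have h2 := z0 p.
  suff : (1 + e / 2) * z p <= e * (d p + z p).
    by move=> h3; apply: le_trans h3 _; rewrite ler_pM2l.
  have [e2|e2] := leP e 2; last by nra.
  have : (1 - e/2) * z p <= (1 - e/2) * (e * d p) by apply: ler_wpM2l => //; lra.
  have : 0 <= (e * e / 2) * d p by rewrite mulr_ge0 ?ltW // divr_gt0// mulr_gt0.
  by have := d0 p; nra.
have [[p [Pp hp]]|hno] := pselect (exists p, (P <= p)%N /\ z p <= e * d p).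
  exists p => p' pp'; rewrite -(subnK pp'); elim: (p' - p)%N => [//|i IH].
  by rewrite addSn; apply: stay => //; apply: leq_trans Pp (leq_addl _ _).
exfalso.
have big p : (P <= p)%N -> e * d p < z p.
  by move=> Pp; rewrite ltNge; apply/negP => h; apply: hno; exists p.
(* otherwise the ratio z / d shrinks by the factor g at every step *)
pose g := (1 + e / 2) / (1 + e).
have g0 : 0 < g by rewrite divr_gt0; lra.
have g1 : g < 1 by rewrite ltr_pdivrMr; lra.
have hg p : (P <= p)%N -> z p.+1 * d p <= g * (z p * d p.+1).
  move=> Pp; have hb := big p Pp; have hdp := hd p; have hzp := hz' p Pp.
  have hd1 : (1 + e) * d p <= d p.+1 by lra.
  have -> : g * (z p * d p.+1) = ((1 + e / 2) * z p) * (d p.+1 / (1 + e)).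
    by rewrite /g; field; lra.
  apply: ler_pM => //; [exact: ltW| exact: ltW|].
  by rewrite ler_pdivlMr; lra.
have hi i : z (P + i)%N <= g ^+ i * (z P / d P * d (P + i)%N).
  elim: i => [|i IH].
    by rewrite addn0 expr0 mul1r divfK // gt_eqF.
  rewrite addnS; have h := hg (P + i)%N (leq_addr _ _).
  rewrite -(ler_pM2r (d0 (P + i)%N)); apply: le_trans h _.
  have h2 : z (P + i)%N * d (P + i).+1 <=
      g ^+ i * (z P / d P * d (P + i)%N) * d (P + i).+1.
    by rewrite ler_pM2r.
  apply: le_trans (ler_wpM2l (ltW g0) h2) _.
  by rewrite exprS le_eqVlt; apply/orP; left; apply/eqP; ring.
have g01 : 0 <= g < 1 by rewrite ltW.
have [I hI] := geometric_small (z P / d P) g01 e0.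
have h := hI I (leqnn _); have h2 := hi I; have h3 := big (P + I)%N (leq_addr _ _).
have : e * d (P + I)%N < z P / d P * g ^+ I * d (P + I)%N.
  apply: lt_le_trans h3 _; apply: le_trans h2 _.
  by rewrite le_eqVlt; apply/orP; left; apply/eqP; ring.
by rewrite ltr_pM2r // => /(lt_trans h); rewrite ltxx.
Qed.

End Sequences.

(** * Growth rate and limit direction of a positive linear map *)

Section Perron.
Context {R : realType} {V : lmodType R} {J : finType}.
Variables (j0 : J) (L : V -> V) (ell : J -> V -> R) (kap : R).
Hypothesis linL : forall a u w, L (a *: u + w) = a *: L u + L w.
Hypothesis lin_ell : forall j a u w, ell j (a *: u + w) = a * ell j u + ell j w.
Hypothesis coneL : forall u, (forall j, 0 <= ell j u) -> forall j, 0 <= ell j (L u).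
Hypothesis posL : forall u, (forall j, 0 < ell j u) -> forall j, 0 < ell j (L u).
Hypothesis kap1 : 1 <= kap.
Hypothesis harnack : forall u, (forall j, 0 <= ell j u) ->
  forall i j, ell i (L u) <= kap * ell j (L u).

(** The order of the cone defined by the functionals, made quantitative: in
    that order, a w <= u <= b w. *)
Definition squeezed (a b : R) (w u : V) : Prop :=
  forall j, a * ell j w <= ell j u <= b * ell j w.

(** The proportion of b - a that survives one step of
    [squeezed_contraction]; one factor kap is spent on comparing the
    functionals of w, the other on those of the larger part. *)
Definition rate : R := 1 - (2 * kap ^+ 2)^-1.

Lemma rate_bounds : 0 <= rate < 1.
Proof.
rewrite /rate; have h : 1 <= kap ^+ 2 by rewrite exprn_ege1.
have h2 : 0 < 2 * kap ^+ 2 by lra.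
have h3 : 0 < (2 * kap ^+ 2)^-1 by rewrite invr_gt0.
have h4 : (2 * kap ^+ 2)^-1 <= 1 by rewrite invf_le1 //; lra.
lra.
Qed.

Lemma squeezed_L a b w u : squeezed a b w u -> squeezed a b (L w) (L u).
Proof.
move=> h.
have h1 j : 0 <= ell j (L ((- a) *: w + u)).
  apply: coneL => i; rewrite lin_ell; have /andP[] := h i; lra.
have h2 j : 0 <= ell j (L ((-1) *: u + b *: w + 0)).
  apply: coneL => i; rewrite addr0 lin_ell.
  have -> : ell i (b *: w) = b * ell i w.
    have e0 : ell i 0 = 0.
      by have := lin_ell i (-1) 0 0; rewrite scaler0 addr0; lra.
    by rewrite -[b *: w]addr0 lin_ell e0 addr0.
  have /andP[] := h i; lra.
move=> j; have := h1 j; have := h2 j; rewrite addr0.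
rewrite !linL !lin_ell.
have -> : ell j (L (b *: w)) = b * ell j (L w).
  have L0 : L 0 = 0.
    have := linL (-1) 0 0; rewrite scaler0 addr0 scaleN1r addNr => ->; done.
  have e0 : ell j 0 = 0.
    by have := lin_ell j (-1) 0 0; rewrite scaler0 addr0; lra.
  by rewrite -[b *: w]addr0 linL L0 addr0 -[_ *: L w]addr0 lin_ell e0 addr0.
move=> x y; apply/andP; split; lra.
Qed.

(** Doeblin's argument. The parts u - a w and b w - u of (b - a) w lie in
    the cone, and L makes all functionals of either part comparable. The
    part with the larger image therefore dominates a fixed fraction of (b -
    a) L w, so that one of the two bounds can be moved by that fraction. *)
Lemma squeezed_contraction a b w u : a <= b -> (forall j, 0 <= ell j w) ->
  squeezed a b w u ->
  exists a' b', [/\ a <= a', a' <= b', b' <= b, b' - a' <= rate * (b - a) &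
    squeezed a' b' (L w) (L u)].
Proof.
move=> ab w0 h; have hL := squeezed_L h.
have k0 : 0 < kap by apply: lt_le_trans ltr01 kap1.
have c1 j : 0 <= ell j ((- a) *: w + u).
  by rewrite lin_ell; have /andP[] := h j; lra.
have c2 j : 0 <= ell j ((- b) *: w + u) * -1.
  by rewrite lin_ell; have /andP[] := h j; lra.
have e0 i : ell i 0 = 0.
  by have := lin_ell i (-1) 0 0; rewrite scaler0 addr0; lra.
have eZ i c x : ell i (c *: x) = c * ell i x.
  by rewrite -[c *: x]addr0 lin_ell e0 addr0.
have L0 : L 0 = 0.
  have := linL (-1) 0 0; rewrite scaler0 addr0 scaleN1r addNr => ->; done.
have LZ c x : L (c *: x) = c *: L x.
  by rewrite -[c *: x]addr0 linL L0 addr0.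
have c2' j : 0 <= ell j ((-1) *: ((- b) *: w + u)) by rewrite eZ mulrC.
have H1 := harnack c1; have H2 := harnack c2'.
have Hw := harnack w0.
set u1 := (- a) *: w + u in c1 H1; set u2 := (-1) *: ((- b) *: w + u) in c2' H2.
have E1 j : ell j (L u1) = ell j (L u) - a * ell j (L w).
  by rewrite /u1 linL lin_ell; ring.
have E2 j : ell j (L u2) = b * ell j (L w) - ell j (L u).
  by rewrite /u2 LZ eZ linL lin_ell; ring.
pose eps : R := (2 * kap ^+ 2)^-1.
have hk2 : 0 < kap ^+ 2 by rewrite exprn_gt0.
have eps0 : 0 < eps by rewrite invr_gt0; lra.
have eps1 : eps <= 1.
  by rewrite invf_le1; have := exprn_ege1 2 kap1; lra.
have epsE : eps * (2 * kap * kap) = 1.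
  by rewrite /eps expr2; field; lra.
have hb : 0 <= eps * (b - a) by rewrite mulr_ge0 ?subr_ge0 ?(ltW eps0).
have key (v : V) : (forall i j, ell i (L v) <= kap * ell j (L v)) ->
   (b - a) * ell j0 (L w) <= 2 * ell j0 (L v) ->
   forall j, eps * (b - a) * ell j (L w) <= ell j (L v).
  move=> Hv hv j.
  have s1 : eps * (b - a) * ell j (L w) <= eps * (b - a) * (kap * ell j0 (L w)).
    by apply: ler_wpM2l.
  apply: le_trans s1 _.
  have s2 : eps * kap * ((b - a) * ell j0 (L w)) <= eps * kap * (2 * ell j0 (L v)).
    by apply: ler_wpM2l => //; rewrite mulr_ge0 ?ltW.
  have s3 : eps * kap * (2 * ell j0 (L v)) <= eps * kap * (2 * (kap * ell j (L v))).
    by apply: ler_wpM2l; [rewrite mulr_ge0 ?ltW|rewrite ler_pM2l // Hv].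
  have s4 : eps * kap * (2 * (kap * ell j (L v))) = ell j (L v).
    transitivity (eps * (2 * kap * kap) * ell j (L v)); first by ring.
    by rewrite epsE mul1r.
  by rewrite -s4; apply: le_trans s3; apply: le_trans s2; rewrite le_eqVlt; apply/orP; left; apply/eqP; ring.
have [le12|/ltW le12] := leP (ell j0 (L u2)) (ell j0 (L u1)).
  have hk : (b - a) * ell j0 (L w) <= 2 * ell j0 (L u1).
    by move: le12; rewrite E1 E2; lra.
  exists (a + eps * (b - a)), b; split => //.
  - by rewrite lerDl.
  - by nra.
  - by rewrite /rate -/eps; lra.
  - move=> j; have /andP[_ ->] := hL j; rewrite andbT.
    have := key _ H1 hk j; rewrite E1; lra.
have hk : (b - a) * ell j0 (L w) <= 2 * ell j0 (L u2).
  by move: le12; rewrite E1 E2; lra.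
exists a, (b - eps * (b - a)); split => //.
- by nra.
- by rewrite gerBl.
- by rewrite /rate -/eps; lra.
- move=> j; have /andP[-> _] := hL j; rewrite /=.
  have := key _ H2 hk j; rewrite E2; lra.
Qed.

Lemma cone_iter u p : (forall j, 0 <= ell j u) ->
  forall j, 0 <= ell j (iter p L u).
Proof. by move=> h; elim: p => [//|p IH] /=; apply: coneL. Qed.

Lemma squeezed_iter a b w u p : squeezed a b w u ->
  squeezed a b (iter p L w) (iter p L u).
Proof. by move=> h; elim: p => [//|p IH] /=; apply: squeezed_L. Qed.

(** The bounds of step [p] remain valid at all later steps. This makes the
    ratios of functionals along an orbit Cauchy sequences. *)
Lemma squeezed_nested a b w u p : a <= b -> (forall j, 0 <= ell j w) ->
  squeezed a b w u ->
  exists a' b', [/\ a <= a', a' <= b', b' <= b, b' - a' <= rate ^+ p * (b - a) &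
    forall p', (p <= p')%N -> squeezed a' b' (iter p' L w) (iter p' L u)].
Proof.
move=> ab w0 h.
suff [a' [b' [h1 h2 h3 h4 h5]]] : exists a' b', [/\ a <= a', a' <= b', b' <= b,
    b' - a' <= rate ^+ p * (b - a) &
    squeezed a' b' (iter p L w) (iter p L u)].
  exists a', b'; split => // p' pp'; rewrite -(subnK pp') !iterD.
  exact: squeezed_iter.
elim: p => [|p [a' [b' [h1 h2 h3 h4 h5]]]].
  by exists a, b; split => //; rewrite expr0 mul1r.
have [a2 [b2 [g1 g2 g3 g4 g5]]] := squeezed_contraction h2 (cone_iter p w0) h5.
exists a2, b2; split => //; [exact: le_trans g1|exact: le_trans h3|].
apply: le_trans g4 _; rewrite exprS -mulrA ler_wpM2l //.
by have /andP[] := rate_bounds.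
Qed.

Lemma squeezed_exists w u : (forall j, 0 < ell j w) -> (forall j, 0 < ell j u) ->
  exists a b, [/\ 0 < a, a <= b & squeezed a b w u].
Proof.
move=> w0 u0.
pose c := \sum_j ell j w / ell j u; pose b := \sum_j ell j u / ell j w.
have hc j : ell j w / ell j u <= c.
  rewrite /c (bigD1 j) //= lerDl sumr_ge0 // => i _.
  by rewrite divr_ge0 ?ltW.
have hb j : ell j u / ell j w <= b.
  rewrite /b (bigD1 j) //= lerDl sumr_ge0 // => i _.
  by rewrite divr_ge0 ?ltW.
have c0 : 0 < c by apply: lt_le_trans (hc j0); rewrite divr_gt0.
have hs : squeezed c^-1 b w u.
  move=> j; have := hc j; have := hb j.
  rewrite !ler_pdivrMr // => h1 h2; rewrite h1 andbT.
  by rewrite ler_pdivrMl.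
exists c^-1, b; split => //; first by rewrite invr_gt0.
by have /andP[h1 h2] := hs j0; have := le_trans h1 h2; rewrite ler_pM2r.
Qed.

(** Perron-Frobenius for the orbit of [u]. Comparing the orbit with its own
    shift, that is squeezing L u by u, shows that the growth ratios along
    all functionals lie in nested intervals of geometrically decreasing
    length; their common limit is [Lam]. *)
Lemma perron u : (forall j, 0 < ell j u) ->
  exists Lam C (r : J -> R), [/\ 0 <= C,
    forall j, 0 < r j,
    forall j, (fun p => ell j (iter p L u) / ell j0 (iter p L u)) @ \oo --> r j,
    forall p j, 0 < ell j (iter p L u) &
    forall p j, `|ell j (iter p.+1 L u) - Lam * ell j (iter p L u)|
      <= C * rate ^+ p * ell j (iter p L u)].
Proof.
move=> u0; have k0 : 0 < kap by apply: lt_le_trans ltr01 kap1.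
have pos p j : 0 < ell j (iter p L u).
  by elim: p j => [//|p IH] /=; apply: posL.
have u0w j : 0 <= ell j u by apply: ltW.
have [a [b [a0 ab hab]]] := squeezed_exists u0 (pos 1%N).
have /andP[q0 q1] := rate_bounds.
pose x p j := ell j (iter p L u).
have near p : exists a' b', [/\ a <= a', b' <= b, b' - a' <= (b - a) * rate ^+ p &
    forall p' j, (p <= p')%N -> a' <= x p'.+1 j / x p' j <= b'].
  have [a' [b' [h1 h2 h3 h4 h5]]] := squeezed_nested p ab u0w hab.
  exists a', b'; split => //; first by rewrite mulrC.
  move=> p' j pp'; have := h5 p' pp' j; rewrite /= -iterSr /= => /andP[y1 y2].
  by rewrite /x ler_pdivlMr ?pos // ler_pdivrMr ?pos //= y1.
pose g p := x p.+1 j0 / x p j0.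
have g_diff p p' i j : (p <= p')%N ->
    `|x p.+1 i / x p i - x p'.+1 j / x p' j| <= (b - a) * rate ^+ p.
  move=> pp'; have [a' [b' [h1 h2 h3 h4]]] := near p.
  have /andP[y1 y2] := h4 p i (leqnn _); have /andP[y3 y4] := h4 p' j pp'.
  by rewrite ler_norml; apply/andP; split; lra.
have [Lam hLam] : exists l : R, g @ \oo --> l.
  apply: (@geometric_cauchy_cvg _ _ (b - a) rate); first by rewrite q0.
  by move=> p; rewrite distrC; apply: g_diff.
have ratioL p j : `|x p.+1 j / x p j - Lam| <= (b - a) * rate ^+ p.
  have hc : (fun p' => `|x p.+1 j / x p j - g p'|) @ \oo --> `|x p.+1 j / x p j - Lam|.
    by apply: cvg_norm; apply: cvgB => //; apply: cvg_cst.
  have [] := near p => a' [b' [h1 h2 h3 h4]].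
  rewrite -(cvg_lim _ hc) //; apply: limr_le; first by apply/cvg_ex; eexists; exact: hc.
  by exists p => // p' pp'; apply: g_diff.
have [M [M0 HM]] : exists M, 0 < M /\ forall p j, x p j / x p j0 <= M.
  exists (kap + \sum_j x 0%N j / x 0%N j0); split.
    by rewrite ltr_wpDr // sumr_ge0 // => j _; rewrite divr_ge0 ?ltW ?pos.
  move=> [|p] j.
    rewrite (bigD1 j) //= addrCA lerDl addr_ge0 ?(ltW k0) //.
    by apply: sumr_ge0 => i _; rewrite divr_ge0 ?ltW ?pos.
  apply: ler_wpDr; first by apply: sumr_ge0 => i _; rewrite divr_ge0 ?ltW ?pos.
  rewrite ler_pdivrMr ?pos //; apply: harnack => i; exact: ltW (pos _ _).
have ratio_ge p j : a <= x p.+1 j / x p j.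
  have := squeezed_iter p hab j; rewrite -iterSr => /andP[h _].
  by rewrite ler_pdivlMr // pos.
have r_diff j p : `|x p.+1 j / x p.+1 j0 - x p j / x p j0| <= (M * (b - a) / a) * rate ^+ p.
  have -> : x p.+1 j / x p.+1 j0 - x p j / x p j0 =
     x p j / x p j0 * ((x p.+1 j / x p j - x p.+1 j0 / x p j0) / (x p.+1 j0 / x p j0)).
    by field; rewrite !gt_eqF ?pos.
  have gp : 0 < x p.+1 j0 / x p j0 by rewrite divr_gt0 ?pos.
  have M0' : 0 <= x p j / x p j0 by rewrite divr_ge0 ?ltW ?pos.
  rewrite normrM (ger0_norm M0') normf_div (gtr0_norm gp).
  have -> : M * (b - a) / a * rate ^+ p = M * ((b - a) * rate ^+ p / a) by ring.
  apply: ler_pM => //; first by rewrite divr_ge0 // ltW.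
  apply: ler_pM => //; first by rewrite invr_ge0 ltW.
    exact: g_diff.
  by rewrite lef_pV2 ?posrE // ratio_ge.
have cvr j : exists r : R, (fun p => x p j / x p j0) @ \oo --> r.
  by apply: (@geometric_cauchy_cvg _ _ (M * (b - a) / a) rate); rewrite ?q0.
have [r hr] := choice cvr.
have r0 j : kap^-1 <= r j.
  rewrite -(cvg_lim _ (hr j)) //; apply: limr_ge; first by apply/cvg_ex; exists (r j).
  exists 1%N => // -[//|p] _ /=.
  rewrite ler_pdivlMr ?pos // ler_pdivrMl //; apply: harnack => i; exact: ltW (pos _ _).
exists Lam, (b - a), r; split => //.
- by rewrite subr_ge0.
- by move=> j; apply: lt_le_trans (r0 j); rewrite invr_gt0.
- move=> p j; have h := ratioL p j; have xp := pos p j.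
  have -> : ell j (iter p.+1 L u) - Lam * ell j (iter p L u) =
      (x p.+1 j / x p j - Lam) * x p j.
    by rewrite mulrBl divfK // gt_eqF.
  by rewrite normrM (gtr0_norm xp) ler_pM2r.
Qed.

End Perron.
(** * The linear lift of a cyclic sequence of crossings *)

Section Lift.
Context {R : realType} {n : nat}.

Definition state : Type := ('rV[R]_n * R^o)%type.

Variables (k : nat) (cvar : nat -> 'I_n) (cthr cside : nat -> R) (cfoc : nat -> 'rV[R]_n).

Definition dir (p : nat) : state := (cfoc p, 1).

(** The multiple of the direction (f, 1) that brings the point X / D to the
    threshold of the [p]-th crossing. By linearity the value makes sense for
    all states, including those with D <= 0. *)
Definition step_weight (p : nat) (u : state) : R :=
  (cthr p * u.2 - u.1 0 (cvar p)) / (cfoc p 0 (cvar p) - cthr p).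

Fixpoint run (u : state) (p : nat) : state :=
  if p is p'.+1 then run u p' + step_weight p' (run u p') *: dir p' else u.

Arguments run : simpl never.

Definition weight (u : state) (p : nat) : R := step_weight p (run u p).

Lemma step_weight_lin p a u w : step_weight p (a *: u + w) = a * step_weight p u + step_weight p w.
Proof. by rewrite /step_weight /= !mxE /= /GRing.scale /=; ring. Qed.

Lemma run_lin a u w p : run (a *: u + w) p = a *: run u p + run w p.
Proof.
elim: p => [//|p IH]; rewrite /run -/run IH step_weight_lin scalerDl scalerDr scalerA.
by rewrite -!addrA; congr (_ + _); rewrite addrCA.
Qed.

Lemma weight_lin a u w p : weight (a *: u + w) p = a * weight u p + weight w p.
Proof. by rewrite /weight run_lin step_weight_lin. Qed.

Lemma run_snd u p : (run u p.+1).2 = (run u p).2 + weight u p.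
Proof. by rewrite /run -/run /= /GRing.scale /= mulr1. Qed.

Lemma run_fst u p l : (run u p.+1).1 0 l = (run u p).1 0 l + weight u p * cfoc p 0 l.
Proof. by rewrite /run -/run /= !mxE. Qed.

(** Evolution of the functional X_l - y D; with y a threshold of the
    variable [l], it vanishes right after each crossing of that threshold. *)
Lemma run_sum u l y q p : (q <= p)%N ->
  (run u p).1 0 l - y * (run u p).2 =
  (run u q).1 0 l - y * (run u q).2 + \sum_(q <= r < p) (cfoc r 0 l - y) * weight u r.
Proof.
move=> qp; rewrite -(subnK qp) addnC; elim: (p - q)%N => [|d IH].
  by rewrite addn0 big_geq // addr0.
rewrite addnS big_nat_recr ?leq_addr // addrA -IH.
by rewrite run_fst run_snd; ring.
Qed.

Lemma run_sum_snd u q p : (q <= p)%N ->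
  (run u p).2 = (run u q).2 + \sum_(q <= r < p) weight u r.
Proof.
move=> qp; rewrite -(subnK qp) addnC; elim: (p - q)%N => [|d IH].
  by rewrite addn0 big_geq // addr0.
by rewrite addnS big_nat_recr ?leq_addr //= addrA -IH -run_snd.
Qed.

Hypothesis k0 : (0 < k)%N.
Hypothesis cvar_per : forall p, cvar (p + k) = cvar p.
Hypothesis cthr_per : forall p, cthr (p + k) = cthr p.
Hypothesis cfoc_per : forall p, cfoc (p + k) = cfoc p.
(** The four assumptions are stated for signs, since a variable may be
    crossed upwards or downwards: the focal point of a crossing lies beyond
    its threshold; between two successive crossings of one variable the
    focal points do not go beyond the threshold of the second; nor does the
    threshold of the first; and two immediately successive crossings of one
    variable are at distinct thresholds. *)
Hypothesis beyond : forall p, 0 < cside p * (cfoc p 0 (cvar p) - cthr p).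
Hypothesis inward : forall q r p, (q < r < p)%N -> cvar q = cvar p ->
  (forall s, (q < s < p)%N -> cvar s <> cvar p) ->
  0 < cside p * (cthr p - cfoc r 0 (cvar p)).
Hypothesis forward : forall q p, (q < p)%N -> cvar q = cvar p ->
  (forall s, (q < s < p)%N -> cvar s <> cvar p) -> 0 <= cside p * (cthr p - cthr q).
Hypothesis no_return : forall p, cvar p.+1 = cvar p ->
  0 < cside p.+1 * (cthr p.+1 - cthr p).

Definition multi : Prop := exists p q, cvar p = cvar q /\ cthr p <> cthr q.

Lemma beyond_neq0 p : cfoc p 0 (cvar p) - cthr p != 0.
Proof. by have := beyond p; case: eqP => // ->; rewrite mulr0 ltxx. Qed.

Lemma run_exit u p : (run u p.+1).1 0 (cvar p) = cthr p * (run u p.+1).2.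
Proof.
rewrite run_fst run_snd /weight /step_weight; have := beyond_neq0 p => h.
by field.
Qed.

Lemma cvar_sub p : (k <= p)%N -> cvar (p - k) = cvar p.
Proof. by move=> kp; rewrite -[in RHS](subnK kp) cvar_per. Qed.

Lemma cthr_sub p : (k <= p)%N -> cthr (p - k) = cthr p.
Proof. by move=> kp; rewrite -[in RHS](subnK kp) cthr_per. Qed.

(** Going back one round always finds an earlier crossing of the same
    variable. *)
Lemma previous p : (k <= p)%N -> exists q, [/\ (p - k <= q)%N, (q < p)%N,
  cvar q = cvar p & forall s, (q < s < p)%N -> cvar s <> cvar p].
Proof.
move=> kp.
have h : exists q, (q < p)%N && (cvar q == cvar p).
  by exists (p - k)%N; rewrite ltn_subrL k0 (leq_trans k0 kp) cvar_sub /=.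
have ub q : (q < p)%N && (cvar q == cvar p) -> (q <= p)%N.
  by case/andP => /ltnW.
case: (ex_maxnP h ub) => q /andP[qp /eqP e] qmax.
exists q; split => //.
  by apply: qmax; rewrite ltn_subrL k0 (leq_trans k0 kp) cvar_sub /=.
move=> s /andP[qs sp] es; have := qmax s; rewrite sp es eqxx => /(_ isT).
by rewrite leqNgt qs.
Qed.

(** Just after the previous crossing [q] of its variable, X_m equals cthr q
    * D; from there on X_m - cthr p * D changes only through the weights in
    between. The denominator enters with the difference of the two
    thresholds, which is positive if q is immediately before p and zero
    without multiple thresholds. *)
Lemma weight_recursion p : (k <= p)%N -> exists q b (c : nat -> R),
  [/\ (q < p)%N, 0 <= b, (forall r, (q < r < p)%N -> 0 < c r),
      (q.+1 = p -> 0 < b) & (~ multi -> b = 0)] /\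
  forall u, weight u p = b * (run u q.+1).2 + \sum_(q.+1 <= r < p) c r * weight u r.
Proof.
move=> kp; have [q [pkq qp eqp hq]] := previous kp.
pose g := cside p * (cfoc p 0 (cvar p) - cthr p).
have g0 : 0 < g by apply: beyond.
exists q, (cside p * (cthr p - cthr q) / g), (fun r => cside p * (cthr p - cfoc r 0 (cvar p)) / g).
split; [split => //|].
- by rewrite divr_ge0 ?(ltW g0) // forward.
- by move=> r hr; rewrite divr_gt0 // (inward hr).
- move=> e; rewrite divr_gt0 //; subst p; apply: no_return; exact/esym.
- move=> nm; have -> : cthr p = cthr q; last by rewrite subrr mulr0 mul0r.
  by apply: contrapT => hn; apply: nm; exists p, q.
- move=> u; have h := run_sum u (cvar p) (cthr p) qp.
  have hx := run_exit u q; rewrite eqp in hx; rewrite hx in h.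
  have s0 : cside p != 0 by have := g0; rewrite /g; case: eqP => // ->; rewrite mul0r ltxx.
  have -> : weight u p = - cside p * ((run u p).1 0 (cvar p) - cthr p * (run u p).2) / g.
    by rewrite /weight /step_weight /g; have := beyond_neq0 p => h0; field; rewrite ?s0 ?h0.
  rewrite h mulrDr mulrDl mulr_sumr mulr_suml; congr (_ + _); first by ring.
  by apply: eq_bigr => r _; ring.
Qed.

(** The sign of the denominator matters only where it enters the recursion,
    that is with multiple thresholds. Without them, requiring it would spoil
    the comparability of the functionals, since D may dwarf the weights. *)
Definition cone (u : state) : Prop :=
  (forall p, 0 <= weight u p) /\ (multi -> 0 <= u.2).

Lemma run_snd_ge0 u p : (forall r, (r < p)%N -> 0 <= weight u r) -> 0 <= u.2 ->
  0 <= (run u p).2.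
Proof.
elim: p => [//|p IH] h u0; rewrite run_snd addr_ge0 ?h //.
by apply: IH => // r rp; apply: h; apply: ltnW.
Qed.

(** The recursion propagates nonnegativity from one round to all later
    crossings. *)
Lemma cone_fin u : (forall p, (p < k)%N -> 0 <= weight u p) -> (multi -> 0 <= u.2) ->
  cone u.
Proof.
move=> h0 hm; split => // p; elim/ltn_ind: p => p IH.
have [pk|kp] := ltnP p k; first exact: h0.
have [q [b [c [[qp b0 c0 _ bm] ->]]]] := weight_recursion kp.
apply: addr_ge0.
  have [m|nm] := pselect multi; last by rewrite bm // mul0r.
  apply: mulr_ge0 => //; apply: run_snd_ge0; last exact: hm.
  by move=> r rq; apply: IH; apply: leq_trans rq _.
rewrite big_nat; apply: sumr_ge0 => r /andP[qr rp].
by apply: mulr_ge0; [apply: ltW; apply: c0; rewrite qr|apply: IH].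
Qed.

Lemma cone_pos u : (forall p, (p < k)%N -> 0 < weight u p) -> (multi -> 0 < u.2) ->
  forall p, 0 < weight u p.
Proof.
move=> h0 hm; have [hc _] : cone u.
  by apply: cone_fin => [p pk|m]; apply: ltW; [apply: h0|apply: hm].
elim/ltn_ind => p IH.
have [pk|kp] := ltnP p k; first exact: h0.
have [q [b [c [[qp b0 c0 bq bm] ->]]]] := weight_recursion kp.
have D0 : multi -> 0 < (run u q.+1).2.
  move=> m; rewrite (@run_sum_snd u 0) //; apply: ltr_wpDr; last exact: hm.
  by apply: sumr_ge0 => r _; apply: hc.
have S0 : 0 <= \sum_(q.+1 <= r < p) c r * weight u r.
  rewrite big_nat; apply: sumr_ge0 => r /andP[qr rp].
  by apply: mulr_ge0; [apply: ltW; apply: c0; rewrite qr|].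
have [e|ne] := eqVneq q.+1 p.
  have bp := bq e; have m : multi by apply: contrapT => /bm e0; move: bp; rewrite e0 ltxx.
  by apply: ltr_wpDr => //; apply: mulr_gt0 => //; apply: D0.
apply: ltr_wpDl.
  have [m|nm] := pselect multi; last by rewrite bm // mul0r.
  by apply: mulr_ge0 => //; apply/ltW/D0.
have qp' : (q.+1 < p)%N by rewrite ltn_neqAle ne.
case: p qp' IH c0 {kp qp bq ne} S0 => // p qp' IH c0 S0.
rewrite big_nat_recr //=; apply: ltr_wpDl.
  rewrite big_nat; apply: sumr_ge0 => r /andP[qr rp].
  by apply: mulr_ge0; [apply: ltW; apply: c0; rewrite qr (ltn_trans rp)|].
by apply: mulr_gt0; [apply: c0; rewrite -ltnS qp' /=|apply: IH].
Qed.

(** * Comparison of the weights of one orbit *)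

(** In the recursion for the weight p + 1, either the weight p has a
    positive coefficient, or p is itself the previous crossing of the same
    variable and then the denominator, which contains the weight p, does. *)
Lemma weight_le_next p : (k <= p.+1)%N ->
  exists2 C : R, 0 <= C & forall u, cone u -> weight u p <= C * weight u p.+1.
Proof.
move=> kp; have [q [b [c [[qp b0 c0 bq bm] hT]]]] := weight_recursion kp.
have [e|ne] := eqVneq q.+1 p.+1.
  have bp := bq e; have m : multi by apply: contrapT => /bm e0; move: bp; rewrite e0 ltxx.
  exists b^-1; first by rewrite invr_ge0.
  move=> u [hc hm]; rewrite ler_pdivlMl // hT e [X in _ + X]big_geq // addr0 ler_pM2l //.
  by rewrite run_snd lerDr; apply: run_snd_ge0 => //; apply: hm.
have qp' : (q < p)%N by rewrite -ltnS ltn_neqAle ne.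
have cp : 0 < c p by apply: c0; rewrite qp' /=.
exists (c p)^-1; first by rewrite invr_ge0 ltW.
move=> u [hc hm]; rewrite ler_pdivlMl // hT big_nat_recr //= addrA lerDr.
apply: addr_ge0.
  have [m|nm] := pselect multi; last by rewrite bm // mul0r.
  by apply: mulr_ge0 => //; apply: (@run_snd_ge0 u q.+1) => //; apply: hm.
rewrite big_nat; apply: sumr_ge0 => r /andP[qr rp].
by apply: mulr_ge0; [apply: ltW; apply: c0; rewrite qr (ltn_trans rp)|].
Qed.

(** One full round back the same variable was crossed at the same threshold,
    so that the denominator cancels and only the weights of the last round
    remain, with coefficients of arbitrary sign. *)
Lemma weight_le_window p : (k <= p)%N ->
  exists2 C : R, 0 <= C & forall u, cone u -> weight u p <= C * \sum_((p - k).+1 <= r < p) weight u r.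
Proof.
move=> kp; pose q := (p - k)%N.
have qp : (q < p)%N by rewrite ltn_subrL k0 (leq_trans k0 kp).
have eqp : cvar q = cvar p by rewrite cvar_sub.
have tqp : cthr q = cthr p by rewrite cthr_sub.
pose g := cfoc p 0 (cvar p) - cthr p.
pose S := \sum_(q.+1 <= r < p) `|cfoc r 0 (cvar p) - cthr p|.
exists (S / `|g|).
  by rewrite divr_ge0 // sumr_ge0.
move=> u [hc _]; have h := run_sum u (cvar p) (cthr p) qp.
have hx := run_exit u q; rewrite eqp tqp in hx; rewrite hx subrr add0r in h.
have g0 : 0 < `|g| by rewrite normr_gt0 beyond_neq0.
rewrite mulrAC ler_pdivlMr // -[weight u p]ger0_norm // -normrM.
have -> : weight u p * g = - ((run u p).1 0 (cvar p) - cthr p * (run u p).2).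
  by rewrite /weight /step_weight /g divfK ?beyond_neq0 // opprB.
rewrite h normrN; apply: le_trans (ler_norm_sum _ _ _) _.
rewrite mulr_suml !big_nat; apply: ler_sum => r hr.
rewrite normrM ler_wpM2l // ger0_norm // -big_nat (bigD1_seq r) ?mem_index_iota ?iota_uniq //=.
by rewrite lerDl sumr_ge0.
Qed.

Lemma weight_le_pivot_early d : exists2 C : R, 0 <= C & forall r u, (k <= r <= k + k)%N ->
  (k + k - d <= r)%N -> cone u -> weight u r <= C * weight u (k + k).
Proof.
elim: d => [|d [C C0 IH]].
  exists 1 => // r u /andP[h1 h2]; rewrite subn0 => h3 _.
  by have -> : r = (k + k)%N; [apply/eqP; rewrite eqn_leq h2|rewrite mul1r].
have [kd|dk] := ltnP d k; last first.
  exists C => // r u /andP[h1 h2] h3; apply: IH; first by rewrite h1.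
  by lia.
have kp : (k <= (k + k - d.+1).+1)%N by lia.
have [C' C'0 h'] := weight_le_next kp.
exists (C + C' * C); first by rewrite addr_ge0 // mulr_ge0.
move=> r u h1 h2 cu; have T0 := cu.1 (k + k)%N.
have [e|ne] := eqVneq r (k + k - d.+1)%N; last first.
  apply: le_trans (IH r u h1 _ cu) _; first by lia.
  by rewrite ler_wpM2r // lerDl mulr_ge0.
subst r; apply: le_trans (h' u cu) _.
apply: (@le_trans _ _ (C' * (C * weight u (k + k)))).
  by rewrite ler_wpM2l //; apply: IH => //; lia.
by rewrite mulrA ler_wpM2r // lerDr.
Qed.

(** The weight at 2 k, after two rounds, serves as the yardstick: it bounds
    the earlier weights by going forward step by step, and the later ones by
    induction on windows of one round. *)
Lemma weight_le_pivot P : exists2 C : R, 0 <= C & forall r u, (k <= r <= k + k + P)%N ->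
  cone u -> weight u r <= C * weight u (k + k).
Proof.
elim: P => [|P [C C0 IH]].
  have [C C0 h] := weight_le_pivot_early (k + k)%N.
  by exists C => // r u hr; apply: h; rewrite ?subnn // addn0 in hr *.
have kp : (k <= k + k + P.+1)%N by lia.
have [C' C'0 h'] := weight_le_window kp.
exists (C + C' * (k%:R * C)).
  by rewrite addr_ge0 // !mulr_ge0.
move=> r u h1 cu; have T0 := cu.1 (k + k)%N.
have [e|ne] := eqVneq r (k + k + P.+1)%N; last first.
  apply: le_trans (IH r u _ cu) _; first by lia.
  by rewrite ler_wpM2r // lerDl !mulr_ge0.
subst r; apply: le_trans (h' u cu) _.
apply: (@le_trans _ _ (C' * (k%:R * C * weight u (k + k)))); last first.
  by rewrite mulrA ler_wpM2r // lerDr.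
rewrite ler_wpM2l // -mulrA.
apply: (@le_trans _ _ (\sum_((k + k + P.+1 - k).+1 <= r < k + k + P.+1) C * weight u (k + k))).
  by rewrite !big_nat; apply: ler_sum => r hr; apply: IH => //; lia.
rewrite sumr_const_nat -[leLHS]mulr_natl; apply: ler_wpM2r; first exact: mulr_ge0.
rewrite ler_nat; lia.
Qed.

Lemma pivot_le_weight P : exists2 C : R, 0 <= C & forall r u, (k + k <= r <= k + k + P)%N ->
  cone u -> weight u (k + k) <= C * weight u r.
Proof.
elim: P => [|P [C C0 IH]].
  exists 1 => // r u h _; have -> : r = (k + k)%N by lia.
  by rewrite mul1r.
have kp : (k <= (k + k + P).+1)%N by lia.
have [C' C'0 h'] := weight_le_next kp.
exists (C + C * C'); first by rewrite addr_ge0 // mulr_ge0.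
move=> r u h1 cu; have T0 := cu.1 r.
have [e|ne] := eqVneq r (k + k + P).+1; last first.
  apply: le_trans (IH r u _ cu) _; first by lia.
  by rewrite ler_wpM2r // lerDl mulr_ge0.
subst r.
apply: le_trans (IH (k + k + P)%N u _ cu) _; first by lia.
rewrite mulrDl; apply: ler_wpDl; first by rewrite mulr_ge0.
by rewrite -mulrA ler_wpM2l //; apply: h'.
Qed.

(** Between crossings of one variable at distinct thresholds th and th', X_m
    passes from th D to th' D'. So (th' - th) D is a combination of the
    weights in between, and D is bounded by them. *)
Lemma snd_le_pivot : multi -> exists2 C : R, 0 <= C & forall u, cone u ->
  (run u (k + k + k)).2 <= C * weight u (k + k).
Proof.
move=> [p0 [q0 [e0 t0]]].
have cvar_perm i p : cvar (p + i * k) = cvar p.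
  by elim: i => [|i IH]; rewrite ?mul0n ?addn0 // mulSn addnCA addnC cvar_per.
have cthr_perm i p : cthr (p + i * k) = cthr p.
  by elim: i => [|i IH]; rewrite ?mul0n ?addn0 // mulSn addnCA addnC cthr_per.
have [p [q [pq qk e t]]] : exists p q, [/\ (p < q)%N, (q < k)%N, cvar p = cvar q & cthr p <> cthr q].
  have hm p : cvar p = cvar (p %% k)%N /\ cthr p = cthr (p %% k)%N.
    by rewrite {1 3}(divn_eq p k) addnC cvar_perm cthr_perm.
  have [e1 t1] := hm p0; have [e2 t2] := hm q0.
  have [lt|lt|eq] := ltngtP (p0 %% k)%N (q0 %% k)%N.
  - exists (p0 %% k)%N, (q0 %% k)%N; rewrite ltn_pmod // -e1 -e2 -t1 -t2; split=> //.
  - exists (q0 %% k)%N, (p0 %% k)%N; rewrite ltn_pmod // -e1 -e2 -t1 -t2; split=> //.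
    exact: nesym.
  - by exfalso; apply: t0; rewrite t1 t2 eq.
(* both crossings are taken in the third round, where the weights are
   bounded by the yardstick *)
pose p1 := (p + 2 * k)%N; pose q1 := (q + 2 * k)%N.
have pq1 : (p1 < q1)%N by rewrite ltn_add2r.
have [C C0 hC] := weight_le_pivot (2 * k)%N.
pose g := cthr q - cthr p.
have g0 : 0 < `|g| by rewrite normr_gt0 subr_eq0; apply/eqP => h; apply: t.
pose S := \sum_(p1.+1 <= r < q1.+1) `|cfoc r 0 (cvar q) - cthr q|.
have S0 : 0 <= S by apply: sumr_ge0.
exists (S / `|g| * C + (2 * k)%:R * C).
  by rewrite addr_ge0 // !mulr_ge0 // invr_ge0 ltW.
move=> u [hc hm].
have pq2 : (p1.+1 <= q1.+1)%N by apply: ltnW.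
have h := run_sum u (cvar q) (cthr q) pq2.
have hp := run_exit u p1; rewrite cvar_perm cthr_perm e in hp.
have hq := run_exit u q1; rewrite cvar_perm cthr_perm in hq.
rewrite hp hq subrr in h.
have D0 : 0 <= (run u p1.+1).2.
  by apply: run_snd_ge0 => //; apply: hm; exists p, q.
have h1 : `|g| * (run u p1.+1).2 <= S * (C * weight u (k + k)).
  rewrite -{1}[(run u p1.+1).2]ger0_norm // -normrM.
  have -> : g * (run u p1.+1).2 = \sum_(p1.+1 <= r < q1.+1) (cfoc r 0 (cvar q) - cthr q) * weight u r.
    by move: h; rewrite /g; lra.
  apply: le_trans (ler_norm_sum _ _ _) _.
  rewrite mulr_suml !big_nat; apply: ler_sum => r hr.
  rewrite normrM ler_wpM2l // ger0_norm //; apply: hC => //.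
  by rewrite /p1 /q1 in hr; lia.
have p3 : (p1.+1 <= k + k + k)%N by rewrite /p1; lia.
rewrite (run_sum_snd u p3) mulrDl; apply: lerD.
  have -> : S / `|g| * C * weight u (k + k) = S * (C * weight u (k + k)) / `|g| by ring.
  by rewrite ler_pdivlMr // mulrC.
apply: (@le_trans _ _ (\sum_(p1.+1 <= r < k + k + k) C * weight u (k + k))).
  rewrite !big_nat; apply: ler_sum => r hr; apply: hC => //.
  by rewrite /p1 in hr; lia.
rewrite sumr_const_nat -[leLHS]mulr_natl -mulrA; apply: ler_wpM2r; first exact: mulr_ge0.
by rewrite ler_nat /p1; lia.
Qed.

(** * The turn map and its Harnack inequality *)

(** Three rounds: from the third round on, the weights are comparable with
    the one at 2 k from both sides, and D has been compared with it. *)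
Definition turn : nat := (k + k + k)%N.

Lemma cvar_turn p : cvar (p + turn) = cvar p.
Proof. by rewrite /turn !addnA !cvar_per. Qed.

Lemma cthr_turn p : cthr (p + turn) = cthr p.
Proof. by rewrite /turn !addnA !cthr_per. Qed.

Lemma cfoc_turn p : cfoc (p + turn) = cfoc p.
Proof. by rewrite /turn !addnA !cfoc_per. Qed.

Lemma run_turn u p : run (run u turn) p = run u (p + turn).
Proof.
elim: p => [//|p IH]; rewrite addSn /run -/run IH; congr (_ + _ *: _).
  by rewrite /step_weight cvar_turn cthr_turn cfoc_turn.
by rewrite /dir cfoc_turn.
Qed.

Lemma weight_turn u p : weight (run u turn) p = weight u (p + turn).
Proof. by rewrite /weight run_turn /step_weight cvar_turn cthr_turn cfoc_turn. Qed.

(** The functionals that define the cone. Without multiple thresholds the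
    denominator is not among them, and the index [None] duplicates a weight. *)
Definition gauge (j : option 'I_turn) (u : state) : R :=
  if j is Some i then weight u i else if `[< multi >] then u.2 else weight u 0.

Lemma gauge_lin j a u w : gauge j (a *: u + w) = a * gauge j u + gauge j w.
Proof. by case: j => [i|] /=; [|case: ifP => _]; rewrite ?weight_lin. Qed.

Lemma k_le_turn : (k <= turn)%N.
Proof. by rewrite /turn -addnA leq_addr. Qed.

Lemma turn_gt0 : (0 < turn)%N.
Proof. exact: leq_trans k0 k_le_turn. Qed.

Lemma gauge_cone u : (forall j, 0 <= gauge j u) -> cone u.
Proof.
move=> h; apply: cone_fin => [p pk|m].
  exact: (h (Some (Ordinal (leq_trans pk k_le_turn)))).
by have := h None; rewrite /= asboolT.
Qed.

Lemma cone_gauge u : cone u -> forall j, 0 <= gauge j u.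
Proof.
move=> [h1 h2] [i|] /=; first exact: h1.
by case: asboolP => [/h2|].
Qed.

Lemma cone_turn u : cone u -> cone (run u turn).
Proof.
move=> [h1 h2]; split; first by move=> p; rewrite weight_turn.
by move=> m; apply: run_snd_ge0 => //; apply: h2.
Qed.

Lemma gauge_turn u : (forall j, 0 <= gauge j u) ->
  forall j, 0 <= gauge j (run u turn).
Proof. by move=> /gauge_cone /cone_turn /cone_gauge. Qed.

Lemma gauge_gt0 u : (forall p, 0 < weight u p) -> (multi -> 0 < u.2) ->
  forall j, 0 < gauge j u.
Proof. by move=> h1 h2 [i|] //=; case: asboolP => [/h2|]. Qed.

Lemma gauge_gt0_cone u : (forall j, 0 < gauge j u) ->
  (forall p, 0 < weight u p) /\ (multi -> 0 < u.2).
Proof.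
move=> h; have hm : multi -> 0 < u.2.
  by move=> m; have := h None; rewrite /= asboolT.
split => //; apply: cone_pos => // p pk.
exact: (h (Some (Ordinal (leq_trans pk k_le_turn)))).
Qed.

Lemma gauge_turn_gt0 u : (forall j, 0 < gauge j u) ->
  forall j, 0 < gauge j (run u turn).
Proof.
move=> /gauge_gt0_cone[h1 h2]; apply: gauge_gt0 => [p|m]; first by rewrite weight_turn.
rewrite (@run_sum_snd u 0) //; apply: ltr_wpDr; last exact: h2.
by apply: sumr_ge0 => r _; apply: ltW.
Qed.

(** [weight_le_pivot] and [snd_le_pivot] bound all functionals after one
    turn by the weight at 2 k, and [pivot_le_weight] bounds that weight by
    each of them. *)
Lemma gauge_harnack : exists2 kap : R, 1 <= kap &
  forall u, (forall j, 0 <= gauge j u) ->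
  forall i j, gauge i (run u turn) <= kap * gauge j (run u turn).
Proof.
have [C1 C10 h1] : exists2 C : R, 0 <= C & forall u, cone u ->
    forall i, gauge i (run u turn) <= C * weight u (k + k).
  have [A A0 hA] := weight_le_pivot (k + turn)%N.
  have [B B0 hB] : exists2 C : R, 0 <= C & forall u, multi -> cone u ->
      (run u turn).2 <= C * weight u (k + k).
    have [m|nm] := pselect multi; last by exists 0.
    by have [C C0 hC] := snd_le_pivot m; exists C => // u _; apply: hC.
  exists (A + B); first exact: addr_ge0.
  move=> u cu i; have T0 := cu.1 (k + k)%N; rewrite mulrDl.
  have AT0 : 0 <= A * weight u (k + k) by apply: mulr_ge0.
  have BT0 : 0 <= B * weight u (k + k) by apply: mulr_ge0.
  have hT p : (p < turn)%N -> weight u (p + turn) <= A * weight u (k + k).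
    by move=> hp; apply: hA => //; rewrite /turn in hp *; lia.
  case: i => [i|] /=; first by rewrite weight_turn; apply: ler_wpDr => //; apply: hT.
  case: asboolP => m; first by apply: ler_wpDl => //; apply: hB.
  by rewrite weight_turn; apply: ler_wpDr => //; apply: hT; apply: turn_gt0.
have [C2 C20 h2] : exists2 C : R, 0 <= C & forall u, cone u ->
    forall i, weight u (k + k) <= C * gauge i (run u turn).
  have [A A0 hA] := pivot_le_weight (k + turn)%N.
  exists (A + 1); first exact: addr_ge0.
  move=> u cu i; have T0 := cu.1 (k + k)%N.
  have hT p : (p < turn)%N -> weight u (k + k) <= (A + 1) * weight u (p + turn).
    move=> hp; rewrite mulrDl mul1r; apply: ler_wpDr; first exact: cu.1.
    by apply: hA => //; rewrite /turn in hp *; lia.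
  case: i => [i|] /=; first by rewrite weight_turn; apply: hT.
  case: asboolP => m; last by rewrite weight_turn; apply: hT; apply: turn_gt0.
  have D0 : 0 <= (run u (k + k)).2 by apply: run_snd_ge0; [move=> r _; apply: cu.1|apply: cu.2].
  have kkt : (k + k <= turn)%N by rewrite /turn leq_addr.
  rewrite (run_sum_snd u kkt) mulrDl mul1r.
  have hS : weight u (k + k) <= \sum_(k + k <= r < turn) weight u r.
    rewrite big_ltn; last by rewrite /turn; lia.
    by rewrite lerDl; apply: sumr_ge0 => r _; apply: cu.1.
  apply: ler_wpDl; last by apply: ler_wpDl.
  rewrite mulr_ge0 // addr_ge0 //; exact: le_trans hS.
exists (C1 * C2 + 1); first by rewrite lerDr mulr_ge0.
move=> u /gauge_cone cu i j; have g0 := cone_gauge (cone_turn cu) j.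
apply: le_trans (h1 u cu i) _; rewrite mulrDl mul1r; apply: ler_wpDr => //.
by rewrite -mulrA ler_wpM2l //; apply: h2.
Qed.

Lemma weight_sum (I : finType) (c : I -> R) (d : I -> state) p :
  weight (\sum_i c i *: d i) p = \sum_i c i * weight (d i) p.
Proof.
have T0 : weight 0 p = 0.
  by have := weight_lin (-1) 0 0 p; rewrite scaler0 addr0; lra.
by elim/big_rec2: _ => // i x y _ <-; rewrite weight_lin.
Qed.

Lemma runZ a u p : run (a *: u) p = a *: run u p.
Proof.
have st0 : run 0 p = 0.
  by have := run_lin (-1) 0 0 p; rewrite scaler0 addr0 scaleN1r addNr.
by rewrite -[a *: u]addr0 run_lin st0 addr0.
Qed.

Lemma weightZ a u p : weight (a *: u) p = a * weight u p.
Proof. by rewrite /weight runZ -[a *: _]addr0 step_weight_lin /step_weight /= mxE mulr0 subrr mul0r addr0. Qed.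

Lemma run_sum_dir u m : run u m = u + \sum_(i < m) weight u i *: dir i.
Proof.
elim: m => [|m IH]; first by rewrite big_ord0 addr0.
by rewrite big_ord_recr /= addrA -IH.
Qed.

Lemma run_turns u p i : run (run u (p * turn)) i = run u (i + p * turn).
Proof.
elim: p u i => [|p IH] u i; first by rewrite mul0n addn0.
by rewrite mulSn addnC -run_turn IH run_turn addnA.
Qed.

Lemma weight_turns u p i : weight (run u (p * turn)) i = weight u (p * turn + i).
Proof.
rewrite addnC; elim: p u i => [|p IH] u i; first by rewrite mul0n addn0.
by rewrite mulSn addnC -run_turn IH weight_turn addnA.
Qed.

Lemma run_next_turn u p : run u (p.+1 * turn) = run (run u (p * turn)) turn.
Proof. by rewrite run_turns mulSn. Qed.

Lemma iter_turn u p : iter p (fun w => run w turn) u = run u (p * turn).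
Proof. by elim: p => [//|p IH]; rewrite run_next_turn -IH. Qed.

(** * Fixed point or subcritical growth *)

Definition positive (u : state) : Prop := (forall p, 0 < weight u p) /\ 0 < u.2.

(** The limit direction r of an orbit with growth rate Lam > 1 sums up to a
    genuine eigenvector: one turn adds to u the combination of the
    directions (f, 1) with the weights of u, and the same combination [w]
    with the weights r is the limit of the normalised increments, on which a
    turn acts as Lam. Its denominator is the sum of the r, which is
    positive. *)
Lemma eigenvector (kap : R) u Lam C (r : option 'I_turn -> R) :
  1 <= kap -> 0 <= C -> 1 < Lam -> (forall j, 0 < r j) ->
  (forall j, (fun p => gauge j (run u (p * turn)) / gauge None (run u (p * turn)))
     @ \oo --> r j) ->
  (forall p j, 0 < gauge j (run u (p * turn))) ->
  (forall p j, `|gauge j (run u (p.+1 * turn)) - Lam * gauge j (run u (p * turn))|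
     <= C * rate kap ^+ p * gauge j (run u (p * turn))) ->
  exists xs : 'rV[R]_n, run (xs, 1 : R^o) turn = Lam *: (xs, 1 : R^o) /\
    forall p, 0 < weight (xs, 1 : R^o) p.
Proof.
move=> kap1 C0 L1 r0 hr pos hL.
pose w : state := \sum_(i < turn) r (Some i) *: dir i.
pose y p (j : option 'I_turn) := gauge j (run u (p * turn)) / gauge None (run u (p * turn)).
pose w_ p : state := \sum_(i < turn) y p (Some i) *: dir i.
have w_E p : w_ p = (gauge None (run u (p * turn)))^-1 *:
    (run u (p.+1 * turn) + (-1) *: run u (p * turn)).
  rewrite run_next_turn.
  rewrite [run (run u _) turn]run_sum_dir addrAC scaleN1r subrr add0r scaler_sumr.
  by apply: eq_bigr => i _; rewrite scalerA mulrC.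
have Tw_ p (i : 'I_turn) : weight (w_ p) i = (Lam - 1) * y p (Some i) +
   (gauge (Some i) (run u (p.+1 * turn)) - Lam * gauge (Some i) (run u (p * turn)))
     / gauge (Some i) (run u (p * turn)) * y p (Some i).
  rewrite w_E weightZ addrC weight_lin /y /=.
  have := pos p (Some i); have := pos p None; rewrite -[gauge (Some i) _]/(weight _ i).
  by move=> h1 h2; field; rewrite !gt_eqF.
(* the same increments, seen first as differences of weights and then as
   combinations of directions *)
have lim1 (i : 'I_turn) : (fun p => weight (w_ p) i) @ \oo --> (Lam - 1) * r (Some i).
  rewrite (_ : (fun p => _) = (fun p => (Lam - 1) * y p (Some i) +
   (gauge (Some i) (run u (p.+1 * turn)) - Lam * gauge (Some i) (run u (p * turn)))
     / gauge (Some i) (run u (p * turn)) * y p (Some i))); last first.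
    by apply/funext => p; apply: Tw_.
  rewrite -[X in _ --> X]addr0; apply: cvgD.
    by apply: cvgM; [apply: cvg_cst|apply: hr].
  rewrite -[X in _ --> X](mul0r (r (Some i))); apply: cvgM; last exact: hr.
  apply/cvgrPdist_lt => e e0; have [P hP] := geometric_small C (rate_bounds kap1) e0.
  exists P => // p hp; have h := hP p hp; rewrite sub0r normrN.
  apply: le_lt_trans h; rewrite normf_div (gtr0_norm (pos _ _)) ler_pdivrMr //.
have lim2 (i : 'I_turn) : (fun p => weight (w_ p) i) @ \oo --> weight w i.
  rewrite (_ : (fun p => _) = (fun p => \sum_(j < turn) y p (Some j) * weight (dir j) i)); last first.
    by apply/funext => p; rewrite /w_ weight_sum.
  rewrite /w weight_sum; apply: cvg_big; first exact: add_continuous.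
  by move=> j _; apply: cvgM; [apply: hr|apply: cvg_cst].
have Tw (i : 'I_turn) : weight w i = (Lam - 1) * r (Some i).
  by rewrite -(cvg_lim _ (lim2 i)) // (cvg_lim _ (lim1 i)).
have stw : run w turn = Lam *: w.
  rewrite run_sum_dir -[LHS]/(w + _) -[in RHS](subrK 1 Lam) scalerDl scale1r addrC.
  congr (_ + _); rewrite /w scaler_sumr; apply: eq_bigr => i _.
  by rewrite scalerA -Tw.
have w2 : w.2 = \sum_(i < turn) r (Some i).
  rewrite /w; elim/big_rec2: _ => // i x z _ <-.
  by rewrite /= /GRing.scale /= mulr1.
have w20 : 0 < w.2.
  rewrite w2 (bigD1 (Ordinal turn_gt0)) //= ltr_wpDr //.
  by apply: sumr_ge0 => i _; apply: ltW.
have vE : ((w.2)^-1 *: w.1, 1 : R^o) = (w.2)^-1 *: w :> state.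
  rewrite [RHS]surjective_pairing; congr pair.
  by rewrite /= /GRing.scale /= mulVf // gt_eqF.
exists ((w.2)^-1 *: w.1); split; first by rewrite vE runZ stw !scalerA mulrC.
apply: cone_pos => // p pk.
have pt : (p < turn)%N by apply: leq_trans pk k_le_turn.
rewrite vE weightZ (Tw (Ordinal pt)) mulr_gt0 ?invr_gt0 // mulr_gt0 // subr_gt0 //.
Qed.

(** Either some orbit grows at a rate larger than 1 and yields an
    eigenvector of the turn map, or every orbit is subcritical. With
    multiple thresholds the latter is impossible: the denominator is one of
    the comparable functionals, so the weights that it accumulates in a turn
    are a fixed fraction of it. *)
Lemma dichotomy : (exists u, positive u) ->
  (exists (xs : 'rV[R]_n) Lam, [/\ 1 < Lam,
     run (xs, 1 : R^o) turn = Lam *: (xs, 1 : R^o) &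
     forall p, 0 < weight (xs, 1 : R^o) p]) \/
  (~ multi /\ forall u, positive u -> forall e : R, 0 < e ->
     exists P, forall p i, (P <= p)%N -> (i < turn)%N ->
       weight u (p * turn + i) <= e * (run u (p * turn)).2).
Proof.
move=> [u0 hu0]; have [kap kap1 harn] := gauge_harnack.
have kap0 : 0 < kap by apply: lt_le_trans ltr01 kap1.
have gpos u : positive u -> forall j, 0 < gauge j u.
  by move=> [h1 h2]; apply: gauge_gt0.
have per u (hu : positive u) := @perron R state _ None (fun w => run w turn) gauge kap
  (fun a v w => run_lin a v w turn) gauge_lin gauge_turn gauge_turn_gt0 kap1 harn u (gpos u hu).
have stp u p : positive u -> positive (run u (p * turn)).
  move=> [h1 h2]; split; first by move=> i; rewrite weight_turns.
  rewrite (@run_sum_snd u 0) //; apply: ltr_wpDr => //.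
  by apply: sumr_ge0 => r _; apply: ltW.
have [[u [Lam [C [r [hu L1 [C0 r0 hr pos hL]]]]]]|hno] := pselect (exists u Lam C (r : option 'I_turn -> R),
   [/\ positive u, 1 < Lam & [/\ 0 <= C, forall j, 0 < r j,
    forall j, (fun p => gauge j (iter p (fun w => run w turn) u) /
        gauge None (iter p (fun w => run w turn) u)) @ \oo --> r j,
    forall p j, 0 < gauge j (iter p (fun w => run w turn) u) &
    forall p j, `|gauge j (iter p.+1 (fun w => run w turn) u) - Lam * gauge j (iter p (fun w => run w turn) u)|
      <= C * rate kap ^+ p * gauge j (iter p (fun w => run w turn) u)]]).
  left; have [|||xs [h1 h2]] := @eigenvector kap u Lam C r kap1 C0 L1 r0.
  - by move=> j; have := hr j; under eq_fun do rewrite iter_turn.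
  - by move=> p j; have := pos p j; rewrite iter_turn.
  - by move=> p j; have := hL p j; rewrite !iter_turn.
  by exists xs, Lam.
right.
have sub u : positive u -> exists Lam C, [/\ Lam <= 1, 0 <= C &
    forall p j, gauge j (run u (p.+1 * turn)) <= (Lam + C * rate kap ^+ p) * gauge j (run u (p * turn))].
  move=> hu; have [Lam [C [r [C0 r0 hr pos hL]]]] := per u hu.
  exists Lam, C; split => //.
    rewrite leNgt; apply/negP => L1; apply: hno; exists u, Lam, C, r; split => //.
  move=> p j; have := hL p j; rewrite !iter_turn ler_norml => /andP[_].
  by rewrite mulrDl; lra.
have Dstep u p : positive u -> (run u (p * turn)).2 + weight u (p * turn) <= (run u (p.+1 * turn)).2.
  move=> hu; have le1 : (p * turn <= p.+1 * turn)%N by rewrite leq_mul2r leqnSn orbT.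
  rewrite (run_sum_snd u le1) lerD2l big_ltn; last by rewrite mulSn -[ltnLHS]add0n ltn_add2r turn_gt0.
  by rewrite lerDl; apply: sumr_ge0 => i _; apply/ltW/hu.1.
have harn' u p : positive u -> forall i j, gauge i (run u (p.+1 * turn)) <= kap * gauge j (run u (p.+1 * turn)).
  move=> hu i j; rewrite run_next_turn; apply: harn => j'.
  by apply/ltW/gpos/stp.
split.
  move=> m; have [Lam [C [L1 C0 hL]]] := sub u0 hu0.
  have e0 : 0 < kap^-1 by rewrite invr_gt0.
  have [P hP] := geometric_small C (rate_bounds kap1) e0.
  have := hL P.+1 None; rewrite /= asboolT //.
  have D0 := (stp u0 P.+1 hu0).2.
  have h1 := Dstep u0 P.+1 hu0.
  have h2 := harn' u0 P hu0 None (Some (Ordinal turn_gt0)).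
  rewrite /= asboolT // weight_turns addn0 -ler_pdivrMl // in h2.
  have h3 := hP P.+1 (leqnSn _).
  move=> h4.
  have : (1 + kap^-1) * (run u0 (P.+1 * turn)).2 <= (Lam + C * rate kap ^+ P.+1) * (run u0 (P.+1 * turn)).2.
    by apply: le_trans h4; apply: le_trans h1; rewrite mulrDl mul1r lerD2l.
  by rewrite ler_pM2r //; lra.
move=> u hu e e0; have [Lam [C [L1 C0 hL]]] := sub u hu.
have ek : 0 < e / kap by rewrite divr_gt0.
have [||||P hP] := @subcritical_ratio_small R (fun p => weight u (p * turn))
  (fun p => (run u (p * turn)).2) Lam C (rate kap) (e / kap) (rate_bounds kap1) L1 C0 ek.
- by move=> p; apply: hu.1.
- by move=> p; exact: (stp u p hu).2.
- by move=> p; apply: Dstep.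
- move=> p; have := hL p (Some (Ordinal turn_gt0)).
  by rewrite /= !weight_turns !addn0.
exists P.+1 => -[//|p] i Pp it.
have := harn' u p hu (Some (Ordinal it)) (Some (Ordinal turn_gt0)).
rewrite /= !weight_turns addn0 => h; apply: le_trans h _.
have := hP p.+1 (ltnW Pp); rewrite -(ler_pM2l kap0) => h; apply: le_trans h _.
by rewrite le_eqVlt; apply/orP; left; apply/eqP; field; rewrite gt_eqF.
Qed.

(** * Attraction to the fixed point *)

Section Attraction.
Variables (xs : 'rV[R]_n) (Lam : R).
Let v : state := (xs, 1).
Hypothesis Lam1 : 1 < Lam.
Hypothesis eigen : run v turn = Lam *: v.
Hypothesis Tv0 : forall p, 0 < weight v p.

Lemma run_eigen p : run v (p * turn) = Lam ^+ p *: v.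
Proof.
elim: p => [|p IH]; first by rewrite mul0n scale1r.
by rewrite run_next_turn IH runZ eigen scalerA exprSr.
Qed.

(** The weights of the eigenvector contribute nothing to the defect X - xs
    D, so that any multiple of them may be subtracted from the weights of u. *)
Lemma defect_step u p l (a : R) :
  (run u (p.+1 * turn)).1 0 l - xs 0 l * (run u (p.+1 * turn)).2 =
  (run u (p * turn)).1 0 l - xs 0 l * (run u (p * turn)).2 +
  \sum_(i < turn) (weight (run u (p * turn)) i - a * weight v i) * (cfoc i 0 l - xs 0 l).
Proof.
have D (w : state) : (run w turn).1 0 l - xs 0 l * (run w turn).2 =
    w.1 0 l - xs 0 l * w.2 + \sum_(i < turn) weight w i * (cfoc i 0 l - xs 0 l).
  rewrite (@run_sum w l (xs 0 l) 0 turn) // big_mkord; congr (_ + _).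
  by apply: eq_bigr => i _; rewrite mulrC.
rewrite run_next_turn.
have hv := D v; rewrite eigen /= mxE mulr1 subrr add0r in hv.
have hv0 : \sum_(i < turn) weight v i * (cfoc i 0 l - xs 0 l) = 0.
  by rewrite -hv /GRing.scale /=; ring.
rewrite D; congr (_ + _).
under [RHS]eq_bigr do rewrite mulrBl -[a * _ * _]mulrA.
by rewrite sumrB -mulr_sumr hv0 mulr0 subr0.
Qed.

(** The defect X - xs D vanishes at the eigenvector [v], hence grows only
    with the part of the weights that is not proportional to those of [v].
    Doeblin's argument makes this part smaller than Lam^p by a geometric
    factor, whereas the denominator grows as fast as Lam^p. *)
Lemma defect_bound : exists K mu, [/\ 0 <= K, 0 <= mu < 1 &
  forall u a b, u.2 = 1 -> 0 < a -> a <= 1 -> a <= b -> squeezed gauge a b v u ->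
  forall p l,
    `|(run u (p * turn)).1 0 l - xs 0 l * (run u (p * turn)).2| <=
      (`|u.1 0 l - xs 0 l| + K * (b - a)) * (mu * Lam) ^+ p /\
    a * Lam ^+ p <= (run u (p * turn)).2].
Proof.
have [kap kap1 harn] := gauge_harnack.
have L0 : 0 < Lam by apply: lt_trans ltr01 Lam1.
have /andP[q0 q1] := rate_bounds kap1; set q := rate kap in q0 q1 *.
(* mu is at least the contraction rate q, and mu Lam > 1 lets the defects of
   all turns be summed as a geometric series dominated by its last term *)
pose m0 := Num.max q Lam^-1.
have m01 : m0 < 1 by rewrite gt_max q1 invf_lt1.
pose mu := (m0 + 1) / 2.
have qmu : q <= mu by (have : q <= m0 by rewrite le_max lexx); rewrite /mu; lra.
have Lmu : 1 < mu * Lam.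
  have : Lam^-1 < mu by (have : Lam^-1 <= m0 by rewrite le_max lexx orbT); rewrite /mu; lra.
  by move=> h; rewrite -ltr_pdivrMr // div1r.
have mu0 : 0 <= mu by apply: le_trans qmu.
pose K1 := \sum_(l < n) \sum_(i < turn) weight v i * `|cfoc i 0 l - xs 0 l|.
have K10 : 0 <= K1.
  by apply: sumr_ge0 => l _; apply: sumr_ge0 => i _; rewrite mulr_ge0 // ltW.
exists (K1 / (mu * Lam - 1)), mu; split.
- by rewrite divr_ge0 // subr_ge0 ltW.
- by rewrite mu0 /mu; lra.
move=> u a b u2 a0 a1 ab hs.
have v0 j : 0 <= gauge j v by apply: cone_gauge; split => // p; apply: ltW.
have nest p := @squeezed_nested R state _ None (fun w => run w turn) gauge kap
  (fun a v w => run_lin a v w turn) gauge_lin gauge_turn kap1 harn a b v u p ab v0 hs.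
have bnd p : exists a' b', [/\ a <= a', b' - a' <= q ^+ p * (b - a) &
    forall i : 'I_turn, a' * (Lam ^+ p * weight v i) <= weight (run u (p * turn)) i <= b' * (Lam ^+ p * weight v i)].
  have [a' [b' [h1 h2 h3 h4 h5]]] := nest p; exists a', b'; split => // i.
  by have := h5 p (leqnn _) (Some i); rewrite /= !iter_turn run_eigen weightZ.
have Lp p : 0 < Lam ^+ p by rewrite exprn_gt0.
move=> p l; split.
  elim: p => [|p IH]; first by rewrite mul0n u2 mulr1 expr0 mulr1 lerDl mulr_ge0 // ?subr_ge0 // divr_ge0 // subr_ge0 ltW.
  have [a' [b' [h1 h2 h3]]] := bnd p.
  rewrite (defect_step u p l (a' * Lam ^+ p)).
  apply: le_trans (ler_normD _ _) _; apply: le_trans (lerD IH (lexx _)) _.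
  set E := _ + _ / _ * _.
  have hK : `|\sum_(i < turn) (weight (run u (p * turn)) i - a' * Lam ^+ p * weight v i) * (cfoc i 0 l - xs 0 l)| <=
      K1 * (b - a) * (mu * Lam) ^+ p.
    apply: le_trans (ler_norm_sum _ _ _) _.
    apply: (@le_trans _ _ (\sum_(i < turn) (b - a) * (mu * Lam) ^+ p * (weight v i * `|cfoc i 0 l - xs 0 l|))).
      apply: ler_sum => i _; rewrite normrM [leRHS]mulrA; apply: ler_wpM2r => //.
      have /andP[g1 g2] := h3 i; rewrite ger0_norm; last by rewrite subr_ge0 -mulrA.
      apply: (@le_trans _ _ ((b' - a') * (Lam ^+ p * weight v i))); first by lra.
      have -> : (b - a) * (mu * Lam) ^+ p * weight v i = (b - a) * mu ^+ p * (Lam ^+ p * weight v i).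
        by rewrite exprMn; ring.
      apply: ler_wpM2r.
        by rewrite mulr_ge0 ?ltW.
      apply: le_trans h2 _; rewrite mulrC; apply: ler_wpM2l; first by rewrite subr_ge0.
      by apply: lerXn2r; rewrite ?nnegrE.
    rewrite -mulr_sumr mulrC [leRHS](_ : _ = K1 * ((b - a) * (mu * Lam) ^+ p)); last by ring.
    apply: ler_wpM2r.
      by rewrite mulr_ge0 ?subr_ge0 // exprn_ge0 // mulr_ge0 // ltW.
    rewrite /K1 (bigD1 l) //= lerDl; apply: sumr_ge0 => l' _.
    by apply: sumr_ge0 => i _; rewrite mulr_ge0 // ltW.
  apply: le_trans (lerD (lexx _) hK) _; rewrite exprSr -mulrDl mulrCA mulrC ler_wpM2l //.
    by rewrite exprn_ge0 // mulr_ge0 // ltW.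
  have hE : K1 * (b - a) = K1 / (mu * Lam - 1) * (b - a) * (mu * Lam - 1).
    by field; rewrite gt_eqF // subr_gt0.
  rewrite [X in _ + X]hE; have : 0 <= `|u.1 0 l - xs 0 l| * (mu * Lam - 1).
    by rewrite mulr_ge0 // subr_ge0 ltW.
  by rewrite /E; lra.
elim: p => [|p IH]; first by rewrite mul0n u2 expr0 mulr1.
have [a' [b' [h1 h2 h3]]] := bnd p.
rewrite run_next_turn.
rewrite (@run_sum_snd (run u (p * turn)) 0 turn) // big_mkord.
have hv : \sum_(i < turn) weight v i = Lam - 1.
  have := @run_sum_snd v 0 turn (leq0n _); rewrite eigen big_mkord /= /GRing.scale /= mulr1.
  by move=> ->; ring.
have hS : a * Lam ^+ p * (Lam - 1) <= \sum_(i < turn) weight (run u (p * turn)) i.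
  rewrite -hv mulr_sumr; apply: ler_sum => i _.
  have /andP[g1 _] := h3 i; apply: le_trans g1; rewrite -mulrA ler_wpM2r //.
  by rewrite mulr_ge0 // ltW.
apply: le_trans (lerD IH hS); rewrite exprS; lra.
Qed.

Definition proj (u : state) l : R := u.1 0 l / u.2.

Lemma proj_defect (u : state) l : 0 < u.2 ->
  `|proj u l - xs 0 l| = `|u.1 0 l - xs 0 l * u.2| / u.2.
Proof.
move=> u0; rewrite -[X in _ / X](gtr0_norm u0) -normf_div; congr (`| _ |).
by rewrite /proj; field; rewrite gt_eqF.
Qed.

Lemma v_gauge_gt0 j : 0 < gauge j v.
Proof. exact: gauge_gt0. Qed.

(** By positivity [u] is squeezed between multiples of [v]; hence X / D - xs
    is at most the quotient of the two bounds of [defect_bound], which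
    decreases like mu^p. *)
Lemma attraction u : positive u -> u.2 = 1 -> forall e : R, 0 < e ->
  exists P, forall p l, (P <= p)%N -> `|proj (run u (p * turn)) l - xs 0 l| < e.
Proof.
move=> [hu1 hu2] u2 e e0.
have [K [mu [K0 mu01 hK]]] := defect_bound.
have [a [b [a0 ab hs]]] := squeezed_exists None v_gauge_gt0 (gauge_gt0 hu1 (fun=> hu2)).
pose a' := Num.min a 1.
have a'0 : 0 < a' by rewrite lt_min a0 ltr01.
have a'1 : a' <= 1 by rewrite ge_min lexx orbT.
have a'a : a' <= a by rewrite ge_min lexx.
have hs' : squeezed gauge a' b v u.
  move=> j; have /andP[h1 ->] := hs j; rewrite andbT.
  by apply: le_trans h1; rewrite ler_pM2r // v_gauge_gt0.
pose C := \sum_(l < n) (`|u.1 0 l - xs 0 l| + K * (b - a')).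
have [P hP] := geometric_small (C / a') mu01 e0.
exists P => p l /hP; apply: le_lt_trans.
have [h1 h2] := hK u a' b u2 a'0 a'1 (le_trans a'a ab) hs' p l.
have L0 : 0 < Lam by apply: lt_trans ltr01 Lam1.
have Lp : 0 < Lam ^+ p by rewrite exprn_gt0.
have D0 : 0 < (run u (p * turn)).2 by apply: lt_le_trans h2; rewrite mulr_gt0.
have ba : 0 <= b - a' by rewrite subr_ge0 (le_trans a'a).
have /andP[mu0 _] := mu01.
rewrite proj_defect // ler_pdivrMr //; apply: le_trans h1 _.
apply: (@le_trans _ _ (C / a' * mu ^+ p * (a' * Lam ^+ p))); last first.
  by rewrite ler_wpM2l // mulr_ge0 ?exprn_ge0 // divr_ge0 ?(ltW a'0) // sumr_ge0 // => i _; rewrite addr_ge0 // mulr_ge0.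
have -> : C / a' * mu ^+ p * (a' * Lam ^+ p) = C * (mu * Lam) ^+ p.
  by rewrite exprMn; field; rewrite gt_eqF.
rewrite ler_wpM2r //; first by rewrite exprn_ge0 // mulr_ge0 // ltW.
rewrite /C (bigD1 l) //= lerDl sumr_ge0 // => i _; by rewrite addr_ge0 // mulr_ge0.
Qed.

(** A state with denominator 1 close to [v] is squeezed between 1 - eps and
    1 + eps times [v], with eps proportional to the distance; then
    [defect_bound] is small for all turns at once. *)
Lemma local_stability (e : R) : 0 < e -> exists2 d : R, 0 < d &
  forall u, positive u -> u.2 = 1 -> (forall l, `|u.1 0 l - xs 0 l| < d) ->
  forall p l, `|proj (run u (p * turn)) l - xs 0 l| < e.
Proof.
move=> e0; have [K [mu [K0 /andP[mu0 mu1] hK]]] := defect_bound.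
pose ev l : state := (delta_mx 0 l, 0).
pose B := \sum_j \sum_(l < n) `|gauge j (ev l)|.
pose G := \sum_j (gauge j v)^-1.
have B0 : 0 <= B by apply: sumr_ge0 => j _; apply: sumr_ge0.
have G0 : 0 <= G by apply: sumr_ge0 => j _; rewrite invr_ge0 ltW // v_gauge_gt0.
have BG0 : 0 <= B * G by rewrite mulr_ge0.
pose d1 := (2 * (B * G + 1))^-1; pose d2 := e / (4 * (1 + 2 * K * (B * G))).
have KBG0 : 0 <= K * (B * G) by rewrite mulr_ge0.
have d10 : 0 < d1 by rewrite invr_gt0; lra.
have d20 : 0 < d2 by rewrite divr_gt0 //; lra.
pose d := Num.min d1 d2.
have d0 : 0 < d by rewrite lt_min d10 d20.
have dd1 : d <= d1 by rewrite ge_min lexx.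
have dd2 : d <= d2 by rewrite ge_min lexx orbT.
exists d => // u [hu1 hu2] u2 hd p l.
pose eps := d * (B * G).
have eps0 : 0 <= eps by rewrite mulr_ge0 // ltW.
have eps1 : eps <= 1 / 2.
  apply: (@le_trans _ _ (d1 * (B * G))); first by rewrite ler_wpM2r.
  by rewrite /d1 ler_pdivrMl; lra.
have gE j : gauge j u - gauge j v = \sum_(l < n) (u.1 0 l - xs 0 l) * gauge j (ev l).
  have g0 : gauge j 0 = 0.
    by have := gauge_lin j (-1) 0 0; rewrite scaler0 addr0; lra.
  have -> : gauge j u - gauge j v = gauge j ((-1) *: v + u) by rewrite gauge_lin; ring.
  have -> : (-1) *: v + u = \sum_(l < n) (u.1 0 l - xs 0 l) *: ev l.
    rewrite [LHS]surjective_pairing [RHS]surjective_pairing; congr pair.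
      have -> : (\sum_(l < n) (u.1 0 l - xs 0 l) *: ev l).1 = \sum_(l < n) (u.1 0 l - xs 0 l) *: delta_mx 0 l.
        by elim/big_rec2: _ => // i x y _ <-.
      rewrite [LHS]row_sum_delta; apply: eq_bigr => i _; congr (_ *: _).
      by rewrite /= !mxE; ring.
    rewrite /= u2.
    have -> : (\sum_(l < n) (u.1 0 l - xs 0 l) *: ev l).2 = \sum_(l < n) 0.
      by elim/big_rec2: _ => // i x y _ <-; rewrite /= scaler0.
    by rewrite big1 // /GRing.scale /=; ring.
  by elim/big_rec2: _ => // i x y _ <-; rewrite gauge_lin.
have hs : squeezed gauge (1 - eps) (1 + eps) v u.
  move=> j; have h : `|gauge j u - gauge j v| <= eps * gauge j v.
    apply: (@le_trans _ _ (d * B)).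
      rewrite gE; apply: le_trans (ler_norm_sum _ _ _) _.
      apply: (@le_trans _ _ (\sum_(i < n) d * `|gauge j (ev i)|)).
        by apply: ler_sum => i _; rewrite normrM ler_wpM2r // ltW.
      rewrite -mulr_sumr ler_pM2l // /B (bigD1 j) //= lerDl.
      by apply: sumr_ge0 => i _; apply: sumr_ge0.
    have -> : eps * gauge j v = d * B * (G * gauge j v) by rewrite /eps; ring.
    apply: ler_peMr; first by rewrite mulr_ge0 // ltW.
    rewrite -ler_pdivrMr ?v_gauge_gt0 // mul1r /G (bigD1 j) //= lerDl.
    by apply: sumr_ge0 => i _; rewrite invr_ge0 ltW // v_gauge_gt0.
  by move: h; rewrite ler_norml => /andP[h1 h2]; apply/andP; split; lra.
have a0 : 0 < 1 - eps by lra.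
have [||h1 h2] := hK u (1 - eps) (1 + eps) u2 a0 _ _ hs p l; [lra|lra|].
have L0 : 0 < Lam by apply: lt_trans ltr01 Lam1.
have Lp : 0 < Lam ^+ p by rewrite exprn_gt0.
have D0 : 0 < (run u (p * turn)).2 by apply: lt_le_trans h2; rewrite mulr_gt0.
rewrite proj_defect // ltr_pdivrMr //; apply: le_lt_trans h1 _.
apply: (@lt_le_trans _ _ (e * (1 / 2 * Lam ^+ p))); last first.
  rewrite ler_pM2l //; apply: le_trans h2; rewrite ler_pM2r //; lra.
rewrite exprMn !mulrA ltr_pM2r //.
apply: (@le_lt_trans _ _ (d * (1 + 2 * K * (B * G)))).
  apply: (@le_trans _ _ ((`|u.1 0 l - xs 0 l| + K * (1 + eps - (1 - eps))) * 1)).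
    apply: ler_wpM2l; last by rewrite exprn_ile1 // ltW.
    rewrite addr_ge0 // mulr_ge0 //; lra.
  have -> : d * (1 + 2 * K * (B * G)) = d + K * (1 + eps - (1 - eps)).
    by rewrite /eps; ring.
  by rewrite mulr1; apply: lerD => //; apply: ltW.
apply: (@le_lt_trans _ _ (d2 * (1 + 2 * K * (B * G)))).
  rewrite ler_wpM2r //; lra.
have -> : d2 * (1 + 2 * K * (B * G)) = e / 4 by rewrite /d2; field; lra.
lra.
Qed.

End Attraction.

End Lift.
(** * Intervals and regions of a network *)

Section Geometry.
Context {R : realType} {n : nat} (N : glass_network R n).

Lemma betweenP i j (x : R) : (j <= nthr N i)%N ->
  between_thr N i j x <->
  ((0 < j)%N -> thr N i j < x) /\ ((j < nthr N i)%N -> x < thr N i j.+1).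
Proof.
move=> jJ; rewrite /between_thr /ethr /= jJ.
case: (eqVneq j 0%N) => [->|j0] /=.
  rewrite ltNyr /=; case: ltnP => h; first by rewrite lte_fin; split=> [h1|[_]]; [split|apply].
  by rewrite ltry; split.
have j0' : (0 < j)%N by rewrite lt0n.
rewrite lte_fin; case: (ltnP j (nthr N i)) => h /=; rewrite ?lte_fin ?ltry ?andbT.
  by split=> [/andP[h1 h2]|[h1 h2]]; [split|apply/andP; split; [apply: h1|apply: h2]].
by split=> [h1|[h1 _]]; [split|apply: h1].
Qed.

Lemma reg_le (a : region_index N) i : (a i <= nthr N i)%N.
Proof. by rewrite -ltnS. Qed.

Lemma thr_mono i j j' : (0 < j < j')%N -> (j' <= nthr N i)%N -> thr N i j < thr N i j'.
Proof.
move=> /andP[j0 jj'] j'J; rewrite -(subnKC jj'); rewrite -(subnKC jj') in j'J.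
elim: (j' - j.+1)%N j'J => [|d IH] h.
  by rewrite addn0 in h *; apply: thr_lt; rewrite j0.
rewrite addnS in h *; apply: lt_trans (IH (ltnW h)) _.
by apply: thr_lt; rewrite h andbT addSn.
Qed.

Lemma thr_inj i a b : (0 < a <= nthr N i)%N -> (0 < b <= nthr N i)%N ->
  thr N i a = thr N i b -> a = b.
Proof.
move=> /andP[a0 aJ] /andP[b0 bJ] eab; have [lt|lt|//] := ltngtP a b.
  have := @thr_mono i a b; rewrite a0 lt eab ltxx => h.
  by have := h isT bJ.
have := @thr_mono i b a; rewrite b0 lt eab ltxx => h.
by have := h isT aJ.
Qed.

Lemma interval_point i j : (j <= nthr N i)%N -> exists x, between_thr N i j x.
Proof.
move=> jJ; have J0 := nthr_gt0 N i.
have [j0|j0] := eqVneq j 0%N.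
  exists (thr N i 1 - 1); apply/(betweenP _ jJ); subst j; split => // _; lra.
have j0' : (0 < j)%N by rewrite lt0n.
have [jJ'|Jj] := ltnP j (nthr N i).
  exists ((thr N i j + thr N i j.+1) / 2); apply/(betweenP _ jJ).
  have h : thr N i j < thr N i j.+1 by apply: thr_lt; rewrite j0'.
  split => _; lra.
exists (thr N i j + 1); apply/(betweenP _ jJ); split => [_|]; first lra.
by rewrite ltnNge Jj.
Qed.

Lemma region_point (a : region_index N) : exists x, region a x.
Proof.
have [x hx] := choice (fun i => interval_point (reg_le a i)).
by exists (\row_i x i) => i; rewrite mxE; apply: hx.
Qed.

Lemma adjacent_unique m m' (a b : region_index N) :
  adjacent_along m a b -> adjacent_along m' a b -> m = m'.
Proof.
move=> [h _] [_ h']; apply: contrapT => /eqP ne.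
by have e := h' m ne; case: h; rewrite e; lia.
Qed.

End Geometry.

(** * Focal points and thresholds along the cycle *)

Section Cycle.
Context {R : realType} {n : nat} {N : glass_network R n} {k : nat}.
Variable O : 'I_k -> region_index N.
Hypothesis attr : cyclic_attractor O.

Let k0 : (0 < k)%N. Proof. by case: attr => -[]. Qed.

(** Positions along the cycle are natural numbers, read modulo k, so that a
    trajectory that winds around passes through positions p, p + 1, and so
    on. *)
Definition idx (p : nat) : 'I_k := Ordinal (ltn_pmod p k0).

Lemma idx_succ p : idx p.+1 = ordS (idx p).
Proof. by apply: val_inj; rewrite /= -[in LHS]addn1 -[in RHS]addn1 modnDml. Qed.

Lemma idx_per p : idx (p + k) = idx p.
Proof. by apply: val_inj; rewrite /= modnDr. Qed.

Lemma idx_ord (i : 'I_k) : idx i = i.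
Proof. by apply: val_inj; rewrite /= modn_small. Qed.

Definition reg (p : nat) : region_index N := O (idx p).

Lemma reg_per p : reg (p + k) = reg p.
Proof. by rewrite /reg idx_per. Qed.

Lemma crosses_ord i : crosses (O i) (O (ordS i)).
Proof. by case: attr => -[_ _ h] _; apply: h. Qed.

Definition exit_ord (i : 'I_k) : 'I_n := projT1 (cid (crosses_ord i)).

Definition exit_var (p : nat) : 'I_n := exit_ord (idx p).

Definition exit_thr (p : nat) : R :=
  thr N (exit_var p) (maxn (reg p (exit_var p)) (reg p.+1 (exit_var p))).

Definition upward (p : nat) : bool := (reg p (exit_var p) < reg p.+1 (exit_var p))%N.

Definition exit_sign (p : nat) : R := if upward p then 1 else -1.

Definition focus (p : nat) : 'rV[R]_n := focal (reg p).

Lemma exit_var_per p : exit_var (p + k) = exit_var p.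
Proof. by rewrite /exit_var idx_per. Qed.

Lemma exit_thr_per p : exit_thr (p + k) = exit_thr p.
Proof. by rewrite /exit_thr -addSn !reg_per exit_var_per. Qed.

Lemma focus_per p : focus (p + k) = focus p.
Proof. by rewrite /focus reg_per. Qed.

Lemma adj p : adjacent_along (exit_var p) (reg p) (reg p.+1).
Proof.
by rewrite /reg idx_succ /exit_var /exit_ord; case: (cid _) => /= m [].
Qed.

Lemma reg_same p l : l != exit_var p -> reg p.+1 l = reg p l.
Proof. by move=> h; case: (adj p) => _ /(_ _ h). Qed.

Lemma cross_focal p : (upward p -> exit_thr p < focus p 0 (exit_var p) /\ exit_thr p < focus p.+1 0 (exit_var p)) /\
  (~~ upward p -> focus p 0 (exit_var p) < exit_thr p /\ focus p.+1 0 (exit_var p) < exit_thr p).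
Proof.
have [hm _] := adj p.
have : ((reg p (exit_var p) < reg p.+1 (exit_var p))%N -> exit_thr p < focus p 0 (exit_var p) /\ exit_thr p < focus p.+1 0 (exit_var p)) /\
   ((reg p.+1 (exit_var p) < reg p (exit_var p))%N -> focus p 0 (exit_var p) < exit_thr p /\ focus p.+1 0 (exit_var p) < exit_thr p).
  rewrite /exit_thr /focus /reg idx_succ /exit_var /exit_ord; case: (cid _) => /= m [_ h]; exact: h.
move=> [h1 h2]; split; first exact: h1.
by rewrite /upward -leqNgt => h; apply: h2; case: hm h => ->; lia.
Qed.

Lemma upward_level p : upward p -> reg p.+1 (exit_var p) = (reg p (exit_var p)).+1 :> nat /\
  exit_thr p = thr N (exit_var p) (reg p (exit_var p)).+1.
Proof.
move=> h; have [hm _] := adj p; rewrite /exit_thr; move: h; rewrite /upward => h.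
by have e : reg p.+1 (exit_var p) = (reg p (exit_var p)).+1 :> nat; [case: hm; lia|rewrite (maxn_idPr (ltnW h)) e].
Qed.

Lemma downward_level p : ~~ upward p -> reg p (exit_var p) = (reg p.+1 (exit_var p)).+1 :> nat /\
  exit_thr p = thr N (exit_var p) (reg p (exit_var p)).
Proof.
move=> h; have [hm _] := adj p; rewrite /exit_thr; move: h; rewrite /upward => h.
have e : reg p (exit_var p) = (reg p.+1 (exit_var p)).+1 :> nat by case: hm; lia.
by split => //; rewrite (maxn_idPl _) // e.
Qed.

Lemma exit_sign_neq0 p : exit_sign p != 0.
Proof. by rewrite /exit_sign; case: ifP; rewrite ?oppr_eq0 oner_eq0. Qed.

Lemma focus_beyond p : 0 < exit_sign p * (focus p 0 (exit_var p) - exit_thr p).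
Proof.
have [h1 h2] := cross_focal p; rewrite /exit_sign; case: ifPn => [/h1|/h2] []; lra.
Qed.

Lemma next_focus_beyond p : 0 < exit_sign p * (focus p.+1 0 (exit_var p) - exit_thr p).
Proof.
have [h1 h2] := cross_focal p; rewrite /exit_sign; case: ifPn => [/h1|/h2] []; lra.
Qed.

(** If the focal point lay beyond a face other than the exit wall, a
    trajectory started close enough to that face would leave through it. The
    time to reach the exit wall depends only on the crossed coordinate, so
    the starting value of the coordinate l can be changed freely. *)
Lemma focal_between p l : l != exit_var p -> between_thr N l (reg p l) (focus p 0 l).
Proof.
move=> ne; have [x0 hx0] := region_point (reg p).
have hent : enters_next (reg p) (reg p.+1).
  by case: attr => _ h; rewrite /reg idx_succ; apply: h.
set f := focus p; pose m := exit_var p; pose j := reg p l.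
have jJ := reg_le (reg p) l.
have e_pos : 0 < exit_sign p * (exit_thr p - x0 0 m).
  have /(betweenP _ (reg_le _ _))[b1 b2] := hx0 m.
  rewrite /exit_sign; case: ifPn => hu.
    have [e1 ->] := upward_level hu; rewrite mul1r subr_gt0; apply: b2.
    by rewrite -e1 reg_le.
  have [e1 ->] := downward_level hu; rewrite mulN1r oppr_gt0 subr_lt0; apply: b1.
  by rewrite e1.
have G := focus_beyond p; rewrite -/f -/m in G.
(* the value of exp(-t) at the time t of arrival at the exit wall *)
pose rho := (f 0 m - exit_thr p) / (f 0 m - x0 0 m).
have d_neq : exit_sign p * (f 0 m - x0 0 m) > 0 by lra.
have d_neq0 : f 0 m - x0 0 m != 0.
  by move: d_neq; case: eqP => // ->; rewrite mulr0 ltxx.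
have rhoE : rho = (exit_sign p * (f 0 m - exit_thr p)) / (exit_sign p * (f 0 m - x0 0 m)).
  by rewrite -mulf_div divff ?exit_sign_neq0 // mul1r.
have rho0 : 0 < rho by rewrite rhoE divr_gt0.
have rho1 : rho < 1 by rewrite rhoE ltr_pdivrMr //; lra.
have exits z : between_thr N l j z -> between_thr N l j (f 0 l + rho * (z - f 0 l)).
  move=> hz; pose x : 'rV[R]_n := \row_i if i == l then z else x0 0 i.
  have hx : region (reg p) x.
    by move=> i; rewrite mxE; case: eqP => [->|].
  have [t [t0 hin [m' [ha hw hb]]]] := hent x hx.
  have em : m' = m := adjacent_unique ha (adj p); subst m'.
  have := hb l ne; rewrite /region_flow !mxE eqxx.
  have -> // : expR (- t) = rho.
  move: hw; rewrite /region_flow !mxE -/m [m == l]eq_sym (negbTE ne) -[thr _ _ _]/(exit_thr p) -/f => hw.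
  rewrite /rho -[exit_thr p]hw; field; exact: d_neq0.
have hz0 := hx0 l; set z0 := x0 0 l in hz0.
have fneq i : (0 < i <= nthr N l)%N -> f 0 l != thr N l i.
  by move=> hi; apply: focal_neq_thr.
have [b1 b2] := (betweenP _ jJ).1 hz0.
apply/(betweenP _ jJ); split => hj.
  rewrite lt_neqAle eq_sym fneq ?hj //= leNgt; apply/negP => flt.
  (* a starting value so close to the face that it is crossed by the time rho *)
  pose z := Num.min z0 (thr N l j + (1 - rho) * (thr N l j - f 0 l) / rho).
  have hd : 0 < (1 - rho) * (thr N l j - f 0 l) / rho.
    by rewrite divr_gt0 // mulr_gt0 // subr_gt0.
  have z1 : z <= z0 by rewrite ge_min lexx.
  have z2 : z <= thr N l j + (1 - rho) * (thr N l j - f 0 l) / rho by rewrite ge_min lexx orbT.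
  have z3 : thr N l j < z by rewrite lt_min b1 // ltrDl.
  have /exits/(betweenP _ jJ)[h3 _] : between_thr N l j z.
    by apply/(betweenP _ jJ); split => // h; apply: le_lt_trans z1 (b2 h).
  have := h3 hj; have : rho * z <= rho * thr N l j + (1 - rho) * (thr N l j - f 0 l).
    apply: le_trans (ler_wpM2l (ltW rho0) z2) _.
    by rewrite mulrDr lerD2l mulrCA divff ?mulr1 // gt_eqF.
  by move=> h4 h5; lra.
rewrite lt_neqAle fneq ?ltnS ?hj //= leNgt; apply/negP => flt.
pose z := Num.max z0 (thr N l j.+1 - (1 - rho) * (f 0 l - thr N l j.+1) / rho).
have hd : 0 < (1 - rho) * (f 0 l - thr N l j.+1) / rho.
  by rewrite divr_gt0 // mulr_gt0 // subr_gt0.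
have z1 : z0 <= z by rewrite le_max lexx.
have z2 : thr N l j.+1 - (1 - rho) * (f 0 l - thr N l j.+1) / rho <= z by rewrite le_max lexx orbT.
have z3 : z < thr N l j.+1 by rewrite gt_max b2 // ltrBlDr ltrDl.
have /exits/(betweenP _ jJ)[_ h3] : between_thr N l j z.
  by apply/(betweenP _ jJ); split => // h; apply: lt_le_trans (b1 h) z1.
have := h3 hj; have : rho * thr N l j.+1 - (1 - rho) * (f 0 l - thr N l j.+1) <= rho * z.
  apply: le_trans (ler_wpM2l (ltW rho0) z2).
  by rewrite [leRHS]mulrBr lerD2l lerN2 mulrCA divff ?mulr1 // gt_eqF.
by move=> h4 h5; lra.
Qed.

Lemma level_const q p m : (forall s, (q < s < p)%N -> exit_var s <> m) ->
  forall r, (q < r <= p)%N -> reg r m = reg p m.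
Proof.
move=> h r /andP[qr rp]; rewrite -(subnKC rp); rewrite -(subnKC rp) in h.
elim: (p - r)%N h => [|d IH] h; first by rewrite addn0.
rewrite IH; last by move=> s /andP[s1 s2]; apply: h; rewrite s1 addnS ltnW.
rewrite addnS reg_same //; apply/eqP => e; apply: (h (r + d)%N); last by [].
by rewrite addnS leqnn andbT (leq_trans qr) // leq_addr.
Qed.

Lemma focus_inward q r p : (q < r < p)%N -> exit_var q = exit_var p ->
  (forall s, (q < s < p)%N -> exit_var s <> exit_var p) ->
  0 < exit_sign p * (exit_thr p - focus r 0 (exit_var p)).
Proof.
move=> /andP[qr rp] e h.
have er := level_const h; have ne : exit_var p != exit_var r.
  by apply/eqP => e'; apply: (h r); rewrite ?qr ?rp.
have /(betweenP _ (reg_le _ _))[b1 b2] := focal_between ne.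
have erp : reg r (exit_var p) = reg p (exit_var p) by apply: er; rewrite qr ltnW.
rewrite erp in b1 b2; rewrite /exit_sign; case: ifPn => hu.
  have [e1 ->] := upward_level hu; rewrite mul1r subr_gt0; apply: b2.
  by rewrite -e1 reg_le.
have [e1 ->] := downward_level hu; rewrite mulN1r oppr_gt0 subr_lt0; apply: b1.
by rewrite e1.
Qed.

Lemma entry_level q : (upward q -> exit_thr q = thr N (exit_var q) (reg q.+1 (exit_var q))) /\
  (~~ upward q -> exit_thr q = thr N (exit_var q) (reg q.+1 (exit_var q)).+1).
Proof.
split=> hu; first by have [e1 ->] := upward_level hu; rewrite e1.
by have [e1 ->] := downward_level hu; rewrite e1.
Qed.

(** Between the two crossings the variable stays in one interval. It leaves
    this interval either by the end opposite to the one by which it entered,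
    the thresholds then being the two ends, or by the same end. *)
Lemma exit_entry q p : (q < p)%N -> exit_var q = exit_var p ->
  (forall s, (q < s < p)%N -> exit_var s <> exit_var p) ->
  (upward q = upward p -> 0 < exit_sign p * (exit_thr p - exit_thr q)) /\ (upward q != upward p -> exit_thr p = exit_thr q).
Proof.
move=> qp e h; have eq1 : reg q.+1 (exit_var p) = reg p (exit_var p).
  by apply: (level_const h); rewrite ltnSn.
have [e1 e2] := entry_level q; rewrite e eq1 in e1 e2.
rewrite /exit_sign; have [hu|hu] := boolP (upward p); have [g1 g2] := (@upward_level p, @downward_level p).
  have [g3 ->] := g1 hu; split => hq.
    rewrite mul1r subr_gt0 e1 ?hq //; apply: thr_lt.
    have [g5 _] := upward_level hq; rewrite e eq1 in g5.
    by rewrite {1}g5 /= -g3 reg_le.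
  by rewrite e2 //; case: (upward q) hq.
have [g3 ->] := g2 hu; split => hq.
  rewrite mulN1r oppr_gt0 subr_lt0 e2 ?hq //; apply: thr_lt.
  have hq' : ~~ upward q by rewrite hq.
  have [g5 _] := downward_level hq'; rewrite e eq1 in g5.
  by rewrite {1}g3 /= -g5 reg_le.
by rewrite e1 //; case: (upward q) hq.
Qed.

Lemma exit_thr_forward q p : (q < p)%N -> exit_var q = exit_var p ->
  (forall s, (q < s < p)%N -> exit_var s <> exit_var p) -> 0 <= exit_sign p * (exit_thr p - exit_thr q).
Proof.
move=> qp e h; have [h1 h2] := exit_entry qp e h.
have [/h1/ltW//|/h2 ->] := eqVneq (upward q) (upward p).
by rewrite subrr mulr0.
Qed.

(** If a variable were crossed back immediately, the focal point of the
    region in between would lie on both sides of the same threshold. *)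
Lemma exit_no_return p : exit_var p.+1 = exit_var p -> 0 < exit_sign p.+1 * (exit_thr p.+1 - exit_thr p).
Proof.
move=> e; have [|h1 h2] := @exit_entry p p.+1 (leqnn _) (esym e); first by move=> s; lia.
apply: h1; apply: contrapT => /eqP ne; have et := h2 ne.
have b1 := next_focus_beyond p; have b2 := focus_beyond p.+1.
rewrite e et in b2; move: b1 b2 ne; rewrite /exit_sign.
by case: (upward p) (upward p.+1) => -[] //; lra.
Qed.

(** * Passing through a region *)

Definition closed_between (i : 'I_n) (j : nat) (x : R) : Prop :=
  ((0 < j)%N -> thr N i j <= x) /\ ((j < nthr N i)%N -> x <= thr N i j.+1).

(** The points from which the flow of the region [reg p] passes through the
    region and leaves it by the exit wall: besides the region itself this
    contains the entry wall. *)
Definition start (p : nat) (x : 'rV[R]_n) : Prop :=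
  (forall l, closed_between l (reg p l) (x 0 l)) /\
  0 < exit_sign p * (exit_thr p - x 0 (exit_var p)).

Lemma between_closed i j x : (j <= nthr N i)%N -> between_thr N i j x -> closed_between i j x.
Proof. by move=> jJ /(betweenP _ jJ)[h1 h2]; split => [/h1|/h2] /ltW. Qed.

Lemma exit_side p x : between_thr N (exit_var p) (reg p (exit_var p)) x -> 0 < exit_sign p * (exit_thr p - x).
Proof.
move=> /(betweenP _ (reg_le _ _))[b1 b2].
rewrite /exit_sign; case: ifPn => hu.
  have [e1 ->] := upward_level hu; rewrite mul1r subr_gt0; apply: b2.
  by rewrite -e1 reg_le.
have [e1 ->] := downward_level hu; rewrite mulN1r oppr_gt0 subr_lt0; apply: b1.
by rewrite e1.
Qed.

Lemma region_start p x : region (reg p) x -> start p x.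
Proof.
move=> h; split; last exact: exit_side.
by move=> l; apply: between_closed (h l); apply: reg_le.
Qed.

Lemma wallE p x : wall (reg p) (reg p.+1) x <->
  x 0 (exit_var p) = exit_thr p /\ forall l, l != exit_var p -> between_thr N l (reg p l) (x 0 l).
Proof.
split=> [[m [ha h1 h2]]|[h1 h2]]; last by exists (exit_var p); split => //; apply: adj.
by have em := adjacent_unique ha (adj p); subst m.
Qed.

(** If the variable of the wall is also the one that is crossed next, then
    it is not at its exit threshold yet, by [exit_no_return]. *)
Lemma wall_start p x : wall (reg p) (reg p.+1) x -> start p.+1 x.
Proof.
move=> /wallE[h1 h2]; split.
  move=> l; have [->|ne] := eqVneq l (exit_var p).
    rewrite h1; have [e1 e2] := entry_level p; split => hj.
      have [hu|hu] := boolP (upward p); first by rewrite e1.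
      rewrite e2 // ltW //; apply: thr_lt; rewrite hj /=.
      by have [<- _] := downward_level hu; apply: reg_le.
    have [hu|hu] := boolP (upward p); last by rewrite e2.
    rewrite e1 // ltW //; apply: thr_lt; rewrite hj andbT.
    by have [-> _] := upward_level hu.
  by rewrite reg_same //; apply: between_closed (h2 l ne); apply: reg_le.
have [e|ne] := eqVneq (exit_var p.+1) (exit_var p).
  by rewrite e h1; apply: exit_no_return.
by apply: exit_side; rewrite reg_same //; apply: h2.
Qed.

Definition exit_weight (p : nat) (x : 'rV[R]_n) : R := step_weight exit_var exit_thr focus p (x, 1).

Lemma exit_weightE p x : exit_weight p x = exit_sign p * (exit_thr p - x 0 (exit_var p)) / (exit_sign p * (focus p 0 (exit_var p) - exit_thr p)).
Proof.
have h := focus_beyond p; have h0 : focus p 0 (exit_var p) - exit_thr p != 0.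
  by move: h; case: eqP => // ->; rewrite mulr0 ltxx.
by rewrite /exit_weight /step_weight /= mulr1; field; rewrite h0 exit_sign_neq0.
Qed.

Lemma exit_weight_gt0 p x : start p x -> 0 < exit_weight p x.
Proof. by case=> _ h; rewrite exit_weightE divr_gt0 // focus_beyond. Qed.

(** The flow, with the time replaced by rho = exp(-t). *)
Definition towards (p : nat) (x : 'rV[R]_n) (rho : R) : 'rV[R]_n :=
  focus p + rho *: (x - focus p).

Definition hit (p : nat) (x : 'rV[R]_n) : 'rV[R]_n := towards p x (1 + exit_weight p x)^-1.

Lemma towards_between p x rho l : start p x -> 0 < rho < 1 -> l != exit_var p ->
  between_thr N l (reg p l) (towards p x rho 0 l).
Proof.
move=> [hc _] /andP[r0 r1] ne; have [c1 c2] := hc l.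
have /(betweenP _ (reg_le _ _))[b1 b2] := focal_between ne.
have -> : towards p x rho 0 l = (1 - rho) * focus p 0 l + rho * x 0 l.
  by rewrite /towards !mxE; ring.
have r1' : 0 < 1 - rho by rewrite subr_gt0.
apply/(betweenP _ (reg_le _ _)); split => hj.
  have h1 := b1 hj; have h2 := c1 hj.
  have h3 : (1 - rho) * thr N l (reg p l) < (1 - rho) * focus p 0 l by rewrite ltr_pM2l.
  have h4 : rho * thr N l (reg p l) <= rho * x 0 l by rewrite ler_pM2l.
  lra.
have h1 := b2 hj; have h2 := c2 hj.
have h3 : (1 - rho) * focus p 0 l < (1 - rho) * thr N l (reg p l).+1 by rewrite ltr_pM2l.
have h4 : rho * x 0 l <= rho * thr N l (reg p l).+1 by rewrite ler_pM2l.
lra.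
Qed.

Lemma towards_exit p x rho :
  exit_sign p * (exit_thr p - towards p x rho 0 (exit_var p)) =
  exit_sign p * (focus p 0 (exit_var p) - exit_thr p) * (rho * (1 + exit_weight p x) - 1).
Proof.
rewrite exit_weightE /towards !mxE; have h := focus_beyond p; set G := exit_sign p * _ in h *.
have -> : G * (rho * (1 + exit_sign p * (exit_thr p - x 0 (exit_var p)) / G) - 1) =
  rho * (G + exit_sign p * (exit_thr p - x 0 (exit_var p))) - G by field; rewrite gt_eqF.
rewrite /G; ring.
Qed.

Lemma towards_region p x rho : start p x -> (1 + exit_weight p x)^-1 < rho < 1 ->
  region (reg p) (towards p x rho).
Proof.
move=> hs /andP[h1 h2] l; have w0 := exit_weight_gt0 hs.
have r0 : 0 < rho by apply: lt_trans h1; rewrite invr_gt0; lra.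
have [->|ne] := eqVneq l (exit_var p); last by apply: towards_between; rewrite // r0.
have hx : 0 < exit_sign p * (exit_thr p - towards p x rho 0 (exit_var p)).
  rewrite towards_exit mulr_gt0 ?focus_beyond // subr_gt0 -ltr_pdivrMr; last lra.
  by rewrite div1r.
have hback : 0 < exit_sign p * (towards p x rho 0 (exit_var p) - x 0 (exit_var p)).
  have -> : exit_sign p * (towards p x rho 0 (exit_var p) - x 0 (exit_var p)) =
     (1 - rho) * (exit_sign p * (focus p 0 (exit_var p) - exit_thr p) + exit_sign p * (exit_thr p - x 0 (exit_var p))).
    by rewrite /towards !mxE; ring.
  by rewrite mulr_gt0 ?subr_gt0 // addr_gt0 ?focus_beyond //; case: hs.
have [c1 c2] := hs.1 (exit_var p).
apply/(betweenP _ (reg_le _ _)); move: hx hback; rewrite /exit_sign; case: ifPn => hu.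
  have [e1 ->] := upward_level hu; rewrite !mul1r !subr_gt0 => g1 g2; split => // hj.
  by apply: le_lt_trans g2; apply: c1.
have [e1 ->] := downward_level hu; rewrite !mulN1r !oppr_gt0 !subr_lt0 => g1 g2; split => // hj.
by apply: lt_le_trans g2 _; apply: c2.
Qed.

Lemma hit_wall p x : start p x -> wall (reg p) (reg p.+1) (hit p x).
Proof.
move=> hs; have w0 := exit_weight_gt0 hs; have w1 : 0 < 1 + exit_weight p x by lra.
apply/wallE; split; last first.
  by move=> l; apply: towards_between => //; rewrite invr_gt0 w1 invf_lt1 //; lra.
have := towards_exit p x (1 + exit_weight p x)^-1; rewrite -/(hit p x) mulVf ?gt_eqF // subrr mulr0.
move/eqP; rewrite mulf_eq0 (negbTE (exit_sign_neq0 p)) subr_eq0 /= => /eqP; exact: esym.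
Qed.

Lemma hit_start p x : start p x -> start p.+1 (hit p x).
Proof. by move=> /hit_wall /wall_start. Qed.

(** * The sequence of crossing points *)

Fixpoint vertex (p : nat) (x : 'rV[R]_n) (q : nat) : 'rV[R]_n :=
  if q is q'.+1 then hit (p + q') (vertex p x q') else x.

Lemma vertex_start p x q : start p x -> start (p + q) (vertex p x q).
Proof.
move=> h; elim: q => [|q IH]; first by rewrite addn0.
by rewrite addnS; apply: hit_start.
Qed.

Lemma vertex_add p x q r : vertex p x (q + r) = vertex (p + q) (vertex p x q) r.
Proof. by elim: r => [|r IH]; rewrite ?addn0 // addnS /= IH addnA. Qed.

Lemma upward_per p : upward (p + k) = upward p.
Proof. by rewrite /upward -addSn !reg_per exit_var_per. Qed.

Lemma exit_sign_per p : exit_sign (p + k) = exit_sign p.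
Proof. by rewrite /exit_sign upward_per. Qed.

Lemma hit_per p x : hit (p + k) x = hit p x.
Proof. by rewrite /hit /towards /exit_weight /step_weight !exit_var_per !exit_thr_per !focus_per. Qed.

Lemma vertex_per p x q : vertex (p + k) x q = vertex p x q.
Proof. by elim: q => [//|q IH] /=; rewrite IH addnAC hit_per. Qed.

Lemma vertex_per_mul i x q : vertex (i * k) x q = vertex 0 x q.
Proof.
by elim: i => [|i IH]; rewrite ?mul0n // mulSn addnC vertex_per.
Qed.

Lemma start_per p x : start (p + k) x <-> start p x.
Proof. by rewrite /start reg_per exit_sign_per exit_thr_per exit_var_per. Qed.

Lemma start_per_mul i x : start (i * k) x <-> start 0 x.
Proof.
by elim: i => [|i IH]; rewrite ?mul0n // mulSn addnC start_per.
Qed.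

Let ST := run exit_var exit_thr focus.
Let TT := weight exit_var exit_thr focus.

(** By homogeneity, the weight of (X, D) is D times the one of (X / D, 1). *)
Lemma vertex_lift x q : start 0 x ->
  [/\ 0 < (ST (x, 1) q).2, vertex 0 x q = ((ST (x, 1) q).2)^-1 *: (ST (x, 1) q).1 &
      0 < TT (x, 1) q].
Proof.
move=> hs; elim: q => [|q [D0 hv T0]].
  by split; rewrite ?ltr01 //= ?invr1 ?scale1r //; apply: exit_weight_gt0.
have h0 := vertex_start q hs; rewrite add0n in h0.
have key i (w : state) : 0 < w.2 -> step_weight exit_var exit_thr focus i w = w.2 * exit_weight i (w.2^-1 *: w.1).
  move=> w0; have h := focus_beyond i; have e0 : focus i 0 (exit_var i) - exit_thr i != 0.
    by move: h; case: eqP => // ->; rewrite mulr0 ltxx.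
  rewrite /exit_weight /step_weight /= !mxE mulr1; field; rewrite e0 gt_eqF //.
have TE : TT (x, 1) q = (ST (x, 1) q).2 * exit_weight q (vertex 0 x q) by rewrite hv; apply: key.
have w0 := exit_weight_gt0 h0.
have D1 : 0 < (ST (x, 1) q.+1).2.
  by rewrite /ST run_snd; apply: addr_gt0.
have hv1 : vertex 0 x q.+1 = ((ST (x, 1) q.+1).2)^-1 *: (ST (x, 1) q.+1).1.
  apply/rowP => l; rewrite [RHS]mxE /ST run_fst run_snd -/ST -/TT TE -[vertex 0 x q.+1]/(hit (0 + q) (vertex 0 x q)) add0n.
  rewrite /hit /towards; move: w0; set w := exit_weight _ _ => w0.
  rewrite !mxE hv mxE; set D := (ST _ _).2 in D0 *.
  have h1 : 0 < 1 + w by lra.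
  have h2 : 0 < D + D * w by rewrite addr_gt0 // mulr_gt0.
  by field; rewrite !gt_eqF.
split => //; have h1 := vertex_start q.+1 hs; rewrite add0n hv1 in h1.
by rewrite /TT /weight -/ST key // mulr_gt0 // exit_weight_gt0.
Qed.

Lemma positive_lift x : start 0 x -> positive exit_var exit_thr focus (x, 1 : R^o).
Proof. by move=> hs; split => [p|]; [case: (vertex_lift p hs)|exact: ltr01]. Qed.

Lemma vertex_turns x j q : vertex 0 x (j * turn k + q) = vertex 0 (vertex 0 x (j * turn k)) q.
Proof.
have -> : (j * turn k = (j * 3) * k)%N by rewrite /turn; lia.
by rewrite vertex_add add0n vertex_per_mul.
Qed.

Lemma proj_lift x q l : start 0 x -> proj (ST (x, 1) q) l = vertex 0 x q 0 l.
Proof. by move=> hs; have [_ -> _] := vertex_lift q hs; rewrite /proj mxE mulrC. Qed.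

Lemma rV_ballP (y z : 'rV[R]_n) (e : R) :
  ball y e z <-> 0 < e /\ forall l, `|y 0 l - z 0 l| < e.
Proof.
split=> [[e0 h]|[e0 h]]; split => //; first by move=> l; apply: h.
by move=> i l; rewrite ord1; apply: h.
Qed.

Lemma rV_cvg {A : Type} {F : set_system A} {FF : Filter F} (h : A -> 'rV[R]_n) (y : 'rV[R]_n) :
  (forall l, (fun t => h t 0 l) @ F --> y 0 l) -> h @ F --> y.
Proof.
move=> hc; apply/cvg_ballP => e e0.
have : \forall t \near F, forall l, ball (y 0 l) e (h t 0 l).
  by apply: filter_forall => l; have := hc l => /cvg_ballP; apply.
by apply: filterS => t ht; apply/rV_ballP.
Qed.

Lemma coord_cvg (g : 'rV[R]_n) l : (fun x : 'rV[R]_n => x 0 l) @ g --> g 0 l.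
Proof. exact: coord_continuous. Qed.

Lemma interpolation_cvg (A : Type) (F : set_system A) (FF : Filter F) (W X : A -> R) (w x c : R) :
  0 <= w -> W @ F --> w -> X @ F --> x ->
  (fun a => c + (1 + W a)^-1 * (X a - c)) @ F --> c + (1 + w)^-1 * (x - c).
Proof.
move=> w0 hW hX; apply: cvgD; first exact: cvg_cst.
apply: cvgM; last by apply: cvgB; [|exact: cvg_cst].
apply: cvgV; first by rewrite gt_eqF //; lra.
by apply: cvgD; [exact: cvg_cst|].
Qed.

Lemma exit_weight_continuous p g : {for g, continuous (exit_weight p)}.
Proof.
have gen (A : Type) (F : set_system A) (FF : Filter F) (X : A -> R) (x a b : R) : X @ F --> x ->
    (fun t => (a - X t) * b) @ F --> (a - x) * b.
  move=> hX; apply: cvgM; last exact: cvg_cst.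
  by apply: cvgB; [exact: cvg_cst|].
exact: (gen _ _ (nbhs_filter g) _ _ (exit_thr p * 1) _ (@coord_cvg g (exit_var p))).
Qed.

(** The case of weight 0 is that of a point of the exit wall, which [hit]
    fixes; nearby points on either side of the wall are then mapped close to
    it. *)
Lemma hit_continuous p g : 0 <= exit_weight p g -> {for g, continuous (hit p)}.
Proof.
move=> w0; apply: (@rV_cvg _ _ (nbhs_filter g)) => l.
have e (x : 'rV[R]_n) : hit p x 0 l = focus p 0 l + (1 + exit_weight p x)^-1 * (x 0 l - focus p 0 l).
  by rewrite /hit /towards !mxE.
rewrite e (_ : (fun x => _) = (fun x : 'rV[R]_n => focus p 0 l + (1 + exit_weight p x)^-1 * (x 0 l - focus p 0 l))).
  apply: (interpolation_cvg (nbhs_filter g) (W := exit_weight p) (X := fun x : 'rV[R]_n => x 0 l)) => //.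
    exact: exit_weight_continuous.
  exact: coord_cvg.
by apply/funext => x; apply: e.
Qed.

Lemma vertex_continuous p g q : start p g -> {for g, continuous (fun x => vertex p x q)}.
Proof.
move=> hs; elim: q => [|q IH]; first exact: cvg_id.
have h := vertex_start q hs.
have hc := hit_continuous (ltW (exit_weight_gt0 h)).
exact: (continuous_comp IH hc).
Qed.

Lemma vertex_near p g q (e : R) : start p g -> 0 < e ->
  \forall x \near g, ball (vertex p g q) e (vertex p x q).
Proof.
by move=> hs e0; have /cvg_ballP/(_ e e0) := @vertex_continuous p g q hs.
Qed.

(** The properties of the periodic orbit in terms of its crossing points. *)
Definition limit_cycle (xs : 'rV[R]_n) : Prop :=
  [/\ start 0 xs, vertex 0 xs k = xs,
    forall x, start 0 x -> forall e : R, 0 < e ->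
      exists Q, forall q, (Q <= q)%N -> ball (vertex 0 xs q) e (vertex 0 x q) &
    forall e : R, 0 < e -> exists2 d : R, 0 < d & forall x, start 0 x ->
      ball xs d x -> forall q, ball (vertex 0 xs q) e (vertex 0 x q)].

Definition all_degenerate : Prop :=
  forall x, start 0 x -> forall e : R, 0 < e -> exists Q, forall q p,
    (Q <= q)%N -> `|vertex 0 x q 0 (exit_var p) - exit_thr p| < e.

Lemma limit_start (x : nat -> 'rV[R]_n) (xs : 'rV[R]_n) :
  (forall j, start 0 (x j)) ->
  (forall e : R, 0 < e -> exists P, forall p l, (P <= p)%N -> `|x p 0 l - xs 0 l| < e) ->
  0 < exit_weight 0 xs -> start 0 xs.
Proof.
move=> hx hl w0; split.
  move=> l; split => hj; rewrite leNgt; apply/negP => hlt.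
    set c := thr N l _ in hlt; have e0 : 0 < c - xs 0 l by rewrite subr_gt0.
    have [P hP] := hl _ e0; have := hP P l (leqnn _); have := ((hx P).1 l).1 hj.
    by rewrite -/c ltr_norml => h1 /andP[_ h2]; lra.
  set c := thr N l _ in hlt; have e0 : 0 < xs 0 l - c by rewrite subr_gt0.
  have [P hP] := hl _ e0; have := hP P l (leqnn _); have := ((hx P).1 l).2 hj.
  by rewrite -/c ltr_norml => h1 /andP[h2 _]; lra.
move: w0; rewrite exit_weightE => w0; have h := focus_beyond 0.
by rewrite pmulr_lgt0 ?invr_gt0 in w0.
Qed.

(** The results on the turn map, carried over to crossing points. The
    eigenvector is fixed by three rounds; it is fixed by one round because
    its image under one round is attracted to it and yet fixed by three
    rounds. *)
Lemma discrete_dichotomy : (exists xs, limit_cycle xs) \/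
  (~ multi exit_var exit_thr /\ all_degenerate).
Proof.
have [x0 /region_start hx0] := region_point (reg 0).
have [|[xs [Lam [L1 eig Tv]]]|[nm sub]] := dichotomy k0 exit_var_per exit_thr_per focus_per
  focus_beyond focus_inward exit_thr_forward exit_no_return.
- by exists (x0, 1); apply: positive_lift.
- left; exists xs.
  have att := attraction k0 exit_var_per exit_thr_per focus_per
    focus_beyond focus_inward exit_thr_forward exit_no_return L1 eig Tv.
  have loc := local_stability k0 exit_var_per exit_thr_per focus_per
    focus_beyond focus_inward exit_thr_forward exit_no_return L1 eig Tv.
  have att' x : start 0 x -> forall e : R, 0 < e -> exists P, forall p l, (P <= p)%N ->
      `|vertex 0 x (p * turn k) 0 l - xs 0 l| < e.
    move=> hs e e0; have [P hP] := att (x, 1) (positive_lift hs) erefl e e0.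
    by exists P => p l Pp; rewrite -proj_lift //; apply: hP.
  have hxs : start 0 xs.
    apply: (limit_start (x := fun p => vertex 0 x0 (p * turn k))); last exact: (Tv 0).
      move=> j; have h := vertex_start (j * turn k) hx0; rewrite add0n in h.
      have e : (j * turn k = (j * 3) * k)%N by rewrite /turn; lia.
      have h' : start (j * 3 * k) (vertex 0 x0 (j * turn k)) by rewrite -e.
      exact: (start_per_mul _ _).1 h'.
    exact: att'.
  have stk x : start 0 x -> start 0 (vertex 0 x k).
    by move=> hs; apply: (start_per 0 _).1 (vertex_start k hs).
  have fixt : vertex 0 xs (turn k) = xs.
    have [_ -> _] := vertex_lift (turn k) hxs; rewrite /ST eig /=.
    apply/rowP => l; rewrite !mxE /GRing.scale /= mulr1 mulrA mulVf ?mul1r //.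
    by rewrite gt_eqF // (lt_trans ltr01).
  have fixj j : vertex 0 xs (j * turn k) = xs.
    by elim: j => [//|j IH]; rewrite mulSn addnC vertex_turns IH.
  have fixk : vertex 0 xs k = xs.
    apply/rowP => l; apply/eqP; rewrite -subr_eq0 -normr_le0; apply/ler_addgt0Pl => e e0.
    rewrite addr0; have [P hP] := att' _ (stk _ hxs) e e0.
    have := hP P l (leqnn _); have -> : vertex 0 (vertex 0 xs k) (P * turn k) = vertex 0 xs k.
      have := vertex_add 0 xs k (P * turn k); rewrite add0n.
      have -> : vertex k (vertex 0 xs k) (P * turn k) = vertex 0 (vertex 0 xs k) (P * turn k).
        by rewrite -[in LHS](add0n k) vertex_per.
      by move=> <-; rewrite addnC vertex_turns fixj.
    exact: ltW.
  have near_all (e : R) : 0 < e -> \forall z \near xs, forall r : 'I_(turn k),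
      ball (vertex 0 xs r) e (vertex 0 z r).
    by move=> e0; apply: (@filter_forall _ _ _ (nbhs xs) (nbhs_filter xs)) => r; apply: vertex_near.
  have near_ball (e : R) : 0 < e -> exists2 d : R, 0 < d & forall z, ball xs d z ->
      forall r, (r < turn k)%N -> ball (vertex 0 xs r) e (vertex 0 z r).
    move=> e0; have /nbhs_ballP[d /= d0 hd] := near_all e e0.
    by exists d => // z hz r hr; apply: (hd z hz (Ordinal hr)).
  have split_q x q : vertex 0 x q = vertex 0 (vertex 0 x (q %/ turn k * turn k)) (q %% turn k).
    by rewrite -vertex_turns -divn_eq.
  have tk0 : (0 < turn k)%N by apply: turn_gt0.
  split => //.
    move=> x hs e e0; have [d d0 hd] := near_ball e e0.
    have [P hP] := att' x hs d d0.
    exists (P * turn k)%N => q hq; rewrite (split_q xs) (split_q x) fixj.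
    apply: hd; last by rewrite ltn_mod.
    apply/rV_ballP; split=> // l; rewrite distrC; apply: hP.
    by rewrite leq_divRL.
  move=> e e0; have [d d0 hd] := near_ball e e0.
  have [d' d'0 hd'] := loc d d0.
  exists d' => // x hs hx q; rewrite (split_q xs) (split_q x) fixj.
  apply: hd; last by rewrite ltn_mod.
  apply/rV_ballP; split=> // l; rewrite distrC -proj_lift //; apply: hd' => //.
    exact: positive_lift.
  by move=> l'; move/rV_ballP: hx => [_ /(_ l')]; rewrite distrC.
right; split => // x hs e e0.
(* In the subcritical case all weights of two rounds are eventually at most
   e' D. From any crossing, the next crossing of the variable of p comes
   within two rounds, and there X_m = theta D exactly; hence X_m / D is
   close to theta already before. F bounds the coefficients of the weights. *)
pose F := \sum_(l < n) \sum_(r < k) \sum_(s < k) `|focus r 0 l - exit_thr s|.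
have F0 : 0 <= F by do 3! (apply: sumr_ge0 => ? _).
pose u : state := (x, 1).
have hu := positive_lift hs.
have ST1 q : (ST u q).2 <= (ST u q.+1).2.
  by rewrite /ST run_snd lerDl; apply/ltW/hu.1.
have STmono q r : (ST u q).2 <= (ST u (q + r)).2.
  by elim: r => [|r IH]; rewrite ?addn0 // addnS; apply: le_trans IH _.
pose M : R := F * ((k + k)%:R * 2 ^+ (k + k)).
have M0 : 0 <= M by rewrite !mulr_ge0 // exprn_ge0.
pose e' := Num.min 1 (e / (M + 1)).
have e'0 : 0 < e' by rewrite lt_min ltr01 divr_gt0 //; lra.
have e'1 : e' <= 1 by rewrite ge_min lexx.
have e'e : e' * M < e.
  have h : e' <= e / (M + 1) by rewrite ge_min lexx orbT.
  apply: (@le_lt_trans _ _ (e / (M + 1) * M)); first by rewrite ler_wpM2r.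
  rewrite mulrAC ltr_pdivrMr; last lra.
  rewrite ltr_pM2l //; lra.
have tk0 : (0 < turn k)%N by apply: turn_gt0.
have [P hP] := sub u hu e' e'0.
have small q : (P * turn k <= q)%N -> TT u q <= e' * (ST u q).2.
  move=> hq; rewrite {1}(divn_eq q (turn k)).
  have h : (P <= q %/ turn k)%N by rewrite leq_divRL.
  have h2 : (q %% turn k < turn k)%N by rewrite ltn_mod.
  apply: le_trans (hP _ _ h h2) _; rewrite ler_pM2l // {2}(divn_eq q (turn k)).
  exact: STmono.
have grow q r : (P * turn k <= q)%N -> (ST u (q + r)).2 <= 2 ^+ r * (ST u q).2.
  move=> hq; elim: r => [|r IH]; first by rewrite addn0 expr0 mul1r.
  have D0 : 0 < (ST u (q + r)).2 by case: (vertex_lift (q + r) hs).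
  rewrite addnS /ST run_snd -/ST exprS -mulrA.
  have h := small (q + r)%N (leq_trans hq (leq_addr _ _)).
  have h2 : e' * (ST u (q + r)).2 <= (ST u (q + r)).2 by rewrite ger_pMl.
  have h3 := le_trans h h2.
  by apply: le_trans (lerD (lexx _) h3) _; lra.
exists (P * turn k)%N => q p hq.
have [D0 hv _] := vertex_lift q hs.
rewrite hv mxE.
have [c [qc ck ec tc]] : exists c, [/\ (q <= c)%N, (c < q + (k + k))%N, exit_var c = exit_var p & exit_thr c = exit_thr p].
  have mper (A : Type) (h : nat -> A) : (forall p, h (p + k)%N = h p) -> forall i p, h (i * k + p)%N = h p.
    by move=> hh; elim=> [//|i IH] p'; rewrite mulSn -addnA addnC hh.
  have q1 := divn_eq q k; have q2 : (q %% k < k)%N by rewrite ltn_mod.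
  have p2 : (p %% k < k)%N by rewrite ltn_mod.
  exists ((q %/ k).+1 * k + p %% k)%N.
  rewrite (mper _ exit_var exit_var_per) (mper _ exit_thr exit_thr_per).
  split; [lia|lia| |]; rewrite [in RHS](divn_eq p k);
    by rewrite ?(mper _ exit_var exit_var_per) ?(mper _ exit_thr exit_thr_per).
have h := @run_sum _ _ exit_var exit_thr focus u (exit_var p) (exit_thr p) q c.+1 (leq_trans qc (leqnSn _)).
have hx := @run_exit _ _ exit_var exit_thr exit_sign focus focus_beyond u c.
rewrite ec tc in hx; rewrite hx subrr -/ST -/TT in h.
have hX : `|(ST u q).1 0 (exit_var p) - exit_thr p * (ST u q).2| < e * (ST u q).2.
  have -> : (ST u q).1 0 (exit_var p) - exit_thr p * (ST u q).2 =
     - \sum_(q <= r < c.+1) (focus r 0 (exit_var p) - exit_thr p) * TT u r by lra.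
  rewrite normrN; apply: le_lt_trans (ler_norm_sum _ _ _) _.
  apply: (@le_lt_trans _ _ (\sum_(q <= r < c.+1) F * (e' * (2 ^+ (k + k) * (ST u q).2)))).
    rewrite !big_nat; apply: ler_sum => r /andP[qr rc].
    rewrite normrM; apply: ler_pM => //.
      have r2 : (r %% k < k)%N by rewrite ltn_mod.
      have p2 : (p %% k < k)%N by rewrite ltn_mod.
      have -> : focus r = focus (Ordinal r2).
        by rewrite /focus /reg; congr (focal (O _)); apply: val_inj; rewrite /= modn_mod.
      have -> : exit_thr p = exit_thr (Ordinal p2).
        rewrite [in LHS](divn_eq p k) /=; elim: (p %/ k)%N => [//|i IH].
        by rewrite mulSn -addnA addnC exit_thr_per.
      rewrite /F (bigD1 (exit_var p)) //= (bigD1 (Ordinal r2)) //= (bigD1 (Ordinal p2)) //= -!addrA lerDl.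
      by rewrite !addr_ge0 //; do ? (apply: sumr_ge0 => ? _).
    rewrite gtr0_norm; last by case: (vertex_lift r hs).
    apply: le_trans (small r (leq_trans hq qr)) _; rewrite ler_pM2l //.
    rewrite -(subnKC qr); apply: le_trans (grow q (r - q)%N hq) _.
    rewrite ler_pM2r //; apply: ler_weXn2l; rewrite ?ler1n //; lia.
  rewrite sumr_const_nat -[ltLHS]mulr_natl.
  apply: (@le_lt_trans _ _ ((k + k)%:R * (F * (e' * (2 ^+ (k + k) * (ST u q).2))))).
    apply: ler_wpM2r; last by rewrite ler_nat; lia.
    by rewrite !mulr_ge0 ?exprn_ge0 // ?ltW.
  have -> : (k + k)%:R * (F * (e' * (2 ^+ (k + k) * (ST u q).2))) = e' * M * (ST u q).2.
    by rewrite /M; ring.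
  by rewrite ltr_pM2r.
have -> : (ST u q).2^-1 * (ST u q).1 0 (exit_var p) - exit_thr p =
   ((ST u q).1 0 (exit_var p) - exit_thr p * (ST u q).2) / (ST u q).2.
  by field; rewrite gt_eqF.
by rewrite normf_div (gtr0_norm D0) ltr_pdivrMr.
Qed.

(** * Local structure and disjointness of regions and walls *)

Lemma min_radius (e : 'I_n -> R) : (forall l, 0 < e l) ->
  exists2 d : R, 0 < d & forall l, d <= e l.
Proof.
move=> e0; pose s := 1 + \sum_l (e l)^-1.
have s0 : 0 < s.
  by rewrite ltr_pwDl // sumr_ge0 // => l _; rewrite invr_ge0 ltW.
exists s^-1; first by rewrite invr_gt0.
move=> l; rewrite -[leRHS]invrK lef_pV2 ?posrE ?invr_gt0 // /s (bigD1 l) //= addrCA lerDl.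
by rewrite addr_ge0 // sumr_ge0 // => i _; rewrite invr_ge0 ltW.
Qed.

Lemma between_open i j (x : R) : (j <= nthr N i)%N -> between_thr N i j x ->
  exists2 e : R, 0 < e & forall z, `|x - z| < e -> between_thr N i j z.
Proof.
move=> jJ /(betweenP _ jJ)[h1 h2].
pose e1 := if (0 < j)%N then x - thr N i j else 1.
pose e2 := if (j < nthr N i)%N then thr N i j.+1 - x else 1.
exists (Num.min e1 e2).
  rewrite lt_min /e1 /e2; apply/andP; split; case: ifP => //.
    by move=> /h1; rewrite subr_gt0.
  by move=> /h2; rewrite subr_gt0.
move=> z; rewrite lt_min /e1 /e2 !ltr_norml => /andP[/andP[_ g1] /andP[g2 _]].
apply/(betweenP _ jJ); split => hj.
  by move: g1; rewrite hj; lra.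
by move: g2; rewrite hj; lra.
Qed.

Lemma region_open a x : region a x ->
  exists2 e : R, 0 < e & forall z : 'rV[R]_n, (forall l, `|x 0 l - z 0 l| < e) -> region (N := N) a z.
Proof.
move=> h; have hl l : exists e : R, 0 < e /\ forall z, `|x 0 l - z| < e -> between_thr N l (a l) z.
  by have [e e0 he] := between_open (reg_le a l) (h l); exists e.
have [e he] := choice hl; have [d d0 hd] := min_radius (fun l => (he l).1).
exists d => // z hz l; apply: (he l).2; exact: lt_le_trans (hz l) (hd l).
Qed.

Lemma thr_local i j : (j < nthr N i)%N -> exists2 e : R, 0 < e &
  forall z, `|thr N i j.+1 - z| < e ->
    (z < thr N i j.+1 -> between_thr N i j z) /\
    (thr N i j.+1 < z -> between_thr N i j.+1 z).
Proof.
move=> jJ; pose e1 := if (0 < j)%N then thr N i j.+1 - thr N i j else 1.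
pose e2 := if (j.+1 < nthr N i)%N then thr N i j.+2 - thr N i j.+1 else 1.
exists (Num.min e1 e2).
  rewrite lt_min /e1 /e2; apply/andP; split; case: ifP => // hj; rewrite subr_gt0;
  by apply: thr_lt; rewrite ?hj.
move=> z; rewrite lt_min /e1 /e2 !ltr_norml => /andP[/andP[_ g1] /andP[g2 _]].
split=> hz.
  apply/(betweenP _ (ltnW jJ)); split => // hj.
  by move: g1; rewrite hj; lra.
apply/(betweenP _ jJ); split => // hj.
by move: g2; rewrite hj; lra.
Qed.

Lemma wall_local q x : wall (reg q) (reg q.+1) x ->
  exists2 e : R, 0 < e & forall z : 'rV[R]_n, (forall l, `|x 0 l - z 0 l| < e) ->
    [/\ 0 < exit_sign q * (z 0 (exit_var q) - exit_thr q) -> region (reg q.+1) z,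
        exit_sign q * (z 0 (exit_var q) - exit_thr q) < 0 -> region (reg q) z &
        z 0 (exit_var q) = exit_thr q -> wall (reg q) (reg q.+1) z].
Proof.
move=> /wallE[h1 h2].
have hl l : exists e : R, 0 < e /\ forall z, `|x 0 l - z| < e -> l != exit_var q ->
    between_thr N l (reg q l) z.
  have [->|ne] := eqVneq l (exit_var q); first by exists 1.
  have [e e0 he] := between_open (reg_le (reg q) l) (h2 l ne).
  by exists e; split => // z hz _; apply: he.
have [e he] := choice hl; have [d d0 hd] := min_radius (fun l => (he l).1).
have other (z : 'rV[R]_n) : (forall l, `|x 0 l - z 0 l| < d) -> forall l, l != exit_var q ->
    between_thr N l (reg q l) (z 0 l).
  by move=> hz l; apply: (he l).2; exact: lt_le_trans (hz l) (hd l).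
have [d' d'0 hd'] : exists2 e : R, 0 < e & forall z : R, `|exit_thr q - z| < e ->
   (0 < exit_sign q * (z - exit_thr q) -> between_thr N (exit_var q) (reg q.+1 (exit_var q)) z) /\
   (exit_sign q * (z - exit_thr q) < 0 -> between_thr N (exit_var q) (reg q (exit_var q)) z).
  rewrite /exit_sign; case: ifPn => hu.
    have [e1 e2] := upward_level hu.
    have hj : (reg q (exit_var q) < nthr N (exit_var q))%N by rewrite -e1 reg_le.
    have [r r0 hr] := thr_local hj; exists r => // z.
    rewrite e2 => /hr[g1 g2]; rewrite !mul1r subr_gt0 subr_lt0 e1; by split.
  have [e1 e2] := downward_level hu.
  have hj : (reg q.+1 (exit_var q) < nthr N (exit_var q))%N by rewrite -e1 reg_le.
  have [r r0 hr] := thr_local hj; exists r => // z.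
  rewrite e2 e1 => /hr[g1 g2]; rewrite !mulN1r oppr_gt0 subr_lt0 oppr_lt0 subr_gt0; by split.
exists (Num.min d d'); first by rewrite lt_min d0.
move=> z hz.
have hz1 : forall l, `|x 0 l - z 0 l| < d by move=> l; have := hz l; rewrite lt_min => /andP[].
have hz2 : `|exit_thr q - z 0 (exit_var q)| < d' by have := hz (exit_var q); rewrite lt_min h1 => /andP[].
have [g1 g2] := hd' _ hz2; have ho := other z hz1.
split => h.
- move=> l; have [->|ne] := eqVneq l (exit_var q); first exact: g1.
  by rewrite reg_same //; apply: ho.
- by move=> l; have [->|ne] := eqVneq l (exit_var q); [exact: g2|exact: ho].
- by apply/wallE.
Qed.

Lemma between_unique i j j' (x : R) : (j <= nthr N i)%N -> (j' <= nthr N i)%N ->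
  between_thr N i j x -> between_thr N i j' x -> j = j'.
Proof.
wlog: j j' / (j <= j')%N.
  by move=> h; case: (leqP j j') => [|/ltnW] h1 h2 h3 h4 h5; [apply: h|apply/esym/h].
rewrite leq_eqVlt => /predU1P[//|jj'] jJ j'J /(betweenP _ jJ)[_ h1] /(betweenP _ j'J)[h2 _].
have h3 := h1 (leq_trans jj' j'J); have h4 := h2 (leq_ltn_trans (leq0n _) jj').
have : thr N i j.+1 <= thr N i j'.
  move: jj'; rewrite leq_eqVlt => /predU1P[->//|jj'].
  by apply/ltW/thr_mono.
by move=> h5; have := lt_trans (lt_le_trans h3 h5) h4; rewrite ltxx.
Qed.

Lemma between_not_thr i j c (x : R) : (j <= nthr N i)%N -> (0 < c <= nthr N i)%N ->
  between_thr N i j x -> x <> thr N i c.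
Proof.
move=> jJ /andP[c0 cJ] /(betweenP _ jJ)[h1 h2] e.
have [cj|jc] := leqP c j.
  have j0 : (0 < j)%N by apply: leq_trans cj.
  have := h1 j0; rewrite e; move: cj; rewrite leq_eqVlt => /predU1P[->|cj]; first by rewrite ltxx.
  by rewrite ltNge ltW // thr_mono // c0.
have := h2 (leq_trans jc cJ); rewrite e; move: jc; rewrite leq_eqVlt => /predU1P[->|jc]; first by rewrite ltxx.
by rewrite ltNge ltW // thr_mono //.
Qed.

Lemma exit_thr_level q : exists2 c, (0 < c <= nthr N (exit_var q))%N & exit_thr q = thr N (exit_var q) c.
Proof.
have [hu|hu] := boolP (upward q).
  have [e1 e2] := upward_level hu; by exists (reg q (exit_var q)).+1; [rewrite /= -e1 reg_le|].
have [e1 e2] := downward_level hu; by exists (reg q (exit_var q)); [rewrite reg_le e1|].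
Qed.

Lemma cycle_wallE i : cycle_wall O i = wall (reg i) (reg i.+1).
Proof. by rewrite /cycle_wall /reg idx_succ idx_ord. Qed.

Lemma wall_idx q : wall (reg q) (reg q.+1) = cycle_wall O (idx q).
Proof. by rewrite /cycle_wall /reg idx_succ. Qed.

Lemma region_unique i j x : region (O i) x -> region (O j) x -> i = j.
Proof.
move=> h1 h2; case: attr => -[_ inj _] _; apply: inj; apply/ffunP => l.
apply: val_inj; exact: between_unique (reg_le _ _) (reg_le _ _) (h1 l) (h2 l).
Qed.

Lemma wall_not_region i j x : cycle_wall O i x -> region (O j) x -> False.
Proof.
rewrite cycle_wallE => /wallE[h _] hr; have [c hc e] := exit_thr_level i.
by apply: (between_not_thr (reg_le _ _) hc (hr (exit_var i))); rewrite h.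
Qed.

(** Two walls of the cycle with a common point separate the same two
    regions; if the cycle crossed them in opposite directions, the focal
    point of the same region would have to lie on both sides of the
    threshold. *)
Lemma wall_unique i j x : cycle_wall O i x -> cycle_wall O j x -> i = j.
Proof.
rewrite !cycle_wallE => hi hj.
have [hi1 hi2] := (wallE _ _).1 hi; have [hj1 hj2] := (wallE _ _).1 hj.
have [c hc e] := exit_thr_level i; have [c' hc' e'] := exit_thr_level j.
have em : exit_var i = exit_var j.
  apply: contrapT => /eqP ne.
  by apply: (between_not_thr (reg_le _ _) hc (hj2 _ ne)); rewrite hi1.
have et : exit_thr i = exit_thr j by rewrite -hi1 -hj1 em.
have same : upward i = upward j -> reg i = reg j.
  move=> eu; apply/ffunP => l; apply: val_inj => /=.
  have [->|ne] := eqVneq l (exit_var i); last first.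
    have h1 := hi2 l ne; rewrite em in ne; have h2 := hj2 l ne.
    exact: between_unique (reg_le _ _) (reg_le _ _) h1 h2.
  have [hu|hu] := boolP (upward i).
    have [a1 a2] := upward_level hu; have hu' : upward j by rewrite -eu.
    have [b1 b2] := upward_level hu'; rewrite -em in b1 b2.
    apply: succn_inj; apply: (@thr_inj _ _ N (exit_var i)); last by rewrite -a2 -b2.
      by rewrite /= -a1 reg_le.
    by rewrite /= -b1 reg_le.
  have [a1 a2] := downward_level hu; have hu' : ~~ upward j by rewrite -eu.
  have [b1 b2] := downward_level hu'; rewrite -em in b1 b2.
  apply: (@thr_inj _ _ N (exit_var i)); last by rewrite -a2 -b2.
    by rewrite reg_le a1.
  by rewrite reg_le b1.
have [eu|ne] := eqVneq (upward i) (upward j).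
  have := same eu; rewrite /reg !idx_ord => eO.
  by case: attr => -[_ inj _] _; apply: inj.
exfalso.
have opp : reg i = reg j.+1.
  apply/ffunP => l; apply: val_inj => /=.
  have [->|nl] := eqVneq l (exit_var i); last first.
    have h1 := hi2 l nl; rewrite em in nl; rewrite reg_same //.
    exact: between_unique (reg_le _ _) (reg_le _ _) h1 (hj2 l nl).
  have [hu|hu] := boolP (upward i).
    have [a1 a2] := upward_level hu; have hu' : ~~ upward j by move: ne; rewrite hu; case: (upward j).
    have [b1 b2] := downward_level hu'; rewrite -em in b1 b2.
    apply: succn_inj; rewrite -b1; apply: (@thr_inj _ _ N (exit_var i)); last by rewrite -a2 -b2.
      by rewrite /= -a1 reg_le.
    by rewrite reg_le b1.
  have [a1 a2] := downward_level hu; have hu' : upward j by move: ne; rewrite (negbTE hu); case: (upward j).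
  have [b1 b2] := upward_level hu'; rewrite -em in b1 b2.
  rewrite b1; apply: (@thr_inj _ _ N (exit_var i)); last by rewrite -a2 -b2.
    by rewrite reg_le a1.
  by rewrite /= -b1 reg_le.
have b1 := focus_beyond i; have b2 := next_focus_beyond j.
have ef : focus i = focus j.+1 by rewrite /focus opp.
rewrite -ef -em -et in b2; move: b1 b2 ne; rewrite /exit_sign.
by case: (upward i) (upward j) => -[] //; lra.
Qed.

(** Membership in a region or in its entry wall: the points whose forward
    motion is governed by [focus p]. *)
Definition at_pos (p : nat) (x : 'rV[R]_n) : Prop :=
  region (reg p) x \/ exists2 i, ordS i = idx p & cycle_wall O i x.

Lemma start_idx p p' x : idx p = idx p' -> start p x -> start p' x.
Proof.
move=> e; rewrite /start /exit_sign /upward /exit_thr /exit_var /reg !idx_succ e; done.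
Qed.

Lemma at_pos_start p x : at_pos p x -> start p x.
Proof.
case=> [/region_start//|[i e]]; rewrite cycle_wallE => /wall_start.
by apply: start_idx; rewrite idx_succ idx_ord.
Qed.

Lemma cycle_set_at_pos x : cycle_set O x -> exists2 p, (p <= k)%N & at_pos p x.
Proof.
case=> i _ [h|h].
  by exists i; [apply/ltnW/ltn_ord|left; rewrite /reg idx_ord].
by exists i.+1; [apply: ltn_ord|right; exists i => //; rewrite idx_succ idx_ord].
Qed.

Lemma at_pos_cycle_set p x : at_pos p x -> cycle_set O x.
Proof.
case=> [h|[i _ h]]; first by exists (idx p) => //; left.
by exists i => //; right.
Qed.

Lemma at_pos_unique p p' x : at_pos p x -> at_pos p' x -> idx p = idx p'.
Proof.
case=> [h|[i e h]] [h'|[i' e' h']].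
- exact: region_unique h h'.
- by case: (wall_not_region h' h).
- by case: (wall_not_region h h').
- by rewrite -e -e' (wall_unique h h').
Qed.

Lemma at_pos_per p x : at_pos (p + k) x <-> at_pos p x.
Proof. by rewrite /at_pos reg_per idx_per. Qed.

Lemma at_pos_wall q x : wall (reg q) (reg q.+1) x -> at_pos q.+1 x.
Proof. by move=> h; right; exists (idx q); rewrite ?idx_succ // -wall_idx. Qed.

Lemma vertex_at_pos p x q : start p x -> at_pos (p + q.+1) (vertex p x q.+1).
Proof. by move=> hs; rewrite addnS; apply/at_pos_wall/hit_wall/vertex_start. Qed.

Definition duration (p : nat) (x : 'rV[R]_n) : R := ln (1 + exit_weight p x).

Lemma duration_gt0 p x : start p x -> 0 < duration p x.
Proof. by move=> /exit_weight_gt0 h; rewrite /duration ln_gt0 //; lra. Qed.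

Lemma expR_duration p x : start p x -> expR (- duration p x) = (1 + exit_weight p x)^-1.
Proof. by move=> /exit_weight_gt0 h; rewrite expRN lnK // posrE; lra. Qed.

Lemma flow_towards p x t : region_flow (focus p) x t = towards p x (expR (- t)).
Proof. by []. Qed.

Lemma flow_region p x t : start p x -> 0 < t < duration p x ->
  region (reg p) (region_flow (focus p) x t).
Proof.
move=> hs /andP[t0 td]; rewrite flow_towards; apply: towards_region => //.
by rewrite -expR_duration // ltr_expR ltrN2 td expR_lt1 oppr_lt0.
Qed.

Lemma flow_duration p x : start p x -> region_flow (focus p) x (duration p x) = hit p x.
Proof. by move=> hs; rewrite flow_towards expR_duration. Qed.

Lemma flow0 f (x : 'rV[R]_n) : region_flow f x 0 = x.
Proof. by rewrite /region_flow oppr0 expR0 scale1r addrC subrK. Qed.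

(** * Trajectories follow the flows of the regions *)

Definition dom (T : \bar R) (t : R) : Prop := 0 <= t /\ (t%:E < T)%E.

Lemma dom_le T s t : dom T t -> 0 <= s <= t -> dom T s.
Proof. by move=> [_ h] /andP[s0 st]; split => //; apply: le_lt_trans h; rewrite lee_fin. Qed.

Lemma within_eps (T : \bar R) (y : R -> 'rV[R]_n) t0 (e : R) :
  {within [set t : R | dom T t], continuous y} -> dom T t0 -> 0 < e ->
  exists2 d : R, 0 < d & forall t, dom T t -> `|t0 - t| < d ->
    forall l, `|y t0 0 l - y t 0 l| < e.
Proof.
move=> /subspace_continuousP/(_ t0) hc d0 e0; have /cvg_ballP/(_ e e0) := hc d0.
rewrite near_withinE => /nbhs_ballP[d /= dpos hd].
exists d => // t dt ht l; have := hd t ht dt; by move/rV_ballP => [_]; apply.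
Qed.

Lemma traj_eps (T : \bar R) (y : R -> 'rV[R]_n) t0 (e : R) : trajectory O T y -> dom T t0 -> 0 < e ->
  exists2 d : R, 0 < d & forall t, dom T t -> `|t0 - t| < d ->
    forall l, `|y t0 0 l - y t 0 l| < e.
Proof. by case=> _ hc _ _ _; apply: within_eps. Qed.

Lemma traj_coord_within (T : \bar R) (y : R -> 'rV[R]_n) l a b :
  trajectory O T y -> 0 <= a -> dom T b -> {within `[a, b], continuous (fun s => y s 0 l)}.
Proof.
move=> tr a0 db; apply/subspace_continuousP => s; rewrite /= in_itv /= => /andP[as_ sb].
have ds : dom T s by apply: dom_le db _; rewrite sb andbT (le_trans a0).
apply/cvgrPdist_lt => e e0; rewrite near_withinE; apply/nbhs_ballP.
have [d d0 hd] := traj_eps tr ds e0; exists d => //= t ht; rewrite /= in_itv /= => /andP[at_ tb].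
by apply: hd => //; apply: dom_le db _; rewrite tb andbT (le_trans a0).
Qed.

(** Uniqueness for y' = - y + f: e^t (y - f) is constant. *)
Lemma flow_solution (T : \bar R) (y : R -> 'rV[R]_n) p a t :
  trajectory O T y -> 0 <= a <= t -> dom T t ->
  (forall s, a < s < t -> region (reg p) (y s)) ->
  y t = region_flow (focus p) (y a) (t - a).
Proof.
move=> tr /andP[a0 at_] dt hr; apply/rowP => l.
pose f := focus p 0 l; pose g s := expR s * (y s 0 l - f).
have [_ _ _ der _] := tr.
have hder s : s \in `]a, t[ -> is_derive s 1 g 0.
  rewrite in_itv /= => /andP[h1 h2].
  have s0 : 0 < s by apply: le_lt_trans h1.
  have ds : (s%:E < T)%E by apply: lt_trans dt.2; rewrite lte_fin.
  have h3 : is_derive s 1 (fun s => y s 0 l) (- y s 0 l + f).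
    by apply: der => //; apply: hr; rewrite h1.
  have h4 : is_derive s 1 (fun s => y s 0 l - f) (- y s 0 l + f).
    by have := is_deriveB h3 (is_derive_cst f s 1); rewrite subr0.
  have e : 0 = expR s *: (- y s 0 l + f) + (y s 0 l - f) *: expR s.
    by rewrite /GRing.scale /=; ring.
  rewrite e; exact: (is_deriveM (is_derive_expR s) h4).
have hcont : {within `[a, t], continuous g}.
  apply/subspace_continuousP => s hs; apply: cvgM.
    exact: (cvg_within_filter _ (@continuous_expR R s)).
  apply: cvgB; last exact: cvg_cst.
  by have /subspace_continuousP := @traj_coord_within T y l a t tr a0 dt; apply.
have [c _ hc] := MVT_segment at_ hder hcont.
have hg : g t = g a by apply/eqP; rewrite -subr_eq0 hc mul0r.
rewrite /region_flow !mxE -/f.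
have -> : expR (- (t - a)) * (y a 0 l - f) = expR (- t) * g a.
  by rewrite /g mulrA -expRD opprB addrC.
rewrite -hg /g mulrA -expRD addNr expR0; ring.
Qed.

(** On a wall this uses the right derivative: the vector field of the next
    region points strictly into that region. *)
Lemma enters_after (T : \bar R) (y : R -> 'rV[R]_n) p a : trajectory O T y -> dom T a ->
  at_pos p (y a) ->
  exists2 d : R, 0 < d & forall t, dom T t -> a < t < a + d -> region (reg p) (y t).
Proof.
move=> tr da; case=> [h|[i ei hi]].
  have [e e0 he] := region_open h; have [d d0 hd] := traj_eps tr da e0.
  exists d => // t dt ht; apply: he; apply: hd => //.
  by rewrite ltr_norml; lra.
have hi' := hi; rewrite cycle_wallE in hi'.
have erp : reg i.+1 = reg p by rewrite /reg idx_succ idx_ord ei.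
have [e e0 he] := wall_local hi'; have [d d0 hd] := traj_eps tr da e0.
have [_ _ _ _ /(_ a i (exit_var i) da.1 da.2 hi) hder] := tr.
have [hx _] := (wallE _ _).1 hi'.
have [d' d'0 hd'] : exists2 d : R, 0 < d & forall h : R, 0 < h < d ->
    0 < exit_sign i * (y (a + h) 0 (exit_var i) - exit_thr i).
  have v0 : 0 < exit_sign i * (- y a 0 (exit_var i) + focal (O (ordS i)) 0 (exit_var i)).
    by have := next_focus_beyond i; rewrite /focus /reg idx_succ idx_ord hx; lra.
  have hc : (fun h => exit_sign i * (h^-1 * (y (a + h) 0 (exit_var i) - y a 0 (exit_var i)))) @ 0^'+ -->
      exit_sign i * (- y a 0 (exit_var i) + focal (O (ordS i)) 0 (exit_var i)).
    by apply: cvgM; [exact: cvg_cst|exact: hder].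
  have hn : \forall h \near (0 : R)^'+, 0 < exit_sign i * (h^-1 * (y (a + h) 0 (exit_var i) - y a 0 (exit_var i))).
    exact: cvgr_gt v0.
  have := hn; rewrite near_withinE.
  move=> /nbhs_ballP[d1 /= d10 hd1].
  exists d1 => // h /andP[h0 hd2].
  have := hd1 h; rewrite /ball /= sub0r normrN (gtr0_norm h0) => /(_ hd2 h0).
  rewrite hx => hh; have -> : exit_sign i * (y (a + h) 0 (exit_var i) - exit_thr i) =
     h * (exit_sign i * (h^-1 * (y (a + h) 0 (exit_var i) - exit_thr i))).
    by field; rewrite gt_eqF.
  by rewrite mulr_gt0.
exists (Num.min d d'); first by rewrite lt_min d0.
move=> t dt /andP[t1 t2]; have t3 : t - a < Num.min d d' by lra.
move: t3; rewrite lt_min => /andP[t3 t4].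
have [|g1 _ _] := he (y t); first by apply: hd => //; rewrite ltr_norml; lra.
rewrite -erp; apply: g1.
have e1 : a + (t - a) = t by lra.
have := hd' (t - a); rewrite e1; apply; rewrite t4 andbT; lra.
Qed.

(** A first time of leaving the region before the predicted one is
    impossible: up to then the trajectory is the flow, which is still in the
    region. *)
Lemma follow_region (T : \bar R) (y : R -> 'rV[R]_n) p a : trajectory O T y -> dom T a ->
  at_pos p (y a) ->
  forall t, dom T t -> a < t < a + duration p (y a) -> region (reg p) (y t).
Proof.
move=> tr da hp t0 dt0 ht0; apply: contrapT => bad0.
have hs := at_pos_start hp.
pose B := [set t | [/\ a < t < a + duration p (y a), dom T t & ~ region (reg p) (y t)]].
have B0 : B !=set0 by exists t0.
have [d d0 hd] := enters_after tr da hp.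
have lbB : lbound B (a + d).
  move=> t [/andP[t1 t2] t3 t4]; rewrite leNgt; apply/negP => t5.
  by apply: t4; apply: hd; rewrite // t1.
have hB : has_lbound B by exists (a + d).
pose c := inf B.
have c1 : a + d <= c by apply: lb_le_inf.
have c2 : c <= t0 by apply: ge_inf.
have dc : dom T c by apply: dom_le dt0 _; rewrite c2 andbT; case: da; lra.
have before s : a < s < c -> region (reg p) (y s).
  move=> /andP[s1 s2]; apply: contrapT => bad.
  have : c <= s; last by lra.
  apply: ge_inf => //; split => //; first by rewrite s1; case/andP: ht0; lra.
  by apply: dom_le dc _; case: da; lra.
have yc : y c = region_flow (focus p) (y a) (c - a).
  by apply: flow_solution tr _ dc before; case: da; lra.
have rc : region (reg p) (y c).
  by rewrite yc; apply: flow_region => //; case/andP: ht0; lra.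
have [d' d'0 hd'] := enters_after tr dc (or_introl rc).
have : c + d' <= c; last by lra.
rewrite {2}/c; apply: lb_le_inf => // t hBt.
have t5 : c <= t by apply: ge_inf.
case: hBt => t1 t2 t3; rewrite leNgt; apply/negP => t4; apply: t3.
move: t5; rewrite le_eqVlt => /predU1P[<-//|t5].
by apply: hd' => //; rewrite t5.
Qed.

Lemma follow (T : \bar R) (y : R -> 'rV[R]_n) p a : trajectory O T y -> dom T a ->
  at_pos p (y a) ->
  forall t, dom T t -> a <= t <= a + duration p (y a) -> y t = region_flow (focus p) (y a) (t - a).
Proof.
move=> tr da hp t dt /andP[t1 t2]; apply: (flow_solution tr) => //.
  by rewrite t1 andbT; case: da.
move=> s /andP[s1 s2]; apply: (follow_region tr da hp); last by rewrite s1; lra.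
by apply: dom_le dt _; case: da; lra.
Qed.

Fixpoint hit_time (p : nat) (x : 'rV[R]_n) (q : nat) : R :=
  if q is q'.+1 then hit_time p x q' + duration (p + q') (vertex p x q') else 0.

Arguments hit_time : simpl never.

Lemma hit_timeS p x q : hit_time p x q.+1 = hit_time p x q + duration (p + q) (vertex p x q).
Proof. by []. Qed.

Lemma hit_time_lt p x q : start p x -> hit_time p x q < hit_time p x q.+1.
Proof. by move=> hs; rewrite hit_timeS ltrDl; apply/duration_gt0/vertex_start. Qed.

Lemma hit_time_mono p x q q' : start p x -> (q <= q')%N -> hit_time p x q <= hit_time p x q'.
Proof.
move=> hs /subnKC <-; elim: (q' - q)%N => [|d IH]; first by rewrite addn0.
by rewrite addnS; apply: le_trans IH _; apply/ltW/hit_time_lt.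
Qed.

Lemma hit_time_ge0 p x q : start p x -> 0 <= hit_time p x q.
Proof. by move=> hs; apply: (hit_time_mono (q := 0) hs). Qed.

Lemma hit_time_add p x q r : hit_time p x (q + r) = hit_time p x q + hit_time (p + q) (vertex p x q) r.
Proof.
elim: r => [|r IH]; first by rewrite addn0 addr0.
by rewrite addnS !hit_timeS IH -addrA vertex_add addnA.
Qed.

Lemma duration_per p x : duration (p + k) x = duration p x.
Proof. by rewrite /duration /exit_weight /step_weight !exit_var_per !exit_thr_per !focus_per. Qed.

Lemma hit_time_per p x q : hit_time (p + k) x q = hit_time p x q.
Proof. by elim: q => [//|q IH]; rewrite !hit_timeS IH vertex_per addnAC duration_per. Qed.

Lemma follow_vertex (T : \bar R) (y : R -> 'rV[R]_n) p : trajectory O T y -> at_pos p (y 0) ->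
  forall q, dom T (hit_time p (y 0) q) ->
    y (hit_time p (y 0) q) = vertex p (y 0) q /\ at_pos (p + q) (vertex p (y 0) q).
Proof.
move=> tr hp; have hs := at_pos_start hp; elim=> [|q IH] hd; first by rewrite addn0.
have hq : dom T (hit_time p (y 0) q).
  by apply: dom_le hd _; rewrite hit_time_ge0 // hit_time_mono.
have [e1 e2] := IH hq; split; last exact: vertex_at_pos.
have h := follow tr hq; rewrite e1 in h.
rewrite (h _ e2 _ hd); last by rewrite hit_timeS lexx andbT lerDl; apply/ltW/duration_gt0/vertex_start.
rewrite hit_timeS addrC addKr flow_duration //; exact: vertex_start.
Qed.

Lemma follow_flow (T : \bar R) (y : R -> 'rV[R]_n) p q t : trajectory O T y ->
  at_pos p (y 0) -> dom T t -> hit_time p (y 0) q <= t <= hit_time p (y 0) q.+1 ->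
  y t = region_flow (focus (p + q)) (vertex p (y 0) q) (t - hit_time p (y 0) q).
Proof.
move=> tr hp dt /andP[t1 t2]; have hs := at_pos_start hp.
have hq : dom T (hit_time p (y 0) q) by apply: dom_le dt _; rewrite hit_time_ge0.
have [e1 e2] := follow_vertex tr hp hq.
rewrite -e1; apply: (follow tr hq) => //; first by rewrite e1.
by rewrite t1 e1.
Qed.

Lemma exit_distinct (i : 'I_k) : i != ordS i.
Proof.
apply/eqP => e; have [h _] := adj i.
have : reg i = reg i.+1 by rewrite /reg idx_succ idx_ord -e.
by move=> e'; move: h; rewrite -e'; lia.
Qed.

Lemma closure_wall i x (e : R) : closure (cycle_wall O i) x -> 0 < e ->
  exists2 z : 'rV[R]_n, cycle_wall O i z & forall l, `|x 0 l - z 0 l| < e.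
Proof.
move=> h e0; have [z [hz hb]] := h _ (nbhsx_ballx x e e0).
by exists z => //; move/rV_ballP: hb => [].
Qed.

(** Near a point of a region there is no point of any wall, and near a point
    of a wall there is none of the next wall; but a point of the spine is
    close to all walls. *)
Lemma spine_disjoint x : spine O x -> cycle_set O x -> False.
Proof.
move=> hsp [i _ [h|h]].
  have [e e0 he] := region_open h.
  have [z hz1 hz2] := closure_wall (hsp i I) e0.
  exact: wall_not_region hz1 (he z hz2).
have h' := h; rewrite cycle_wallE in h'.
have [e e0 he] := wall_local h'.
have [z hz1 hz2] := closure_wall (hsp (ordS i) I) e0.
have [g1 g2 g3] := he z hz2.
have [lt|lt|eq] := ltgtP (exit_sign i * (z 0 (exit_var i) - exit_thr i)) 0.
- by apply: (wall_not_region hz1); apply: (g2 lt).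
- by apply: (wall_not_region hz1); apply: (g1 lt).
- have e1 : z 0 (exit_var i) = exit_thr i.
    by move/eqP: eq; rewrite mulf_eq0 (negbTE (exit_sign_neq0 i)) subr_eq0 => /eqP.
  have := g3 e1; rewrite -cycle_wallE => /(wall_unique hz1) /eqP.
  by rewrite eq_sym (negbTE (exit_distinct i)).
Qed.

(** Infinitely many crossings accumulate in finite time only at a point of
    the closure of every wall, and such a point does not belong to the
    cycle. *)
Lemma reach (T : \bar R) (y : R -> 'rV[R]_n) p : trajectory O T y -> at_pos p (y 0) ->
  forall t, dom T t -> exists q, hit_time p (y 0) q <= t < hit_time p (y 0) q.+1.
Proof.
move=> tr hp t dt; have hs := at_pos_start hp; apply: contrapT => hno.
set x := y 0 in hp hs hno *.
have ub q : hit_time p x q <= t.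
  elim: q => [|q IH]; first by case: dt.
  by rewrite leNgt; apply/negP => h; apply: hno; exists q; rewrite IH.
pose A := [set hit_time p x q | q in [set: nat]].
have A0 : A !=set0 by exists (hit_time p x 0), 0%N.
have uA : has_ubound A by exists t => _ [q _ <-].
pose c := sup A.
have hc q : hit_time p x q <= c by apply: ub_le_sup => //; exists q.
have ct : c <= t by apply: ge_sup => // _ [q _ <-].
have dc : dom T c by apply: dom_le dt _; rewrite ct (le_trans _ (hc 0%N)).
have [_ _ hcyc _ _] := tr.
apply: (@spine_disjoint (y c)); last by apply: hcyc; case: dc.
move=> i _ U /nbhs_ballP[e /= e0 hU].
have [d d0 hd] := traj_eps tr dc e0.
have [_ [Q _ <-] hQ] := sup_adherent d0 (conj A0 uA).
(* a late crossing of the wall i *)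
pose q := (i + k * (Q + p).+1 - p)%N.
have le1 : (Q + p <= k * (Q + p))%N by rewrite leq_pmull.
have le2 : ((Q + p).+1 <= k * (Q + p).+1)%N by rewrite leq_pmull.
have hq : (p + q = i + k * (Q + p).+1)%N by rewrite /q; lia.
have Qq : (Q <= q)%N by rewrite /q; lia.
have dq : dom T (hit_time p x q.+1) by apply: dom_le dc _; rewrite hit_time_ge0 // hc.
have [e1 e2] := follow_vertex tr hp dq.
exists (y (hit_time p x q.+1)); split.
  rewrite e1 -(idx_ord i).
  have <- : idx (p + q) = idx i by apply: val_inj; rewrite /= hq addnC mulnC modnMDl.
  by rewrite -wall_idx; apply/hit_wall/vertex_start.
apply: hU; apply/rV_ballP; split => // l; apply: hd => //.
have : hit_time p x Q <= hit_time p x q.+1 by apply: hit_time_mono => //; apply: leqW.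
by move=> h; have := hc q.+1; rewrite -/c in hQ; rewrite ltr_norml; lra.
Qed.

(** * The trajectory from a given point *)

Definition piece (p : nat) (x : 'rV[R]_n) (t : R) : nat :=
  if pselect (exists q, t < hit_time p x q.+1) is left h then ex_minn h else 0%N.

(** The trajectory assembled from the flows of successive regions. It is
    extended to negative times by the flow of the first region, so that it
    is continuous at 0 from both sides. *)
Definition solution (p : nat) (x : 'rV[R]_n) (t : R) : 'rV[R]_n :=
  let q := piece p x t in
  region_flow (focus (p + q)) (vertex p x q) (t - hit_time p x q).

(** At a hitting time both adjacent pieces give the same value. *)
Lemma solution_piece p x q t : start p x -> (q = 0%N \/ hit_time p x q <= t) ->
  t <= hit_time p x q.+1 ->
  solution p x t = region_flow (focus (p + q)) (vertex p x q) (t - hit_time p x q).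
Proof.
move=> hs hq; have lt_case q0 : (q0 = 0%N \/ hit_time p x q0 <= t) -> t < hit_time p x q0.+1 ->
    piece p x t = q0.
  move=> h0 h1; rewrite /piece; case: pselect => [h|[]]; last by exists q0.
  case: ex_minnP => m hm hmin; apply/eqP; rewrite eqn_leq hmin //=.
  case: h0 => [->//|h0]; rewrite leqNgt; apply/negP => mq.
  by have := lt_le_trans hm (hit_time_mono hs mq); rewrite ltNge h0.
rewrite le_eqVlt => /predU1P[e|lt]; last by rewrite /solution (lt_case q).
have hs' := vertex_start q hs.
rewrite /solution (lt_case q.+1); last by rewrite e hit_time_lt.
  rewrite e subrr flow0 [hit_time _ _ q.+1]/= addrC addKr flow_duration //.
by right; rewrite e.
Qed.

Lemma solution_vertex p x q : start p x -> solution p x (hit_time p x q) = vertex p x q.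
Proof.
move=> hs; rewrite (solution_piece (q := q) hs).
- by rewrite subrr flow0.
- by right.
- by apply/ltW/hit_time_lt.
Qed.

Lemma piece_exists p x t : start p x -> 0 <= t -> (exists q, t < hit_time p x q) ->
  exists2 q, hit_time p x q <= t & t < hit_time p x q.+1.
Proof.
move=> hs t0 [Q hQ]; elim: Q hQ => [|Q IH] hQ; first by move: hQ; rewrite ltNge t0.
have [h|h] := ltP t (hit_time p x Q); first exact: IH.
by exists Q.
Qed.

Lemma flow_coord f (x : 'rV[R]_n) (c : R) l (s : R) :
  region_flow f x (s - c) 0 l = f 0 l + expR (c - s) * (x 0 l - f 0 l).
Proof. by rewrite /region_flow !mxE opprB. Qed.

Lemma flow_derive f (x : 'rV[R]_n) (c : R) l (s : R) :
  is_derive s 1 (fun s => region_flow f x (s - c) 0 l)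
    (- region_flow f x (s - c) 0 l + f 0 l).
Proof.
rewrite (_ : (fun s => _) = (fun s => f 0 l + expR (c - s) * (x 0 l - f 0 l))); last first.
  by apply/funext => u; rewrite flow_coord.
rewrite flow_coord.
have h1 : is_derive s 1 (fun s => c - s) (-1).
  by have := is_deriveB (is_derive_cst c s 1) (is_derive_id s 1); rewrite sub0r.
have h2 : is_derive s 1 (fun s => expR (c - s)) (expR (c - s) * -1).
  have := @is_derive1_comp R expR (fun u => c - u) s _ _ (is_derive_expR (c - s)) h1.
  exact: id.
have h3 := is_deriveM h2 (is_derive_cst (x 0 l - f 0 l) s 1).
have h4 := is_deriveD (is_derive_cst (f 0 l) s 1) h3.
have e : - (f 0 l + expR (c - s) * (x 0 l - f 0 l)) + f 0 l =
  0 + (expR (c - s) *: 0 + (x 0 l - f 0 l) *: (expR (c - s) * -1)).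
  by rewrite /GRing.scale /=; ring.
by rewrite e; exact: h4.
Qed.

Lemma flow_cvg f (x : 'rV[R]_n) (c s : R) :
  (fun s => region_flow f x (s - c)) @ s --> region_flow f x (s - c).
Proof.
apply: rV_cvg => l; have [hd _] := flow_derive f x c l s.
by have /derivable1_diffP/differentiable_continuous := hd.
Qed.

Lemma solution_cvg p x t : start p x -> (exists2 q, (q = 0%N \/ hit_time p x q <= t) & t < hit_time p x q.+1) ->
  solution p x @ t --> solution p x t.
Proof.
move=> hs [q h1 h2]; apply/cvg_ballP => e e0.
have E := solution_piece hs h1 (ltW h2).
have /cvg_ballP/(_ e e0) c1 := @flow_cvg (focus (p + q)) (vertex p x q) (hit_time p x q) t.
have r0 : 0 < hit_time p x q.+1 - t by rewrite subr_gt0.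
have right_near : \forall s \near t, s < hit_time p x q.+1.
  by apply/nbhs_ballP; exists (hit_time p x q.+1 - t) => //= s; rewrite /ball /= ltr_norml; lra.
have [h3|[h3 e3]] : (q = 0%N \/ hit_time p x q < t) \/ ((0 < q)%N /\ hit_time p x q = t).
  case: h1 => [->|]; first by left; left.
  rewrite le_eqVlt => /predU1P[h1|h1]; last by left; right.
  by case: (posnP q) => [->|q0]; [left; left|right].
- have left_near : \forall s \near t, q = 0%N \/ hit_time p x q <= s.
    case: h3 => [->|h3]; first by near=> s; left.
    apply/nbhs_ballP; exists (t - hit_time p x q); rewrite /= ?subr_gt0 // => s.
    by rewrite /ball /= ltr_norml => hh; right; lra.
  near=> s; rewrite E (@solution_piece p x q s) //; last by apply/ltW; near: s.
    by near: s.
  by near: s.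
- case: q h3 e3 h1 h2 E c1 r0 right_near => // q _ e3 _ h2 E c1 r0 right_near.
  have E' : solution p x t = region_flow (focus (p + q)) (vertex p x q) (t - hit_time p x q).
    by apply: solution_piece => //; rewrite -e3 //; right; apply/ltW/hit_time_lt.
  have /cvg_ballP/(_ e e0) c2 := @flow_cvg (focus (p + q)) (vertex p x q) (hit_time p x q) t.
  have left_near : \forall s \near t, hit_time p x q < s.
    have : 0 < t - hit_time p x q by rewrite -e3 subr_gt0 hit_time_lt.
    move=> d0; apply/nbhs_ballP; exists (t - hit_time p x q) => //= s.
    by rewrite /ball /= ltr_norml; lra.
  near=> s; have [st|ts] := leP s t.
    rewrite E' (@solution_piece p x q s) //; last by rewrite e3.
      by near: s.
    by right; apply/ltW; near: s.
  rewrite E (@solution_piece p x q.+1 s) //; last by apply/ltW; near: s.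
    by near: s.
  by right; rewrite e3 ltW.
Unshelve. all: by end_near. Qed.

Lemma solution_at_pos p x q t : at_pos p x -> hit_time p x q <= t < hit_time p x q.+1 -> at_pos (p + q) (solution p x t).
Proof.
move=> hp /andP[h1 h2]; have hs := at_pos_start hp.
have hv : at_pos (p + q) (vertex p x q).
  by case: q {h1 h2} => [|q]; [rewrite addn0|apply: vertex_at_pos].
move: h1; rewrite le_eqVlt => /predU1P[<-|h1]; first by rewrite solution_vertex.
left; rewrite (@solution_piece p x q t) //; last exact: ltW.
  by apply: flow_region; [exact: vertex_start|rewrite subr_gt0 h1 ltrBlDl].
by right; apply: ltW.
Qed.

Lemma solution_trajectory p x (T : \bar R) : at_pos p x -> (0 < T)%E ->
  (forall t : R, (t%:E < T)%E -> exists q, t < hit_time p x q) ->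
  trajectory O T (solution p x).
Proof.
move=> hp T0 hT; have hs := at_pos_start hp.
have loc t : dom T t -> exists2 q, hit_time p x q <= t & t < hit_time p x q.+1.
  by case=> t0 tT; apply: piece_exists => //; apply: hT.
split => //.
- apply/subspace_continuousP => t dt; apply: cvg_within_filter; apply: solution_cvg => //.
  by have [q h1 h2] := loc t dt; exists q => //; right.
- move=> t t0 tT; have [q h1 h2] := loc t (conj t0 tT).
  by apply: (@at_pos_cycle_set (p + q)); apply: solution_at_pos; rewrite // h1.
- move=> t i m t0 tT hr; have [q h1 h2] := loc t (conj (ltW t0) tT).
  have h3 : hit_time p x q < t.
    rewrite lt_neqAle h1 andbT; apply/eqP => e.
    case: q h1 h2 e => [|q] h1 h2 e; first by move: t0; rewrite -e ltxx.
    rewrite -e solution_vertex // in hr; apply: (@wall_not_region (idx (p + q)) _ _ _ hr).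
    by rewrite -wall_idx; apply/hit_wall/vertex_start.
  have ei : i = idx (p + q).
    apply: region_unique hr _; rewrite (@solution_piece p x q t) //; [|by right|exact: ltW].
    by apply: flow_region; [exact: vertex_start|rewrite subr_gt0 h3 ltrBlDl].
  have -> : solution p x t = region_flow (focus (p + q)) (vertex p x q) (t - hit_time p x q).
    by apply: solution_piece; [|right|apply: ltW].
  have -> : focal (O i) = focus (p + q) by rewrite ei.
  apply: near_eq_is_derive (flow_derive _ _ _ _ _).
  have d0 : 0 < Num.min (t - hit_time p x q) (hit_time p x q.+1 - t) by rewrite lt_min !subr_gt0 h3.
  apply/nbhs_ballP; exists (Num.min (t - hit_time p x q) (hit_time p x q.+1 - t)) => //= s.
  rewrite /ball /= lt_min !ltr_norml => /andP[/andP[g1 g2] /andP[g3 g4]].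
  rewrite (@solution_piece p x q s) //; last by lra.
  by right; lra.
- move=> t i m t0 tT hw; have [q h1 h2] := loc t (conj t0 tT).
  have ha : at_pos (p + q) (solution p x t) by apply: solution_at_pos; rewrite // h1.
  have ei : ordS i = idx (p + q).
    case: ha => [h|[j <- h]]; first by case: (wall_not_region hw h).
    by rewrite (wall_unique hw h).
  have E : solution p x t = region_flow (focus (p + q)) (vertex p x q) (t - hit_time p x q).
    by apply: solution_piece; [|right|apply: ltW].
  have -> : focal (O (ordS i)) = focus (p + q) by rewrite ei.
  have [hd hv] := flow_derive (focus (p + q)) (vertex p x q) (hit_time p x q) m t.
  rewrite E -hv; set fl := fun s : R => _ in hd hv *.
  have hc : (fun h => h^-1 *: ((fl \o shift t) (h *: 1) - fl t)) @ 0^'+ --> 'D_1 fl t.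
    by apply: cvg_dnbhs_at_right.
  apply: cvg_trans hc; apply: near_eq_cvg.
  rewrite near_withinE; apply/nbhs_ballP; exists (hit_time p x q.+1 - t); rewrite /= ?subr_gt0 // => h.
  rewrite /ball /= sub0r normrN => hb h0; rewrite (gtr0_norm h0) in hb.
  rewrite (@solution_piece p x q (t + h)) //; first last.
  + by lra.
  + by right; lra.
  by rewrite /fl /= [h *: 1]mulr1 [h + t]addrC.
Qed.

(** * Trajectories as polygonal lines *)

Definition seg (x y : 'rV[R]_n) (s : R) : 'rV[R]_n := x + s *: (y - x).

Lemma seg_near (x y x' y' : 'rV[R]_n) (s e : R) l : 0 <= s <= 1 ->
  `|x 0 l - x' 0 l| < e -> `|y 0 l - y' 0 l| < e ->
  `|seg x y s 0 l - seg x' y' s 0 l| < e.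
Proof.
move=> /andP[s0 s1] h1 h2.
have -> : seg x y s 0 l - seg x' y' s 0 l = (1 - s) * (x 0 l - x' 0 l) + s * (y 0 l - y' 0 l).
  by rewrite /seg !mxE; ring.
move: h1 h2; rewrite !ltr_norml => /andP[a1 a2] /andP[b1 b2].
have s1' : 0 <= 1 - s by lra.
have c1 := ler_wpM2l s0 (ltW b1); have c2 := ler_wpM2l s0 (ltW b2).
have c3 := ler_wpM2l s1' (ltW a1); have c4 := ler_wpM2l s1' (ltW a2).
have [s_eq|s_lt] := eqVneq s 0; first by rewrite s_eq; apply/andP; split; lra.
have s_pos : 0 < s by rewrite lt_neqAle eq_sym s_lt.
by apply/andP; split; nra.
Qed.

Lemma flow_seg p x t : start p x -> 0 <= t <= duration p x ->
  exists2 s : R, 0 <= s <= 1 & region_flow (focus p) x t = seg x (hit p x) s.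
Proof.
move=> hs /andP[t0 td]; set rho := expR (- t).
have r1 : rho <= 1 by rewrite /rho expR_le1 oppr_le0.
have hr : (1 + exit_weight p x)^-1 <= rho by rewrite -expR_duration // ler_expR lerN2.
have w0 := exit_weight_gt0 hs; have w1 : (1 + exit_weight p x)^-1 < 1 by rewrite invf_lt1; lra.
have d0 : 0 < 1 - (1 + exit_weight p x)^-1 by lra.
exists ((1 - rho) / (1 - (1 + exit_weight p x)^-1)).
  by rewrite divr_ge0 ?(ltW d0) ?subr_ge0 //= ler_pdivrMr // mul1r lerD2l lerN2.
rewrite flow_towards -/rho /seg /hit; apply/rowP => l; rewrite /towards !mxE.
by set q := (1 + _)^-1 in d0 *; field; rewrite gt_eqF.
Qed.

Lemma seg_flow p x s : start p x -> 0 <= s <= 1 ->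
  exists2 t : R, 0 <= t <= duration p x & region_flow (focus p) x t = seg x (hit p x) s.
Proof.
move=> hs /andP[s0 s1]; have w0 := exit_weight_gt0 hs.
set q := (1 + exit_weight p x)^-1; have w1 : q < 1 by rewrite invf_lt1; lra.
have q0 : 0 < q by rewrite invr_gt0; lra.
pose rho := 1 - s * (1 - q).
have hq : s * (1 - q) <= 1 - q by rewrite ger_pMl // subr_gt0.
have hq0 : 0 <= s * (1 - q) by rewrite mulr_ge0 // subr_ge0 ltW.
have r0 : q <= rho by rewrite /rho; lra.
have r1 : rho <= 1 by rewrite /rho; lra.
have rp : 0 < rho by lra.
exists (- ln rho).
  rewrite oppr_ge0 ln_le0 //= /duration lerNl -lnV ?posrE; last lra.
  by rewrite ler_ln ?posrE.
rewrite flow_towards opprK lnK ?posrE // /seg /hit -/q.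
by apply/rowP => l; rewrite /towards !mxE /rho; ring.
Qed.

Lemma traj_solution (T : \bar R) (y : R -> 'rV[R]_n) p t : trajectory O T y -> at_pos p (y 0) ->
  dom T t -> y t = solution p (y 0) t.
Proof.
move=> tr hp dt; have hs := at_pos_start hp; have [q /andP[h1 h2]] := reach tr hp dt.
have h3 : hit_time p (y 0) q <= t <= hit_time p (y 0) q.+1 by rewrite h1 ltW.
by rewrite (follow_flow tr hp dt h3) (@solution_piece p _ q) //; [right|apply: ltW].
Qed.

(** A trajectory that stops before its next crossing can be extended up to
    that crossing by [solution]. *)
Lemma maximal_reaches (T : \bar R) (y : R -> 'rV[R]_n) p q : maximal_trajectory O T y ->
  at_pos p (y 0) -> ((hit_time p (y 0) q)%:E < T)%E.
Proof.
move=> [tr hmax] hp; have hs := at_pos_start hp; rewrite ltNge; apply/negP => hT.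
have lt := hit_time_lt q hs.
have : ((hit_time p (y 0) q.+1)%:E <= T)%E.
  apply: (hmax _ (solution p (y 0))).
    apply: solution_trajectory => //.
      by rewrite lte_fin; apply: le_lt_trans lt; apply: hit_time_ge0.
    by move=> t; rewrite lte_fin => h; exists q.+1.
  by move=> t t0 tT; rewrite -(traj_solution tr hp (conj t0 tT)).
by move=> /le_trans/(_ hT); rewrite lee_fin leNgt lt.
Qed.

(** The solutions of y' = f - y run along straight lines. *)
Lemma on_segment (T : \bar R) (y : R -> 'rV[R]_n) p t : trajectory O T y -> at_pos p (y 0) ->
  dom T t -> exists q s, [/\ hit_time p (y 0) q <= t < hit_time p (y 0) q.+1, 0 <= s <= 1 &
    y t = seg (vertex p (y 0) q) (vertex p (y 0) q.+1) s].
Proof.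
move=> tr hp dt; have [q hq] := reach tr hp dt; have /andP[h1 h2] := hq.
have h3 : hit_time p (y 0) q <= t <= hit_time p (y 0) q.+1 by rewrite h1 ltW.
have hs := vertex_start q (at_pos_start hp).
have [|s hs1 e] := @flow_seg (p + q) (vertex p (y 0) q) (t - hit_time p (y 0) q) hs.
  by rewrite subr_ge0 h1 lerBlDl ltW.
by exists q, s; split => //; rewrite (follow_flow tr hp dt h3) e.
Qed.

Lemma late_piece p x q Q t : start p x -> hit_time p x Q <= t -> t < hit_time p x q.+1 -> (Q <= q)%N.
Proof.
move=> hs h1 h2; rewrite leqNgt; apply/negP => h3.
by have := lt_le_trans h2 (hit_time_mono hs h3); rewrite ltNge h1.
Qed.

Lemma hit_idx p p' x : idx p = idx p' -> hit p x = hit p' x.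
Proof.
by move=> e; rewrite /hit /towards /exit_weight /step_weight /exit_thr /exit_var /focus /reg !idx_succ e.
Qed.

Lemma vertex_idx p p' x q : idx p = idx p' -> vertex p x q = vertex p' x q.
Proof.
move=> e; elim: q => [//|q IH] /=; rewrite IH; apply: hit_idx.
by apply: val_inj; move/(congr1 val): e => /= e; rewrite -modnDml e modnDml.
Qed.

Lemma hit_towards p x rho : 0 < rho -> start p x -> hit p (towards p x rho) = hit p x.
Proof.
move=> r0 hs; have w0 := exit_weight_gt0 hs.
have e : 1 + exit_weight p (towards p x rho) = rho * (1 + exit_weight p x).
  rewrite [exit_weight p (towards _ _ _)]exit_weightE towards_exit mulrAC divff ?mul1r; last by rewrite gt_eqF // focus_beyond.
  ring.
rewrite /hit e; apply/rowP => l; rewrite /towards !mxE; field.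
by rewrite (gt_eqF r0) gt_eqF //; lra.
Qed.

(** * The periodic orbit through the fixed point *)

Section Limit.
Variable xs : 'rV[R]_n.
Hypothesis hlim : limit_cycle xs.

Let hxs : start 0 xs. Proof. by case: hlim. Qed.
Let fixk : vertex 0 xs k = xs. Proof. by case: hlim. Qed.

Lemma limit_at_pos : at_pos 0 xs.
Proof.
apply/(at_pos_per 0); rewrite -fixk; have := @vertex_at_pos 0 xs k.-1 hxs.
by rewrite prednK.
Qed.

Lemma limit_vertex_per q : vertex 0 xs (q + k) = vertex 0 xs q.
Proof. by rewrite addnC vertex_add fixk vertex_per. Qed.

Lemma limit_vertex_idx q q' : idx q = idx q' -> vertex 0 xs q = vertex 0 xs q'.
Proof.
have h i r : vertex 0 xs (i * k + r) = vertex 0 xs r.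
  by elim: i => [//|i IH]; rewrite mulSn -addnA addnC limit_vertex_per.
move=> /(congr1 val) /= e.
by rewrite (divn_eq q k) (divn_eq q' k) !h e.
Qed.

Let P : R := hit_time 0 xs k.

Lemma limit_hit_time q : hit_time 0 xs (q + k) = hit_time 0 xs q + P.
Proof. by rewrite addnC hit_time_add fixk hit_time_per addrC. Qed.

Lemma period_gt0 : 0 < P.
Proof. by rewrite /P -(prednK k0); apply: le_lt_trans (hit_time_lt _ hxs); apply: hit_time_ge0. Qed.

Lemma limit_hit_time_unbounded t : exists q, t < hit_time 0 xs q.
Proof.
have h j : hit_time 0 xs (j * k) = j%:R * P.
  elim: j => [|j IH]; first by rewrite mul0n mul0r.
  by rewrite mulSn addnC limit_hit_time IH -[j.+1]addn1 natrD mulrDl mul1r.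
have P0 := period_gt0.
exists ((Num.truncn (`|t| / P)).+1 * k)%N; rewrite h -ltr_pdivrMr //.
have h1 : t / P <= `|t| / P by rewrite ler_pM2r ?invr_gt0 // ler_norm.
apply: le_lt_trans h1 _; apply: truncnS_gt.
Qed.

Definition orbit_solution : R -> 'rV[R]_n := solution 0 xs.

Definition orbit : set 'rV[R]_n := [set orbit_solution t | t in [set t : R | 0 <= t]].

Lemma orbit_trajectory : trajectory O +oo%E orbit_solution.
Proof.
apply: solution_trajectory limit_at_pos _ _ => // t _; exact: limit_hit_time_unbounded.
Qed.

Lemma orbit_period t : 0 <= t -> orbit_solution (t + P) = orbit_solution t.
Proof.
move=> t0; have [q h1 h2] := piece_exists hxs t0 (limit_hit_time_unbounded t).
rewrite /orbit_solution (@solution_piece 0 xs q t) //; [|by right|exact: ltW].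
rewrite (@solution_piece 0 xs (q + k)) //; last first.
- by rewrite -addSn limit_hit_time lerD2r ltW.
- by right; rewrite limit_hit_time lerD2r.
by rewrite limit_hit_time limit_vertex_per !add0n focus_per; congr region_flow; ring.
Qed.

Lemma orbit_period_mul t j : 0 <= t -> orbit_solution (t + j%:R * P) = orbit_solution t.
Proof.
move=> t0; elim: j => [|j IH]; first by rewrite mul0r addr0.
rewrite -[j.+1]addn1 natrD mulrDl mul1r addrA orbit_period // addr_ge0 // mulr_ge0 //.
exact/ltW/period_gt0.
Qed.

Lemma orbit_seg q s : 0 <= s <= 1 -> orbit (seg (vertex 0 xs q) (vertex 0 xs q.+1) s).
Proof.
move=> hs; have hq := vertex_start q hxs.
have [t /andP[t0 t1] e] := seg_flow hq hs.
exists (t + hit_time 0 xs q); first by rewrite /= addr_ge0 // hit_time_ge0.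
rewrite /orbit_solution (@solution_piece 0 xs q) //; last by rewrite hit_timeS addrC lerD2l.
  by rewrite addrK e.
by right; rewrite lerDr.
Qed.

Lemma orbit_periodic : periodic_orbit O orbit.
Proof.
exists orbit_solution, P; split => //; [exact: period_gt0|exact: orbit_trajectory|].
by move=> t; apply: orbit_period.
Qed.

Lemma orbit_point g : orbit g -> exists q s, [/\ 0 <= s <= 1,
  g = seg (vertex 0 xs q) (vertex 0 xs q.+1) s, at_pos q g & hit q g = vertex 0 xs q.+1].
Proof.
case=> t /= t0 <-; have [q h1 h2] := piece_exists hxs t0 (limit_hit_time_unbounded t).
have hq := vertex_start q hxs.
have E : orbit_solution t = region_flow (focus q) (vertex 0 xs q) (t - hit_time 0 xs q).
  by apply: solution_piece => //; [right|apply: ltW].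
have [|s hs e] := @flow_seg (0 + q) (vertex 0 xs q) (t - hit_time 0 xs q) hq.
  by rewrite subr_ge0 h1 lerBlDl ltW.
exists q, s; split => //.
- by rewrite E e.
- by apply: (@solution_at_pos 0 xs q t limit_at_pos); rewrite h1.
- by rewrite E flow_towards; apply: hit_towards; [apply: expR_gt0|].
Qed.

(** The position of [g] on its segment does not matter: the flow from any
    point of the segment leads to the same end point. *)
Lemma orbit_vertex g p q : orbit g -> at_pos p g ->
  vertex p g q.+1 = vertex 0 xs (p + q.+1).
Proof.
move=> hg hp; have [q0 [s [_ _ hq0 hh]]] := orbit_point hg.
have e := at_pos_unique hp hq0.
rewrite -(add1n q) vertex_add.
have e1 : vertex p g 1 = vertex 0 xs q0.+1 by rewrite /= addn0 (hit_idx _ e).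
rewrite e1 (_ : vertex 0 xs q0.+1 = vertex 0 xs (p + 1)); last first.
  apply: limit_vertex_idx; rewrite addn1 !idx_succ e //.
by rewrite addnA [RHS]vertex_add.
Qed.

Lemma orbit_seg_from g p q s : orbit g -> at_pos p g -> 0 <= s <= 1 ->
  orbit (seg (vertex p g q) (vertex p g q.+1) s).
Proof.
move=> hg hp hs; rewrite orbit_vertex //.
case: q => [|q]; last by rewrite orbit_vertex // [in X in seg _ X]addnS; apply: orbit_seg.
have [q0 [s0 [hs0 e hq0 hh]]] := orbit_point hg.
have ei := at_pos_unique hp hq0.
have -> : vertex 0 xs (p + 1) = vertex 0 xs q0.+1.
  by apply: limit_vertex_idx; rewrite addn1 !idx_succ ei.
have -> : seg (vertex p g 0) (vertex 0 xs q0.+1) s =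
    seg (vertex 0 xs q0) (vertex 0 xs q0.+1) (s0 + s * (1 - s0)).
  by rewrite /= {1}e /seg; apply/rowP => l; rewrite !mxE; ring.
apply: orbit_seg; move: hs0 hs => /andP[a1 a2] /andP[b1 b2].
have : 0 <= s * (1 - s0) by rewrite mulr_ge0 ?subr_ge0.
have : s * (1 - s0) <= 1 - s0 by rewrite ler_piMl // subr_ge0.
by move=> c1 c2; apply/andP; split; lra.
Qed.

Lemma limit_attracts x p : (p <= k)%N -> start p x -> forall e : R, 0 < e ->
  exists Q, forall q, (Q <= q)%N -> ball (vertex 0 xs (p + q)) e (vertex p x q).
Proof.
move=> pk hs e e0; have h0 := vertex_start (k - p) hs; rewrite subnKC // in h0.
have h0' : start 0 (vertex p x (k - p)) by apply/(start_per 0).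
have [_ _ att _] := hlim; have [Q hQ] := att _ h0' e e0.
exists (k - p + Q)%N => q hq; have le : (k - p <= q)%N by apply: leq_trans hq; rewrite leq_addr.
have -> : vertex 0 xs (p + q) = vertex 0 xs (q - (k - p)).
  have -> : (p + q = q - (k - p) + k)%N by lia.
  exact: limit_vertex_per.
have -> : vertex p x q = vertex 0 (vertex p x (k - p)) (q - (k - p)).
  rewrite -[in LHS](subnKC le) vertex_add subnKC // -[k in LHS]add0n.
  exact: (vertex_per 0).
by apply: hQ; lia.
Qed.

Lemma orbit_attracts (T : \bar R) (y : R -> 'rV[R]_n) :
  maximal_trajectory O T y -> converges_to T y orbit.
Proof.
move=> hm; have tr := hm.1; have [T0 _ hc _ _] := tr.
have [p pk hp] := cycle_set_at_pos (hc 0 (lexx 0) T0); have hs := at_pos_start hp.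
move=> e e0; have [Q hQ] := limit_attracts pk hs e0.
exists (hit_time p (y 0) Q); split; [exact: hit_time_ge0|exact: maximal_reaches|].
move=> t t1 t2; have dt : dom T t by split => //; apply: le_trans t1; apply: hit_time_ge0.
have [q [s [/andP[h1 h2] hs1 ->]]] := on_segment tr hp dt.
have Qq := late_piece hs t1 h2.
exists (seg (vertex 0 xs (p + q)) (vertex 0 xs (p + q).+1) s); first exact: orbit_seg.
apply/rV_ballP; split => // l; apply: seg_near => //.
  by have /rV_ballP[_ ->] := hQ q Qq.
by have /rV_ballP[_] := hQ q.+1 (leqW Qq); rewrite addnS; apply.
Qed.

(** The distance is controlled by continuity up to the position 2 k, where
    the trajectory crosses a wall at [xs], and from then on by the stability
    of [xs]. *)
Lemma vertex_stable g p : orbit g -> (p <= k)%N -> at_pos p g -> forall e : R, 0 < e ->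
  exists2 d : R, 0 < d & forall z, start p z -> ball g d z ->
    forall q, ball (vertex p g q) e (vertex p z q).
Proof.
move=> hg pk hp e e0; have hs := at_pos_start hp.
have [_ _ _ stab] := hlim; have [d1 d10 hd1] := stab e e0.
have [r [r0 pr]] : exists r, (0 < r)%N /\ (p + r = k + k)%N.
  by exists (k - p + k)%N; split; lia.
pose e1 := Num.min e d1.
have e10 : 0 < e1 by rewrite lt_min e0.
have : \forall z \near g, forall i : 'I_r.+1, ball (vertex p g i) e1 (vertex p z i).
  by apply: (@filter_forall _ _ _ (nbhs g) (nbhs_filter g)) => i; apply: vertex_near.
move=> /nbhs_ballP[d /= d0 hd]; exists d => // z hz hgz q.
have hi i : (i < r.+1)%N -> ball (vertex p g i) e1 (vertex p z i).
  by move=> ir; have := hd z hgz (Ordinal ir).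
have [qr|rq] := ltnP q r.+1.
  apply: (le_ball (e1 := e1)); last exact: hi.
  by rewrite ge_min lexx.
have per0 w i : vertex (p + r) w i = vertex 0 w i.
  by rewrite pr vertex_per -[k]add0n vertex_per.
have rq' : (r <= q)%N by apply: ltnW.
have gr : vertex p g r = xs.
  rewrite -(prednK r0) orbit_vertex // prednK // pr limit_vertex_per -[k]add0n.
  by rewrite limit_vertex_per.
rewrite -(subnKC rq') !vertex_add !per0 gr; apply: hd1.
  by have := vertex_start r hz; rewrite pr start_per -[k]add0n start_per.
have := hi r (leqnn _); rewrite gr; apply: le_ball; by rewrite ge_min lexx orbT.
Qed.

(** Closeness to the orbit of the whole polygonal line that starts at [z],
    which contains the trajectory from [z]. *)
Definition stays_close (e : R) (z : 'rV[R]_n) : Prop :=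
  forall p q s, (p <= k)%N -> at_pos p z -> 0 <= s <= 1 ->
    neighborhood orbit e (seg (vertex p z q) (vertex p z q.+1) s).

(** If [g] lies in a region, then nearby points are in the same region and
    [vertex_stable] applies. If [g] lies on a wall, a nearby point may still
    have to cross that wall; it does so close to [g], and [vertex_stable]
    applies from there on. *)
Lemma stays_close_at g (e : R) : orbit g -> 0 < e ->
  exists2 d : R, 0 < d & forall z, ball g d z -> stays_close e z.
Proof.
move=> hg e0; have [q0 [_ [_ _ hq0 _]]] := orbit_point hg.
have [p0 pk0 hp0] := cycle_set_at_pos (at_pos_cycle_set hq0).
have [d1 d10 hd1] := vertex_stable hg pk0 hp0 e0.
have good z s q : start p0 z -> ball g d1 z -> 0 <= s <= 1 ->
    neighborhood orbit e (seg (vertex p0 z q) (vertex p0 z q.+1) s).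
  move=> hz hb hs; exists (seg (vertex p0 g q) (vertex p0 g q.+1) s); first exact: orbit_seg_from.
  have hv := hd1 z hz hb.
  by apply/rV_ballP; split => // l; apply: seg_near => //; [have /rV_ballP[_ ->] := hv q|have /rV_ballP[_ ->] := hv q.+1].
have same z p : at_pos p z -> idx p = idx p0 -> ball g d1 z -> forall q s, 0 <= s <= 1 ->
    neighborhood orbit e (seg (vertex p z q) (vertex p z q.+1) s).
  move=> hz ei hb q s hs; rewrite !(vertex_idx z _ ei); apply: good => //.
  exact: start_idx ei (at_pos_start hz).
case: (hp0) => [hr|[i ei hw]].
  have [d2 d20 hd2] := region_open hr.
  exists (Num.min d1 d2); first by rewrite lt_min d10.
  move=> z /rV_ballP[_ hz] p q s pk hpz hs.
  have hz1 : ball g d1 z.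
    by apply/rV_ballP; split=> // l; have := hz l; rewrite lt_min => /andP[].
  apply: same => //; apply: (at_pos_unique hpz (p' := p0)); left; apply: hd2 => l.
  by have := hz l; rewrite lt_min => /andP[].
have hw' := hw; rewrite cycle_wallE in hw'.
have [d2 d20 hd2] := wall_local hw'.
have [hx _] := (wallE _ _).1 hw'.
have wg : exit_weight i g = 0 by rewrite exit_weightE hx subrr mulr0 mul0r.
have hg1 : hit i g = g by rewrite /hit wg addr0 invr1 /towards scale1r addrC subrK.
pose e1 := Num.min e d1; have e10 : 0 < e1 by rewrite lt_min e0.
have [d3 d30 hd3] : exists2 d : R, 0 < d & forall z, ball g d z -> ball g e1 (hit i z).
  have hc : {for g, continuous (hit i)} by apply: hit_continuous; rewrite wg.
  have /cvg_ballP/(_ e1 e10) := hc; rewrite hg1 => /nbhs_ballP[d /= d0 hd].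
  by exists d.
exists (Num.min (Num.min d1 e) (Num.min d2 d3)); first by rewrite !lt_min d10 e0 d20.
move=> z /rV_ballP[_ hz] p q s pk hpz hs.
have hz1 : ball g d1 z.
  by apply/rV_ballP; split=> // l; have := hz l; rewrite !lt_min -!andbA => /and4P[].
have hze : ball g e z.
  by apply/rV_ballP; split=> // l; have := hz l; rewrite !lt_min -!andbA => /and4P[].
have hz2 l : `|g 0 l - z 0 l| < d2.
  by have := hz l; rewrite !lt_min -!andbA => /and4P[].
have hz3 : ball g d3 z.
  by apply/rV_ballP; split=> // l; have := hz l; rewrite !lt_min -!andbA => /and4P[].
have [g1 g2 g3] := hd2 z hz2.
have e_i : idx i.+1 = idx p0 by rewrite idx_succ idx_ord ei.
have [lt|lt|eq] := ltgtP (exit_sign i * (z 0 (exit_var i) - exit_thr i)) 0; first last.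
- have e1' : z 0 (exit_var i) = exit_thr i.
    by move/eqP: eq; rewrite mulf_eq0 (negbTE (exit_sign_neq0 i)) subr_eq0 => /eqP.
  apply: same => //; rewrite -e_i; apply: (at_pos_unique hpz).
  exact/at_pos_wall/g3.
- apply: same => //; rewrite -e_i; apply: (at_pos_unique hpz); left; exact: g1.
(* z has yet to cross the wall that g lies on, and does so close to g *)
have hzi : start i z by apply/region_start/g2.
have epi : idx p = idx i by apply: (at_pos_unique hpz); left; apply: g2.
have hh := hd3 z hz3.
have hh1 : ball g d1 (hit i z) by apply: le_ball hh; rewrite ge_min lexx orbT.
have hhe : ball g e (hit i z) by apply: le_ball hh; rewrite ge_min lexx.
have v1 : vertex p z 1 = hit i z by rewrite /= addn0 (hit_idx _ epi).
have sh : start p0 (hit i z) by apply: start_idx e_i _; apply: hit_start.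
case: q => [|q].
  exists (seg g g s); first by rewrite /seg subrr scaler0 addr0.
  rewrite v1; apply/rV_ballP; split => // l; apply: seg_near => //.
    by have /rV_ballP[_ ->] := hze.
  by have /rV_ballP[_ ->] := hhe.
have shift r : vertex p z r.+1 = vertex p0 (hit i z) r.
  rewrite -(add1n r) vertex_add v1; apply: vertex_idx.
  by rewrite addn1 idx_succ epi -idx_succ e_i.
by rewrite !shift; apply: good.
Qed.

Lemma orbit_compact : compact orbit.
Proof.
have -> : orbit = orbit_solution @` `[0, P].
  apply/seteqP; split => [g [t /= t0 <-]|g [t]]; last first.
    by rewrite /= in_itv /= => /andP[t0 _] <-; exists t.
  have P0 := period_gt0.
  pose j := Num.truncn (t / P).
  have tP0 : 0 <= t / P by rewrite divr_ge0 // ltW.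
  have j1 : j%:R * P <= t by rewrite -ler_pdivlMr // truncn_le.
  have j2 : t < j%:R * P + P.
    have -> : j%:R * P + P = j.+1%:R * P by rewrite -[j.+1]addn1 natrD mulrDl mul1r.
    by rewrite -ltr_pdivrMr //; apply: truncnS_gt.
  exists (t - j%:R * P); first by rewrite /= in_itv /=; apply/andP; split; lra.
  by rewrite -[in RHS](subrK (j%:R * P) t) orbit_period_mul // subr_ge0.
apply: continuous_compact; last exact: segment_compact.
have [_ hc _ _ _] := orbit_trajectory.
apply: continuous_subspaceW hc => t; rewrite /= in_itv /= => /andP[t0 _].
by split => //; rewrite ltry.
Qed.

(** The radius of [stays_close_at] depends on the point of the orbit; by
    compactness one radius serves for all of them. *)
Lemma orbit_stays_close (e : R) : 0 < e -> exists2 d : R, 0 < d &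
  forall g z, orbit g -> ball g d z -> stays_close e z.
Proof.
move=> e0; have /compact_near_coveringP := orbit_compact.
move=> /(_ R (0 : R)^'+ (fun d g => forall z, ball g d z -> stays_close e z)) h.
have : \forall d \near (0 : R)^'+, orbit `<=` (fun g => forall z, ball g d z -> stays_close e z).
  apply: h => g hg; have [d d0 hd] := stays_close_at hg e0.
  have d20 : 0 < d / 2 by rewrite divr_gt0.
  exists (ball g (d / 2), [set d' : R | 0 < d' < d / 2]).
    split; first exact: nbhsx_ballx.
    by apply: filterS (filterI (nbhs_right_gt (0 : R)) (nbhs_right_lt d20)) => d' [a b]; apply/andP.
  case=> g' d' /= [hg' /andP[d'0 d'2]] z hz; apply: hd.
  have -> : d = d / 2 + d / 2 by lra.
  by apply: ball_triangle hg' _; apply: le_ball hz; apply: ltW.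
rewrite near_withinE => /nbhs_ballP[d /= d0 hd].
exists (d / 2); first by rewrite divr_gt0.
move=> g z hg hz; apply: (hd (d / 2) _ _ g hg z hz); last by rewrite divr_gt0.
by rewrite /ball /= sub0r normrN gtr0_norm; lra.
Qed.

Lemma orbit_asymptotically_stable : asymptotically_stable O orbit.
Proof.
split; last first.
  by exists 1 => // T y hm _; apply: orbit_attracts.
move=> e e0; have [d d0 hd] := orbit_stays_close e0; exists d => // T y hm [g hg hb] t t0 tT.
have tr := hm.1; have [T0 _ hc _ _] := tr.
have [p pk hp] := cycle_set_at_pos (hc 0 (lexx 0) T0).
have [q [s [_ hs ->]]] := on_segment tr hp (conj t0 tT).
exact: hd hg hb p q s pk hp hs.
Qed.

Lemma periodic_mul (y : R -> 'rV[R]_n) (Q : R) : 0 < Q ->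
  (forall t, 0 <= t -> y (t + Q) = y t) -> forall t j, 0 <= t -> y (t + j%:R * Q) = y t.
Proof.
move=> Q0 hy t j t0; elim: j => [|j IH]; first by rewrite mul0r addr0.
by rewrite -[j.+1]addn1 natrD mulrDl mul1r addrA hy // addr_ge0 // mulr_ge0 // ltW.
Qed.

(** A periodic orbit converges to [orbit] and returns to each of its points,
    hence is contained in the closed set [orbit]. As both wind around the
    cycle through the same crossing points, they are equal. *)
Lemma orbit_unique G : periodic_orbit O G -> orbit = G.
Proof.
move=> [y [Q [Q0 tr hper ->]]].
have hm : maximal_trajectory O +oo%E y by split => // T' z _ _; rewrite leey.
have hG t : 0 <= t -> orbit (y t).
  move=> t0; have cl := compact_closed (@norm_hausdorff _ 'rV[R]_n) orbit_compact.
  apply: cl => U /nbhs_ballP[e /= e0 hU].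
  have [t1 [t10 _ ht1]] := orbit_attracts hm e0.
  pose j := (Num.truncn (t1 / Q)).+1.
  have h1 : t1 <= t + j%:R * Q.
    apply: ler_wpDl => //; rewrite -ler_pdivrMr //; apply/ltW/truncnS_gt.
  have [g hg hb] := ht1 _ h1 (ltry _).
  rewrite (periodic_mul Q0 hper) // in hb.
  by exists g; split => //; apply: hU; apply: ball_sym.
have hg := hG 0 (lexx 0).
have [q0 [s0 [hs0 _ hp _]]] := orbit_point hg.
have hs := at_pos_start hp.
apply/seteqP; split => [g' hg'|_ [t /= t0 <-]]; last exact: hG.
have [t' /= t'0 <-] := hg'.
have [q1 h1 h2] := piece_exists hxs t'0 (limit_hit_time_unbounded t').
pose r := (q1 + q0 * k + k - q0)%N.
have le0 : (q0 <= q0 * k)%N by rewrite leq_pmulr.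
have r0 : (0 < r)%N by rewrite /r; lia.
have er : (q0 + r = q1 + (q0 + 1) * k)%N by rewrite /r mulnDl mul1n; lia.
have ei : idx (q0 + r) = idx q1.
  by apply: val_inj; rewrite /= er addnC modnMDl.
have ev : vertex q0 (y 0) r = vertex 0 xs q1.
  by rewrite -(prednK r0) orbit_vertex // prednK //; apply: limit_vertex_idx.
have ef : focus (q0 + r) = focus q1 by rewrite /focus /reg ei.
have ed : duration (q0 + r) (vertex 0 xs q1) = duration q1 (vertex 0 xs q1).
  by rewrite /duration /exit_weight /step_weight /exit_thr /exit_var /focus /reg !idx_succ ei.
pose t := (t' - hit_time 0 xs q1 + hit_time q0 (y 0) r).
have tpos : 0 <= t by rewrite /t addr_ge0 ?subr_ge0 // hit_time_ge0.
exists t => //.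
rewrite (traj_solution tr hp (conj tpos (ltry _))).
rewrite (@solution_piece q0 (y 0) r) //; first last.
- by rewrite hit_timeS ev ed /t addrC lerD2l lerBlDl -[q1 in duration q1]add0n -hit_timeS ltW.
- by right; rewrite /t lerDr subr_ge0.
rewrite /orbit_solution (@solution_piece 0 xs q1) //; [|by right|exact: ltW].
by rewrite ev ef /t addrK.
Qed.

Lemma limit_unique_stable : unique_stable_periodic_orbit O.
Proof.
exists orbit; last exact: orbit_asymptotically_stable.
by split; [exact: orbit_periodic|exact: orbit_unique].
Qed.

End Limit.

(** * Convergence to the spine *)

Definition crossed (l : 'I_n) : Prop := exists p, exit_var p = l.

Lemma level_uncrossed l p : ~ crossed l -> reg p l = reg 0 l.
Proof.
move=> h; elim: p => [//|p IH]; rewrite reg_same //.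
by apply/eqP => e; apply: h; exists p.
Qed.

(** The threshold of a variable that is crossed at this threshold only is an
    end of each interval that the variable visits. *)
Lemma exit_thr_closed_between p i : ~ multi exit_var exit_thr ->
  closed_between (exit_var p) (reg i (exit_var p)) (exit_thr p).
Proof.
move=> nm; have nm' q : exit_var q = exit_var p -> exit_thr q = exit_thr p.
  by move=> e; apply: contrapT => ne; apply: nm; exists q, p.
have hex : exists c, (i <= c)%N && (exit_var c == exit_var p).
  exists (p + i * k)%N; apply/andP; split.
    by apply: leq_trans (leq_addl _ _); rewrite leq_pmulr.
  apply/eqP; elim: (i) => [|j IH]; first by rewrite mul0n addn0.
  by rewrite mulSn addnCA addnC exit_var_per.
case: (ex_minnP hex) => c /andP[ic /eqP ec] cmin.
have lev : reg c (exit_var p) = reg i (exit_var p).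
  have h d : (i <= d)%N -> (d <= c)%N -> reg d (exit_var p) = reg i (exit_var p); last exact: h.
  elim: d => [|d IH] id dc; first by move: id; rewrite leqn0 => /eqP ->.
  move: id; rewrite leq_eqVlt => /predU1P[<-//|id].
  rewrite reg_same; last first.
    by apply/eqP => e; have := cmin d; rewrite e eqxx andbT => /(_ id); rewrite leqNgt dc.
  by apply: IH => //; apply: ltnW.
rewrite -lev -(nm' c ec) -ec.
have [hu|hu] := boolP (upward c).
  have [e1 ->] := upward_level hu; split => hj //.
  by apply/ltW/thr_lt; rewrite hj -e1 reg_le.
have [e1 ->] := downward_level hu; split => hj //.
by apply/ltW/thr_lt; rewrite hj e1.
Qed.

(** Without multiple thresholds, a point whose crossed coordinates sit at
    their thresholds is a limit of points of each wall: push it slightly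
    towards an arbitrary point of the wall. *)
Lemma spine_point (x : 'rV[R]_n) : ~ multi exit_var exit_thr -> (forall p, x 0 (exit_var p) = exit_thr p) ->
  (forall l, ~ crossed l -> closed_between l (reg 0 l) (x 0 l)) -> spine O x.
Proof.
move=> nm h1 h2 i _ U /nbhs_ballP[e /= e0 hU].
have hx l : closed_between l (reg i l) (x 0 l).
  have [[p <-]|hn] := pselect (crossed l); first by rewrite h1; apply: exit_thr_closed_between.
  by rewrite level_uncrossed //; apply: h2.
have [x0 hx0] := region_point (reg i).
have [w hw] : exists w, wall (reg i) (reg i.+1) w.
  by exists (hit i x0); apply: hit_wall (region_start hx0).
have [w1 w2] := (wallE _ _).1 hw.
pose M := 1 + \sum_l `|w 0 l - x 0 l|.
have M0 : 1 <= M by rewrite lerDl sumr_ge0.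
pose r := Num.min 1 (e / (2 * M)).
have M2 : 0 < 2 * M by lra.
have r0 : 0 < r by rewrite lt_min ltr01 divr_gt0.
have r1 : r <= 1 by rewrite ge_min lexx.
have rM : r * M < e.
  apply: (@le_lt_trans _ _ (e / (2 * M) * M)).
    by apply: ler_wpM2r; [lra|rewrite ge_min lexx orbT].
  have -> : e / (2 * M) * M = e / 2 by field; lra.
  lra.
pose z := seg x w r.
exists z; split.
  rewrite cycle_wallE; apply/wallE; split.
    by rewrite /z /seg !mxE w1 h1 subrr mulr0 addr0.
  move=> l ne; have [c1 c2] := hx l; have /(betweenP _ (reg_le _ _))[b1 b2] := w2 l ne.
  have -> : z 0 l = (1 - r) * x 0 l + r * w 0 l by rewrite /z /seg !mxE; ring.
  have r1' : 0 <= 1 - r by lra.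
  apply/(betweenP _ (reg_le _ _)); split => hj.
    have a1 := ler_wpM2l r1' (c1 hj); have := b1 hj; rewrite -(ltr_pM2l r0) => a2; lra.
  have a1 := ler_wpM2l r1' (c2 hj); have := b2 hj; rewrite -(ltr_pM2l r0) => a2; lra.
apply: hU; apply/rV_ballP; split => // l.
have -> : x 0 l - z 0 l = - (r * (w 0 l - x 0 l)) by rewrite /z /seg !mxE; ring.
rewrite normrN normrM (gtr0_norm r0); apply: le_lt_trans rM; rewrite ler_pM2l //.
rewrite /M (bigD1 l) //= addrCA lerDl addr_ge0 // sumr_ge0 //.
Qed.

Lemma crossed_or l : {p | exit_var p = l} + ~ crossed l.
Proof. by case: (pselect (crossed l)) => [/cid|]; [left|right]. Qed.

(** A point of the spine at a distance from [x] given by the crossed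
    coordinates alone. *)
Definition collapse (x : 'rV[R]_n) : 'rV[R]_n :=
  \row_l (if crossed_or l is inl p then exit_thr (sval p) else x 0 l).

Lemma collapse_spine (x : 'rV[R]_n) : ~ multi exit_var exit_thr ->
  (forall l, ~ crossed l -> closed_between l (reg 0 l) (x 0 l)) -> spine O (collapse x).
Proof.
move=> nm h; apply: spine_point => //.
  move=> p; rewrite mxE; case: crossed_or => [[q e]|[]]; last by exists p.
  by apply: contrapT => ne; apply: nm; exists q, p.
move=> l hl; rewrite mxE; case: crossed_or => [[q e]|_]; last exact: h.
by case: hl; exists q.
Qed.

(** Without multiple thresholds, the spine contains the collapse of each
    point of a region. *)
Lemma ideal_multi : ideal O -> multi exit_var exit_thr.
Proof.
move=> hi; apply: contrapT => nm; have [x hx] := region_point (reg 0).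
have : spine O (collapse x).
  by apply: collapse_spine => // l _; apply: between_closed (hx l); apply: reg_le.
by rewrite hi.
Qed.

Lemma degenerate_converges : ~ multi exit_var exit_thr -> all_degenerate -> all_converge_to_spine O.
Proof.
move=> nm hdeg T y hm; have tr := hm.1; have [T0 _ hc _ _] := tr.
have [p pk hp] := cycle_set_at_pos (hc 0 (lexx 0) T0); have hs := at_pos_start hp.
move=> e e0; have h0 := vertex_start (k - p) hs; rewrite subnKC // in h0.
have h0' : start 0 (vertex p (y 0) (k - p)) by apply/(start_per 0).
have [Q hQ] := hdeg _ h0' e e0.
have hQ' q r : (k - p + Q <= q)%N -> `|vertex p (y 0) q 0 (exit_var r) - exit_thr r| < e.
  move=> hq; have le : (k - p <= q)%N by apply: leq_trans hq; rewrite leq_addr.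
  rewrite -(subnKC le) vertex_add subnKC // -[k]add0n vertex_per; apply: hQ.
  by rewrite add0n; lia.
exists (hit_time p (y 0) (k - p + Q)); split; [exact: hit_time_ge0|exact: maximal_reaches|].
move=> t t1 t2; have dt : dom T t by split => //; apply: le_trans t1; apply: hit_time_ge0.
have [q [s [/andP[g1 g2] hs1 ey]]] := on_segment tr hp dt.
have Qq := late_piece hs t1 g2.
exists (collapse (y t)).
  apply: collapse_spine => // l hl.
  have [p' _ hp'] := cycle_set_at_pos (hc t dt.1 t2).
  by rewrite -(level_uncrossed p' hl); apply: (at_pos_start hp').1.
apply/rV_ballP; split => // l; rewrite mxE; case: crossed_or => [[r er]|_]; last by rewrite subrr normr0.
rewrite [sval _]/=; have -> : exit_thr r = seg (const_mx (exit_thr r)) (const_mx (exit_thr r)) s 0 l.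
  by rewrite /seg !mxE; ring.
rewrite ey; apply: seg_near => //; rewrite mxE distrC -er; apply: hQ' => //.
exact: leqW.
Qed.

(** A periodic trajectory that converges to the closed spine would start in
    the spine, which is disjoint from the cycle. *)
Lemma spine_no_periodic : all_converge_to_spine O -> ~ exists G, periodic_orbit O G.
Proof.
move=> hall [G [y [Q [Q0 tr hper _]]]].
have hm : maximal_trajectory O +oo%E y by split => // T' z _ _; rewrite leey.
have [T0 _ hc _ _] := tr.
apply: (@spine_disjoint (y 0)); last exact: hc (lexx 0) T0.
move=> i _ U /nbhs_ballP[e /= e0 hU].
have e20 : 0 < e / 2 by rewrite divr_gt0.
have [t1 [t10 _ ht1]] := hall _ _ hm _ e20.
pose j := (Num.truncn (t1 / Q)).+1.
have h1 : t1 <= 0 + j%:R * Q.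
  by rewrite add0r -ler_pdivrMr //; apply/ltW/truncnS_gt.
have [g hg hb] := ht1 _ h1 (ltry _).
rewrite (periodic_mul Q0 hper) // in hb.
have [z [hz1 hz2]] := hg i I _ (nbhsx_ballx g _ e20).
exists z; split => //; apply: hU.
have -> : e = e / 2 + e / 2 by lra.
by apply: ball_triangle hz2; apply: ball_sym.
Qed.

End Cycle.

Theorem theorem5p12 (R : realType) (n : nat) (N : glass_network R n)
    (k : nat) (O : 'I_k -> region_index N) :
  general_network N -> cyclic_attractor O ->
  (ideal O -> unique_stable_periodic_orbit O) /\
  (~ ideal O ->
     unique_stable_periodic_orbit O \/
     (all_converge_to_spine O /\ ~ (exists G, periodic_orbit O G))).
Proof.
move=> _ attr; have [[xs hxs]|[nm hdeg]] := discrete_dichotomy attr.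
  by split => _; [|left]; exact: limit_unique_stable hxs.
split=> [/(ideal_multi attr)//|_]; right.
have hall := degenerate_converges nm hdeg.
by split => //; exact: spine_no_periodic attr hall.
Qed.
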